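(* Let $n \geq 2$ and let $f: \mathbb{S}^n \rightarrow \mathbb{C}$ be a smooth function on the unit round sphere $\mathbb{S}^n \subset \mathbb{R}^{n+1}$. Then $f$ is a $(\lambda,\mu)$-eigenfunction on $\mathbb{S}^n$ (for some $\lambda,\mu\in\mathbb{C}$) if and only if there exists a homogeneous polynomial $F: \mathbb{R}^{n+1} \rightarrow \mathbb{C}$ (with complex coefficients) such that $f = F|_{\mathbb{S}^n}$ and $F$ is a $(0,0)$-eigenfunction on $\mathbb{R}^{n+1}$.
   Context: Let $(M,g)$ be a Riemannian manifold, and extend $g$ to a complex bilinear form on the complexified tangent bundle $T^{\mathbb{C}}M$. For smooth functions $\varphi,\psi: M\to\mathbb{C}$ define the Laplace-Beltrami operator $\tau(\varphi) := \operatorname{div}\operatorname{grad}\varphi$ and the bilinear conformality operator $\varkappa(\varphi,\psi) := g(\operatorname{grad}\varphi,\operatorname{grad}\psi)$ (complex bilinear, not Hermitian). A function $f: M\to\mathbb{C}$ is called a $(\lambda,\mu)$-eigenfunction (or complex-valued eigenfunction) if there exist $\lambda,\mu\in\mathbb{C}$ such that $\tau(f)=\lambda f$ and $\varkappa(f,f)=\mu f^2$. In particular, $F$ is a $(0,0)$-eigenfunction on $\mathbb{R}^{n+1}$ (with the Euclidean metric) if $\tau(F)=0$ and $\varkappa(F,F)=0$. The sphere $\mathbb{S}^n$ carries its canonical round metric. *)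

(* Defs.v *)
From mathcomp Require Import all_boot all_order all_algebra.
From mathcomp Require Import all_classical all_reals all_analysis.
From mathcomp Require Import complex ring.
(* Only canonical instances and coercions are imported: the notations clash
   with those of mathcomp-analysis. *)
From mathcomp Require mpoly.
Import (canonicals, coercions) mpoly.

Set Implicit Arguments.
Unset Strict Implicit.
Unset Printing Implicit Defensive.

Import Order.TTheory GRing.Theory Num.Theory.
Import numFieldNormedType.Exports.
Local Open Scope ring_scope.
Local Open Scope complex_scope.

Section Coordinates.
Variables (R : realType) (m : nat).
Implicit Types (g : 'rV[R]_m -> 'M[R]_m) (phi psi : 'rV[R]_m -> R[i]).

Definition partial (h : 'rV[R]_m -> R) (i : 'I_m) (u : 'rV[R]_m) : R :=
  'D_(delta_mx 0 i) h u.

(* C^(k+1): all first partial derivatives exist everywhere and are C^k;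
   for k = 0 this implies differentiability, hence continuity of h. *)
Fixpoint Ck (k : nat) (h : 'rV[R]_m -> R) : Prop :=
  if k is k'.+1 then
    (forall i u, derivable h u (delta_mx 0 i)) /\
    (forall i, Ck k' (partial h i))
  else continuous h.

Definition Csmooth phi : Prop :=
  forall k, Ck k (fun u => complex.Re (phi u)) /\
            Ck k (fun u => complex.Im (phi u)).

Definition cpartial phi (i : 'I_m) (u : 'rV[R]_m) : R[i] :=
  partial (fun w => complex.Re (phi w)) i u +i*
  partial (fun w => complex.Im (phi w)) i u.

(* Complex bilinear extension of the metric. *)
Definition cmetric g (u : 'rV[R]_m) : 'M[R[i]]_m :=
  map_mx (real_complex R) (g u).

Definition volume g (u : 'rV[R]_m) : R := Num.sqrt (\det (g u)).

(* (grad phi)^i = \sum_j g^{ij} d_j phi *)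
Definition grad g phi (u : 'rV[R]_m) : 'rV[R[i]]_m :=
  \row_i \sum_j invmx (cmetric g u) i j * cpartial phi j u.

(* div X = 1 / sqrt(det g) * \sum_i d_i (sqrt(det g) * X^i) *)
Definition divergence g (X : 'rV[R]_m -> 'rV[R[i]]_m) (u : 'rV[R]_m) : R[i] :=
  ((volume g u)%:C)^-1 *
  \sum_i cpartial (fun w => (volume g w)%:C * X w 0 i) i u.

Definition tau g phi : 'rV[R]_m -> R[i] := divergence g (grad g phi).

Definition kappa g phi psi (u : 'rV[R]_m) : R[i] :=
  \sum_i \sum_j cmetric g u i j * grad g phi u 0 i * grad g psi u 0 j.

End Coordinates.

(* A Riemannian manifold presented by an atlas whose charts are parametrized
   by the whole of R^dim.  Only the data used below is recorded: [metric c] is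
   the Gram matrix of the metric in the chart [c]; that the transition maps are
   smooth and that the Gram matrices are positive definite and agree on
   overlaps are facts about the two instances defined below. *)
Record riemannian (R : realType) := Riemannian {
  point :> Type;
  dim : nat;
  chart_index : Type;
  chart : chart_index -> 'rV[R]_dim -> point;
  chart_cover : forall p : point, exists c u, chart c u = p;
  metric : chart_index -> 'rV[R]_dim -> 'M[R]_dim }.

Definition smooth (R : realType) (M : riemannian R) (f : M -> R[i]) : Prop :=
  forall c : chart_index M, Csmooth (f \o chart c).

Definition eigenfunction (R : realType) (M : riemannian R) (lambda mu : R[i])
    (f : M -> R[i]) : Prop :=
  forall (c : chart_index M) (u : 'rV[R]_(dim M)),
    tau (metric c) (f \o chart c) u = lambda * f (chart c u) /\
    kappa (metric c) (f \o chart c) (f \o chart c) u = mu * f (chart c u) ^+ 2.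

Arguments smooth {R} M f.
Arguments eigenfunction {R} M lambda mu f.

Section Euclidean.
Variables (R : realType) (m : nat).

Lemma euclid_cover (p : 'rV[R]_m) : exists (_ : unit) u, u = p.
Proof. by exists tt, p. Qed.

Definition euclid : riemannian R :=
  @Riemannian R 'rV[R]_m m unit (fun _ u => u) euclid_cover
    (fun _ _ => 1%:M).

End Euclidean.

Section Sphere.
Variables (R : realType) (n : nat).

Definition sqnorm (k : nat) (x : 'rV[R]_k) : R := \sum_i x 0 i ^+ 2.

Definition sphere_point : Type := {x : 'rV[R]_n.+1 | sqnorm x == 1}.

(* Inverse of the stereographic projection from the pole (1, 0, ..., 0) for
   s = false, and from (-1, 0, ..., 0) for s = true. *)
Definition stereo (s : bool) (u : 'rV[R]_n) : 'rV[R]_n.+1 :=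
  (1 + sqnorm u)^-1 *:
  row_mx (((-1) ^+ s * (sqnorm u - 1))%:M : 'rV_1) (2 *: u).

Lemma sqnorm_ge0 k (x : 'rV[R]_k) : 0 <= sqnorm x.
Proof. by apply: sumr_ge0 => i _; exact: sqr_ge0. Qed.

Lemma sqnormZ k a (x : 'rV[R]_k) : sqnorm (a *: x) = a ^+ 2 * sqnorm x.
Proof.
by rewrite /sqnorm mulr_sumr; apply: eq_bigr => i _; rewrite mxE exprMn.
Qed.

Lemma sqnorm_row_mx k l (x : 'rV[R]_k) (y : 'rV[R]_l) :
  sqnorm (row_mx x y) = sqnorm x + sqnorm y.
Proof.
by rewrite /sqnorm big_split_ord /=; congr (_ + _); apply: eq_bigr => i _;
  rewrite ?row_mxEl ?row_mxEr.
Qed.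

Lemma sqnorm_scalar (a : R) : sqnorm (a%:M : 'rV_1) = a ^+ 2.
Proof. by rewrite /sqnorm big_ord1 mxE eqxx mulr1n. Qed.

Lemma sqnormD1_neq0 k (x : 'rV[R]_k) : 1 + sqnorm x != 0.
Proof. by rewrite gt_eqF // ltr_wpDr // sqnorm_ge0. Qed.

Lemma stereo_on_sphere s u : sqnorm (stereo s u) == 1.
Proof.
apply/eqP; rewrite /stereo sqnormZ (@sqnorm_row_mx 1 n) sqnorm_scalar sqnormZ.
rewrite exprMn sqrr_sign mul1r; field.
exact: sqnormD1_neq0.
Qed.

Definition sphere_chart (s : bool) (u : 'rV[R]_n) : sphere_point :=
  exist _ (stereo s u) (stereo_on_sphere s u).

Lemma sphere_cover (p : sphere_point) : exists s u, sphere_chart s u = p.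
Proof.
case: p => x xS; pose x0 := x 0 0.
pose y : 'rV[R]_n := @rsubmx _ 1 1 n x.
have xE : x = row_mx (x0%:M : 'rV_1) y.
  rewrite -[LHS](@hsubmxK _ 1 1 n); congr (@row_mx _ 1 1 n _ _).
  apply/rowP => i; rewrite !mxE !ord1 eqxx mulr1n; congr (x _ _).
  exact/val_inj.
have yE : sqnorm y = 1 - x0 ^+ 2.
  by move/eqP: xS; rewrite xE (@sqnorm_row_mx 1 n) sqnorm_scalar => <-; ring.
pose s := 0 < x0; pose e : R := (-1) ^+ s.
have e2 : e ^+ 2 = 1 by exact: sqrr_sign.
have d0 : 1 - e * x0 != 0.
  rewrite /e /s; case: ltrP => x0p; rewrite ?expr1 ?expr0.
    by rewrite mulN1r opprK gt_eqF // addr_gt0.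
  by rewrite mul1r gt_eqF // subr_gt0 (le_lt_trans x0p).
exists s, ((1 - e * x0)^-1 *: y).
apply: val_inj => /=; rewrite /stereo -/e sqnormZ yE.
have qE : (1 - e * x0)^-1 ^+ 2 * (1 - x0 ^+ 2) = (1 + e * x0) / (1 - e * x0).
  have -> : 1 - x0 ^+ 2 = (1 - e * x0) * (1 + e * x0).
    by rewrite -[x0 ^+ 2]mul1r -{2}e2; ring.
  by field.
have hE : 1 + (1 + e * x0) / (1 - e * x0) = 2 / (1 - e * x0) by field.
rewrite qE hE [RHS]xE.
rewrite (@scale_row_mx _ 1 1 n); congr (@row_mx _ 1 1 n _ _).
  rewrite scale_scalar_mx; congr (_ %:M).
  have -> : (1 + e * x0) / (1 - e * x0) - 1 = 2 * e * x0 / (1 - e * x0).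
    by field.
  transitivity (e ^+ 2 * x0); last by rewrite e2 mul1r.
  by field.
rewrite !scalerA -[RHS]scale1r; congr (_ *: _); field.
exact: d0.
Qed.

(* The metric induced by the Euclidean metric of R^(n+1):
   g_ij = <d_i x, d_j x> for the parametrization x = stereo s. *)
Definition round_metric (s : bool) (u : 'rV[R]_n) : 'M[R]_n :=
  \matrix_(i, j) \sum_(k < n.+1)
    partial (fun w => stereo s w 0 k) i u *
    partial (fun w => stereo s w 0 k) j u.

Definition sphere : riemannian R :=
  @Riemannian R sphere_point n bool sphere_chart sphere_cover round_metric.

End Sphere.

Definition is_homogeneous (R : realType) (m d : nat)
    (P : mpoly.mpoly m R[i]) : Prop :=
  P \is mpoly.ishomog1 d (@mpoly.mdeg m).

Definition poly_fun (R : realType) (m : nat) (P : mpoly.mpoly m R[i]) :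
    euclid R m -> R[i] :=
  fun x : 'rV[R]_m => mpoly.meval (fun i => (x 0 i)%:C) P.

(* Main.v *)
From HB Require Import structures.
Require Import Defs.
From mathcomp Require Import all_boot all_order all_algebra.
From mathcomp Require Import all_classical all_reals all_analysis.
From mathcomp Require Import complex ring lra.
From mathcomp Require mpoly.
Import (canonicals, coercions) mpoly.

(** Let [D_c] be the [c]-th component in [R^(n+1)] of the gradient on the sphere
    ([Sd c]); the Laplace-Beltrami operator is the sum of the [D_c \o D_c]
    ([lap], [lap_chart]).

    The analytic half of the proof shows that an eigenfunction of the Laplacian
    alone is the restriction of a polynomial ([eigenpair_polyS]), by elementary
    means in place of the spectral theorem.  The infinitesimal rotations
    [x_i D_j - x_j D_i] commute with the Laplacian, hence preserve eigenspaces.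
    The maximum principle, applied to the sum of the squared rotational
    derivatives plus a multiple of the squared modulus, bounds the former by the
    maximum of the latter, with a constant depending only on the eigenvalue
    ([bernstein]).  By iteration, the [m]-th derivative of the function along a
    unit speed great circle is at most [A * C ^+ m] ([iter_dir_rot_bound]).  A
    [2 pi]-periodic function with such derivatives is a trigonometric polynomial
    whose degree depends on [C] only: averaging it, times a Dirichlet kernel,
    over equidistant nodes gives a function of bounded exponential type and
    short period, which must be constant ([bohr_favard], [average_cst]), and
    this is an exact interpolation formula ([sampling]).  The values of the
    function on the great circles through the pole [e_j] are therefore expressed
    by finitely many derivatives at that pole ([tower_from_jet]), and these are
    polynomials in the direction of the circle.  So the function becomes
    polynomial once multiplied by a power of [1 - x_j ^+ 2]
    ([polyS_away_from_poles]); since the sum of the [1 - x_j ^+ 2] is the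
    constant [n], it is polynomial ([polyS_of_local]).

    The algebraic half starts from a polynomial eigenfunction.  As [|x|^2 = 1] on
    the sphere, its restriction is that of [A + B] with [A], [B] homogeneous of
    consecutive degrees, and the antipodal map shows that both are
    eigenfunctions.  On a homogeneous [P] of degree [d] the spherical Laplacian
    is the Euclidean one minus [d (d + n - 1)] ([clap_restr]), so that either [P]
    is harmonic or it may be replaced by a multiple of its Laplacian, of smaller
    degree ([harmonic_descent]).  In this way the function is the restriction of
    a harmonic homogeneous [F] of degree [d] whose degree is determined by the
    eigenvalue ([eigen_harmonic], [sphere_eigenvalue_inj]).

    Conformality then reads: the sum of the [(d_k F) ^+ 2] equals
    [(mu + d ^+ 2) * F ^+ 2] on the sphere ([gradsq_restr]).  If
    [mu = - d ^+ 2], this sum is a homogeneous polynomial vanishing on the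
    sphere, hence is 0, which is the claim.  Otherwise [F ^+ 2] is divisible by
    [|x|^2]; this quadratic form is squarefree over the complex numbers, so that
    [F = |x|^2 H] ([normsq_dvd_of_sqr]).  But then [F] agrees on the sphere
    with [H], of degree [d - 2], and therefore with a harmonic polynomial of
    degree at most [d - 2]; the eigenvalue of [F] being that of degree [d], this
    forces [F = 0] ([conformal_harmonic]).

    Conversely, [clap_restr] and [gradsq_restr] show that a homogeneous
    (0,0)-eigenfunction of degree [d] restricts to an eigenfunction for
    [lambda = - d (d + n - 1)] and [mu = - d ^+ 2]. *)

Set Implicit Arguments.
Unset Strict Implicit.
Unset Printing Implicit Defensive.

Import Order.TTheory GRing.Theory Num.Theory.
Import numFieldNormedType.Exports.
Local Open Scope classical_set_scope.
Local Open Scope ring_scope.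

(** * One-variable calculus *)

Section MeanValue.
Variable R : realType.

Lemma mean_value (f df : R -> R) (a b : R) :
  (forall x : R, is_derive x 1 f (df x)) ->
  exists2 c, `|c - a| <= `|b - a| & f b - f a = df c * (b - a).
Proof.
move=> fdf.
have fc : continuous f.
  by move=> x; apply/differentiable_continuous/derivable1_diffP; case: (fdf x).
have [ab|ba] := lerP a b.
- have [c cab e] := MVT_segment ab (fun x _ => fdf x) (continuous_subspaceT fc).
  exists c => //; move: cab; rewrite in_itv /= => /andP[ac cb].
  by rewrite ger0_norm ?subr_ge0 // lerB.
- have [c cab e] := MVT_segment (ltW ba) (fun x _ => fdf x) (continuous_subspaceT fc).
  move: cab; rewrite in_itv /= => /andP[bc ca].
  exists c.
    by rewrite distrC ger0_norm ?subr_ge0 // lerD2l lerN2.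
  by rewrite -opprB e -mulrN opprB.
Qed.

(** If the second derivative were positive at a critical maximum, the function
    would increase just after it. *)
Lemma second_derivative_at_max (f df : R -> R) (d2 : R) :
  (forall x : R, is_derive x 1 f (df x)) -> is_derive (0 : R) 1 df d2 ->
  (forall x, f x <= f 0) -> df 0 = 0 /\ d2 <= 0.
Proof.
move=> fdf dd fmax.
have d0 : df 0 = 0.
  have := @derive1_at_max R f (-1) 1 0 (ltW (lt_trans (ltrN10 R) ltr01)).
  move=> /(_ (fun x _ => @ex_derive _ _ _ _ _ _ _ (fdf x))).
  rewrite in_itv /= ltrN10 ltr01 => /(_ isT (fun x _ => fmax x)) h.
  by have /@derive_val <- := fdf 0; rewrite derive_val.
split=> //; rewrite leNgt; apply/negP => d2p.
have : \forall t \near (0 : R)^', 0 < t^-1 * df t.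
  have /cvgrPdist_lt /(_ d2 d2p) : (t^-1 * df t) @[t --> (0 : R)^'] --> d2.
    have [/cvg_ex[l hl] dv] := dd.
    have : 'D_1 df 0 = l by apply/cvg_lim.
    rewrite dv => ->; move: hl; apply: cvg_trans; apply: near_eq_cvg.
    by near=> t; rewrite /= d0 subr0 /GRing.scale /= mulr1 addr0.
  apply: filterS => t; rewrite distrC => /ltr_normlP[h1 h2]; lra.
rewrite /dnbhs => /nbhs_ballP[e /= e0 he].
have [c ce fe] := mean_value 0 (e / 2) fdf.
have [c' c'P feq] : exists2 c, c \in `]0, (e / 2)[%R & f (e / 2) - f 0 = df c * (e / 2 - 0).
  apply: MVT => //; first by rewrite divr_gt0.
  apply: continuous_subspaceT => x.
  by apply/differentiable_continuous/derivable1_diffP; case: (fdf x).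
move: c'P; rewrite in_itv /= => /andP[c0 c'e].
have := he c'; rewrite /ball /= sub0r normrN gtr0_norm // => h.
have {h} : 0 < c'^-1 * df c' by apply: h; [lra | rewrite gt_eqF].
rewrite pmulr_rgt0 ?invr_gt0 // => dfp.
have := fmax (e / 2); rewrite -subr_le0 feq subr0 leNgt => /negP; apply.
by rewrite mulr_gt0 // divr_gt0.
Unshelve. all: by end_near. Qed.

End MeanValue.

(** * Differentiability from continuous partial derivatives *)

Section Multivariate.
Variables (R : realType) (m : nat).
Implicit Types (h g : 'rV[R]_m -> R) (u v : 'rV[R]_m).

Notation e_ i := (delta_mx 0 i : 'rV[R]_m).

Lemma is_derive_line h u v t : derivable h (u + t *: v) v ->
  is_derive t 1 (fun s => h (u + s *: v)) ('D_v h (u + t *: v)).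
Proof.
move=> hd.
have E : (fun s => s^-1 *: (((fun s => h (u + s *: v)) \o shift t) (s *: 1)
    - (fun s => h (u + s *: v)) t)) =
  (fun s => s^-1 *: ((h \o shift (u + t *: v)) (s *: v) - h (u + t *: v))).
  apply/funext => s /=; congr (_ *: (h _ - _)).
  by rewrite [s *: 1]mulr1 scalerDl addrCA.
split; first by rewrite /derivable E.
by rewrite /derive E.
Qed.

(** The points [truncate v k] form a path from 0 to [v] along the coordinate axes. *)
Definition truncate (v : 'rV[R]_m) (k : nat) : 'rV[R]_m :=
  \row_i (if (i < k)%N then v 0 i else 0).

Lemma norm_coord v i : `|v 0 i| <= `|v|.
Proof. by rewrite [leRHS]/Num.Def.normr /= mx_normrE; exact: (le_bigmax _ _ (0, i)). Qed.

(** The linear form with coefficients [c]: the candidate differential. *)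
Definition dlin (c : 'I_m -> R) v : R := \sum_i v 0 i * c i.

Lemma dlin_is_linear c : linear (dlin c).
Proof.
move=> a u v; rewrite /dlin scaler_sumr -big_split /=; apply: eq_bigr => i _.
by rewrite !mxE mulrDl -mulrA.
Qed.
HB.instance Definition _ c := GRing.isLinear.Build R 'rV[R]_m R _ (dlin c) (dlin_is_linear c).

(** Move along one coordinate at a time and apply the mean value theorem to each
    of the [m] steps. *)
Lemma increment_bound h u (eps : R) (d : R) :
  (forall i u, derivable h u (e_ i)) ->
  (forall w i, `|w| <= d -> `|partial h i (u + w) - partial h i u| <= eps) ->
  forall v, `|v| <= d ->
    `|h (u + v) - h u - dlin (partial h ^~ u) v| <= eps * m%:R * `|v|.
Proof.
move=> hd hc v vd.
have step k (km : (k < m)%N) :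
  `|h (u + truncate v k.+1) - h (u + truncate v k) -
    v 0 (Ordinal km) * partial h (Ordinal km) u| <= eps * `|v|.
  set i := Ordinal km; set t := truncate v k.
  have -> : truncate v k.+1 = t + v 0 i *: e_ i.
    apply/rowP => j; rewrite !mxE /= ltnS leq_eqVlt.
    have [-> |ji] := eqVneq j i; first by rewrite eqxx ltnn /= mulr1 add0r.
    rewrite mulr0 addr0; suff -> : (j == k :> nat) = false by [].
    by apply/negbTE; apply: contraNN ji => /eqP e; apply/eqP/ord_inj.
  have [c cle] := mean_value 0 (v 0 i) (fun x => is_derive_line (hd i (u + t + x *: e_ i))).
  rewrite scale0r addr0 subr0 [u + (_ + _)]addrA => ->.
  rewrite -/(partial h i _) mulrC -mulrBr normrM mulrC.
  apply: ler_pM => //; last exact: norm_coord.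
  rewrite -addrA; apply: hc.
  rewrite [leLHS]/Num.Def.normr /= mx_normrE (bigmax_le _ (le_trans (normr_ge0 _) vd)) // => -[a j] _ /=.
  rewrite (ord1 a) !mxE /=; have [->|ji] := eqVneq j i.
    rewrite ltnn add0r mulr1; move: cle; rewrite !subr0 => /le_trans; apply.
    exact: le_trans (norm_coord v i) vd.
  rewrite mulr0 addr0; case: ifP => _; first exact: le_trans (norm_coord v j) vd.
  by rewrite normr0 (le_trans _ vd).
have trm : truncate v m = v by apply/rowP => j; rewrite mxE ltn_ord.
have tr0 : truncate v 0 = 0 by apply/rowP => j; rewrite !mxE.
have -> : h (u + v) - h u = \sum_(i < m) (h (u + truncate v i.+1) - h (u + truncate v i)).
  rewrite -(big_mkord xpredT (fun k => h (u + truncate v k.+1) - h (u + truncate v k))).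
  by rewrite telescope_sumr // trm tr0 addr0.
rewrite /dlin -sumrB (le_trans (ler_norm_sum _ _ _)) //.
have -> : eps * m%:R * `|v| = \sum_(i < m) eps * `|v|.
  by rewrite sumr_const card_ord -mulr_natr; ring.
by apply: ler_sum => i _; case: i => k km; exact: step.
Qed.

Section C1.
Variable h : 'rV[R]_m -> R.
Hypothesis hd : forall i u, derivable h u (e_ i).
Hypothesis hc : forall i, continuous (partial h i).

Lemma C1_partial_close u (eps : R) : 0 < eps -> exists2 d, 0 < d &
  forall w i, `|w| <= d -> `|partial h i (u + w) - partial h i u| <= eps.
Proof.
move=> eps0.
have : \forall w \near (0 : 'rV[R]_m), forall i, `|partial h i (u + w) - partial h i u| <= eps.
  apply: (@filter_forall _ _ (fun i w => `|partial h i (u + w) - partial h i u| <= eps) (nbhs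
    (0 : 'rV[R]_m))) => i.
  have /cvgrPdist_le /(_ _ eps0) := @hc i u.
  rewrite [\forall x \near _, _ <= _](near_shift (0 : 'rV[R]_m)) /= subr0; apply: filterS => w /=.
  rewrite [w + u]addrC.
  by rewrite distrC.
move=> /nbhs_ballP[d /= d0 hd']; exists (d / 2); first by rewrite divr_gt0.
move=> w i wd; apply: hd'; rewrite -ball_normE /ball_ /= sub0r normrN.
by rewrite (le_lt_trans wd) // ltr_pdivrMr // ltr_pMr // ltr1n.
Qed.

Lemma C1_diff u : differentiable h u /\ ('d h u = dlin (partial h ^~ u) :> (_ -> _)).
Proof.
have dc : continuous (dlin (partial h ^~ u)).
  have -> : dlin (partial h ^~ u) = \sum_i ((fun v : 'rV[R]_m => v 0 i) * cst (partial h i u)).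
    by apply/funext => v; rewrite /dlin fct_sumE; apply: eq_bigr.
  move=> v; apply: (@big_ind _ (fun f => {for v, continuous f})).
  - exact: cst_continuous.
  - by move=> f g cf cg; exact: continuousD.
  - move=> i _; apply: continuousM; last exact: cst_continuous.
    exact: coord_continuous.
have E : h \o shift u = cst (h u) + dlin (partial h ^~ u) +o_ (0 : 'rV[R]_m) id.
  apply/eqaddoP => _/posnumP[e].
  have [d d0 dP] := @C1_partial_close u (e%:num / m.+1%:R) (divr_gt0 (gt0 e) (ltr0Sn _ _)).
  near=> v.
  rewrite [X in `|X|](_ : _ = h (u + v) - h u - dlin (partial h ^~ u) v); last first.
    by rewrite -[LHS]/(h (v + u) - (h u + dlin (partial h ^~ u) v)) opprD addrA [v + u]addrC.
  apply: le_trans (increment_bound hd dP _) _.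
    by near: v; apply: (@nbhs0_le R 'rV[R]_m d d0).
  apply: ler_wpM2r => //; rewrite mulrAC ler_pdivrMr ?ltr0Sn //.
  by apply: ler_wpM2l => //; rewrite ler_nat.
have dE : 'd h u = dlin (partial h ^~ u) :> (_ -> _) by apply: diff_unique.
by split=> //; apply/diff_locallyP; rewrite dE.
Unshelve. all: by end_near. Qed.

Lemma C1_continuous : continuous h.
Proof. by move=> u; apply: differentiable_continuous; case: (C1_diff u). Qed.

(** The chain rule along a curve. *)
Lemma C1_curve (w : R -> 'rV[R]_m) (dw : 'rV[R]_m) (t : R) :
  (forall i, is_derive t 1 (fun s => w s 0 i) (dw 0 i)) ->
  is_derive t 1 (h \o w) (\sum_i dw 0 i * partial h i (w t)).
Proof.
move=> wd.
have wt : derivable w t 1.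
  by apply/derivable_mxP => i j; rewrite ord1; case: (wd j).
have wdiff : differentiable w t by apply/derivable1_diffP.
have [hdiff hE] := C1_diff (w t).
split; first exact/derivable1_diffP/differentiable_comp.
rewrite deriveE; last exact: differentiable_comp.
rewrite diff_comp //= hE -deriveE // derive_mx // /dlin.
by apply: eq_bigr => i _; rewrite mxE; congr (_ * _); case: (wd i).
Qed.

End C1.
End Multivariate.

(** * Smooth functions and symmetry of second derivatives *)

Section Smooth.
Variables (R : realType) (m : nat).
Implicit Types (h g : 'rV[R]_m -> R) (u v : 'rV[R]_m).

Notation e_ i := (delta_mx 0 i : 'rV[R]_m).

Lemma CkSP k h : Ck k.+1 h ->
  (forall i u, derivable h u (e_ i)) /\ (forall i, Ck k (partial h i)).
Proof. by []. Qed.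

Lemma Ck_pred k h : Ck k.+1 h -> Ck k h.
Proof.
elim: k h => [|k IH] h [hd hp]; first exact: C1_continuous hd hp.
by split=> // i; apply: IH; exact: hp.
Qed.

Lemma derivable_coord (j : 'I_m) u v : derivable (fun w : 'rV[R]_m => w 0 j) u v.
Proof. by have /derivable_mxP := @derivable_id R 'rV[R]_m u v; exact. Qed.

Lemma derive_coord (j : 'I_m) u v : 'D_v (fun w : 'rV[R]_m => w 0 j) u = v 0 j.
Proof.
have /derive_mx := @derivable_id R 'rV[R]_m u v.
by rewrite derive_id => /rowP /(_ j); rewrite mxE.
Qed.

Lemma partial_coord (j i : 'I_m) u :
  partial (fun w : 'rV[R]_m => w 0 j) i u = (i == j)%:R.
Proof. by rewrite /partial derive_coord mxE eqxx eq_sym. Qed.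

Lemma partial_cst (c : R) i u : partial (fun=> c) i u = 0.
Proof. exact: derive_cst. Qed.

Section Rules.
Variables (h g : 'rV[R]_m -> R) (i : 'I_m) (u : 'rV[R]_m).
Hypotheses (hd : derivable h u (e_ i)) (gd : derivable g u (e_ i)).

Lemma partialD : partial (fun w => h w + g w) i u = partial h i u + partial g i u.
Proof. exact: (@deriveD _ _ _ h g u (e_ i) hd gd). Qed.

Lemma partialM : partial (fun w => h w * g w) i u =
  partial h i u * g u + h u * partial g i u.
Proof.
have -> : (fun w => h w * g w) = h * g by [].
rewrite /partial (@deriveM _ _ h g u (e_ i) hd gd) addrC /GRing.scale /=.
by rewrite [g u * _]mulrC.
Qed.

Lemma partialZ c : partial (fun w => c * h w) i u = c * partial h i u.
Proof. exact: (@deriveZ _ _ _ h c u (e_ i) hd). Qed.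

Lemma partialV : h u != 0 ->
  partial (fun w => (h w)^-1) i u = - (h u) ^- 2 * partial h i u.
Proof. by move=> h0; exact: (@deriveV _ _ h u (e_ i) h0 hd). Qed.

End Rules.

Lemma Ck_cst k c : Ck k (fun _ : 'rV[R]_m => c).
Proof.
elim: k c => [|k IH] c; first exact: cst_continuous.
split=> [i u|i]; first exact: derivable_cst.
have -> : partial (fun=> c) i = fun=> 0 by apply/funext => u; rewrite partial_cst.
exact: IH.
Qed.

Lemma CkD k h g : Ck k h -> Ck k g -> Ck k (fun w => h w + g w).
Proof.
elim: k h g => [|k IH] h g; first by move=> hc gc u; exact: continuousD (hc u) (gc u).
move=> /CkSP[hd hp] /CkSP[gd gp]; split=> [i u|i]; first exact: derivableD.
have -> : partial (fun w => h w + g w) i = fun w => partial h i w + partial g i w.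
  by apply/funext => u; rewrite partialD.
exact: IH.
Qed.

Lemma CkM k h g : Ck k h -> Ck k g -> Ck k (fun w => h w * g w).
Proof.
elim: k h g => [|k IH] h g; first by move=> hc gc u; exact: continuousM (hc u) (gc u).
move=> hk gk; have [hd hp] := CkSP hk; have [gd gp] := CkSP gk.
split=> [i u|i]; first exact: derivableM.
have -> : partial (fun w => h w * g w) i =
    fun w => partial h i w * g w + h w * partial g i w.
  by apply/funext => u; rewrite partialM.
by apply: CkD; apply: IH => //; exact: Ck_pred.
Qed.

Lemma Ck_coord k (j : 'I_m) : Ck k (fun w : 'rV[R]_m => w 0 j).
Proof.
case: k => [|k]; first exact: coord_continuous.
split=> [i u|i]; first exact: derivable_coord.
have -> : partial (fun w : 'rV[R]_m => w 0 j) i = fun=> (i == j)%:R.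
  by apply/funext => u; rewrite partial_coord.
exact: Ck_cst.
Qed.

Definition smooth_fun h := forall k, Ck k h.

Lemma smooth_funP h : smooth_fun h ->
  [/\ forall i u, derivable h u (e_ i), forall i, smooth_fun (partial h i) & continuous h].
Proof.
move=> hs; split; last exact: hs 0%N.
- by have /CkSP[] := hs 1%N.
- by move=> i k; have /CkSP[_] := hs k.+1; exact.
Qed.

Lemma smooth_funD h g : smooth_fun h -> smooth_fun g -> smooth_fun (fun w => h w + g w).
Proof. by move=> hs gs k; exact: CkD. Qed.

Lemma smooth_funM h g : smooth_fun h -> smooth_fun g -> smooth_fun (fun w => h w * g w).
Proof. by move=> hs gs k; exact: CkM. Qed.

Lemma smooth_fun_cst c : smooth_fun (fun _ : 'rV[R]_m => c).
Proof. by move=> k; exact: Ck_cst. Qed.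

Lemma smooth_fun_sum (I : Type) (r : seq I) (F : I -> 'rV[R]_m -> R) :
  (forall i, smooth_fun (F i)) -> smooth_fun (fun w => \sum_(i <- r) F i w).
Proof.
move=> Fs; elim: r => [|i r IH].
  have -> : (fun w => \sum_(i <- [::]) F i w) = fun=> 0.
    by apply/funext => w; rewrite big_nil.
  exact: smooth_fun_cst.
have -> : (fun w => \sum_(j <- i :: r) F j w) = fun w => F i w + \sum_(j <- r) F j w.
  by apply/funext => w; rewrite big_cons.
exact: smooth_funD.
Qed.

Lemma partial_sum (I : Type) (r : seq I) (F : I -> 'rV[R]_m -> R) i u :
  (forall j, derivable (F j) u (e_ i)) ->
  derivable (fun w => \sum_(j <- r) F j w) u (e_ i) /\
  partial (fun w => \sum_(j <- r) F j w) i u = \sum_(j <- r) partial (F j) i u.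
Proof.
move=> Fd; elim: r => [|j r IH].
  have -> : (fun w => \sum_(j <- [::]) F j w) = fun=> 0.
    by apply/funext => w; rewrite big_nil.
  by rewrite big_nil partial_cst; split=> //; exact: derivable_cst.
have -> : (fun w => \sum_(k <- j :: r) F k w) = fun w => F j w + \sum_(k <- r) F k w.
  by apply/funext => w; rewrite big_cons.
split; first exact: (derivableD (Fd j) IH.1).
by rewrite big_cons -IH.2; exact: (partialD (Fd j) IH.1).
Qed.

Section Schwarz.
Variable h : 'rV[R]_m -> R.
Hypothesis hs : smooth_fun h.

Let hd : forall i u, derivable h u (e_ i). Proof. by case: (smooth_funP hs). Qed.
Let hdd i : forall j u, derivable (partial h i) u (e_ j).
Proof. by case: (smooth_funP hs) => _ /(_ i) /smooth_funP[]. Qed.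

(** Two mean value theorems, first in the direction [e_j] and then in the
    direction [e_i]; the left-hand side is symmetric in [i] and [j]. *)
Lemma second_difference i j u (r : R) : 0 < r ->
  exists2 w, `|w| <= r *+ 2 &
  h (u + r *: e_ i + r *: e_ j) - h (u + r *: e_ i) - (h (u + r *: e_ j) - h u) =
    partial (partial h j) i (u + w) * r * r.
Proof.
move=> r0.
have [t t0 E1] := mean_value 0 r (fun t => is_deriveB
   (is_derive_line (@hd j (u + r *: e_ i + t *: e_ j)))
   (is_derive_line (@hd j (u + t *: e_ j)))).
have [s s0 E2] := mean_value 0 r (fun s =>
   is_derive_line (@hdd j i (u + t *: e_ j + s *: e_ i))).
exists (t *: e_ j + s *: e_ i).
  have ne k : `|e_ k| <= 1.
    rewrite [leLHS]/Num.Def.normr /= mx_normrE (bigmax_le _ ler01) // => -[a b] _ /=.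
    by rewrite mxE; case: (_ && _); rewrite ?normr1 ?normr0.
  rewrite !subr0 (ger0_norm (ltW r0)) in t0; rewrite !subr0 (ger0_norm (ltW r0)) in s0.
  rewrite mulr2n (le_trans (ler_normD _ _)) // lerD // normrZ.
    by rewrite -[leRHS]mulr1 ler_pM.
  by rewrite -[leRHS]mulr1 ler_pM.
have {}E1 : h (u + r *: e_ i + r *: e_ j) - h (u + r *: e_ j) -
    (h (u + r *: e_ i) - h u) =
    (partial h j (u + r *: e_ i + t *: e_ j) - partial h j (u + t *: e_ j)) * r.
  move: E1; rewrite subr0 => <-.
  rewrite -[RHS]/(h (u + r *: e_ i + r *: e_ j) - h (u + r *: e_ j) -
    (h (u + r *: e_ i + 0 *: e_ j) - h (u + 0 *: e_ j))).
  by rewrite !scale0r !addr0.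
transitivity ((partial h j (u + t *: e_ j + r *: e_ i) - partial h j (u + t *: e_ j)) * r).
  by rewrite [u + t *: e_ j + _]addrAC -E1; ring.
congr (_ * r); move: E2; rewrite scale0r addr0 subr0 => ->.
by rewrite addrA.
Qed.

(** Schwarz: evaluate the same second difference in the two orders and shrink the
    square. *)
Lemma partialC i j u : partial (partial h i) j u = partial (partial h j) i u.
Proof.
apply/eqP; rewrite -subr_eq0 -normr_le0; apply/ler_addgt0Pl => eps eps0; rewrite addr0.
have near_close k l : exists2 d, 0 < d & forall w, `|w| <= d ->
   `|partial (partial h k) l (u + w) - partial (partial h k) l u| <= eps / 2.
  have [_ /(_ k) /smooth_funP[_ /(_ l) /smooth_funP[lc1 lc2 lc3] _] _] := smooth_funP hs.
  have /cvgrPdist_le /(_ (eps / 2)) := @lc3 u.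
  rewrite divr_gt0 // => /(_ isT).
  rewrite [\forall x \near _, _ <= _](near_shift (0 : 'rV[R]_m)) /= subr0.
  move=> /nbhs_ballP[d /= d0 dP]; exists (d / 2); first by rewrite divr_gt0.
  move=> w wd; rewrite distrC [u + w]addrC; apply: (dP w).
  rewrite -ball_normE /ball_ /= sub0r normrN.
  by rewrite (le_lt_trans wd) // ltr_pdivrMr // ltr_pMr // ltr1n.
have [d1 d10 D1] := near_close i j; have [d2 d20 D2] := near_close j i.
(* the points found by [second_difference] are within [2 * r] of [u] *)
pose r := Num.min d1 d2 / 2.
have m0 : 0 < Num.min d1 d2 by rewrite lt_min d10.
have r0 : 0 < r by rewrite divr_gt0.
have r2 : r *+ 2 = Num.min d1 d2 by rewrite -mulr_natr divfK // pnatr_eq0.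
have [w1 w1r E1] := second_difference i j u r0.
have [w2 w2r E2] := second_difference j i u r0.
move: E1 E2.
have w1d2 : `|w1| <= d2 by rewrite (le_trans w1r) // r2 ge_min lexx orbT.
have w2d1 : `|w2| <= d1 by rewrite (le_trans w2r) // r2 ge_min lexx.
have := D1 _ w2d1; have := D2 _ w1d2 => H2 H1 E1 E2.
have {E1 E2} E : partial (partial h j) i (u + w1) = partial (partial h i) j (u + w2).
  have rn : r != 0 by rewrite gt_eqF.
  have : partial (partial h j) i (u + w1) * r * r = partial (partial h i) j (u + w2) * r * r.
    apply: (etrans (esym E1)); apply: etrans E2.
    rewrite (addrAC u (r *: e_ i)).
    generalize (h (u + r *: e_ j + r *: e_ i)) (h (u + r *: e_ i)) (h (u + r *: e_ j)) (h u).
    by move=> a b c d; ring.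
  by move=> /(mulIf rn) /(mulIf rn).
rewrite E in H2; clear E; rewrite -(subrKA (partial (partial h i) j (u + w2))) (le_trans
  (ler_normD _ _)) //.
rewrite [leRHS]splitr; apply: lerD; last exact: H2.
by rewrite distrC; exact: H1.
Qed.

End Schwarz.
End Smooth.

(** * Stereographic coordinates *)

Section Chart.
Variables (R : realType) (n : nat).
Implicit Types (h g : 'rV[R]_n -> R) (u v : 'rV[R]_n) (s : bool) (k l : 'I_n)
  (c d : 'I_n.+1).

Notation e_ i := (delta_mx 0 i : 'rV[R]_n).

(** The stereographic chart is conformal: its metric is [conf u ^+ 2] times the
    Euclidean one. *)
Definition conf u : R := 2 / (1 + sqnorm u).
(** The inverse of [conf], kept as a polynomial so that derivatives stay polynomial. *)
Definition confV u : R := (1 + sqnorm u) / 2.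

Lemma denom_neq0 u : 1 + sqnorm u != 0. Proof. exact: sqnormD1_neq0. Qed.
Lemma denom_gt0 u : 0 < 1 + sqnorm u.
Proof. by rewrite ltr_wpDr // sqnorm_ge0. Qed.
Lemma conf_gt0 u : 0 < conf u. Proof. by rewrite divr_gt0 // denom_gt0. Qed.

Lemma confVE u : confV u = (conf u)^-1.
Proof. by rewrite /conf /confV invf_div. Qed.

(** The chart [s] misses the point of the sphere whose only nonzero coordinate is
    this sign, in place 0. *)
Definition pole_sign s : R := (-1) ^+ s.

(** The coefficients of the [c]-th ambient component of the gradient in the chart
    [s]: up to the factor [conf ^+ 2] these are the partial derivatives of the
    chart ([partial_stereo]). *)
Definition frame s c k u : R :=
  if unlift ord0 c is Some j then (j == k)%:R * confV u - u 0 j * u 0 k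
  else pole_sign s * u 0 k.

Lemma frame0 s k u : frame s ord0 k u = pole_sign s * u 0 k.
Proof. by rewrite /frame unlift_none. Qed.
Lemma frameS s j k u : frame s (lift ord0 j) k u = (j == k)%:R * confV u - u 0 j * u 0 k.
Proof. by rewrite /frame liftK. Qed.

Lemma stereo0 s u : stereo s u 0 ord0 = pole_sign s * (1 - conf u).
Proof.
have -> : (ord0 : 'I_n.+1) = lshift n (ord0 : 'I_1) by apply/val_inj.
rewrite /pole_sign /stereo mxE (@row_mxEl _ 1 1 n) mxE eqxx mulr1n /conf.
by field; rewrite denom_neq0.
Qed.

Lemma stereoS s u j : stereo s u 0 (lift ord0 j) = conf u * u 0 j.
Proof.
have -> : lift ord0 j = rshift 1 j by rewrite rshift1.
rewrite /stereo mxE (@row_mxEr _ 1 1 n) mxE /conf.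
by field; rewrite denom_neq0.
Qed.

Lemma ord_liftP (P : 'I_n.+1 -> Prop) : P ord0 -> (forall j, P (lift ord0 j)) -> forall c, P c.
Proof. by move=> P0 PS c; case: (unliftP ord0 c) => [j ->|->]. Qed.

Lemma delta_sum k (F : 'I_n -> R) : \sum_l (k == l)%:R * F l = F k.
Proof.
rewrite (bigD1 k) //= eqxx mul1r big1 ?addr0 // => l lk.
by rewrite eq_sym (negbTE lk) mul0r.
Qed.

(** The common shape of all the sums over the frame: each factor is a combination
    of Kronecker symbols and of the coordinates of [u]. *)
Lemma sum_affine u a b (i j k : 'I_n) (p q r : R) :
  \sum_l (a * (i == l)%:R + b * u 0 l) *
         (p * u 0 l + q * (j == l)%:R + r * (k == l)%:R) =
  a * (p * u 0 i + q * (i == j)%:R + r * (i == k)%:R) +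
  b * (p * sqnorm u + q * u 0 j + r * u 0 k).
Proof.
rewrite (eq_bigr (fun l => a * ((i == l)%:R * (p * u 0 l + q * (j == l)%:R + r * (k == l)%:R))
  + (b * p * (u 0 l ^+ 2) + b * q * ((j == l)%:R * u 0 l) + b * r * ((k == l)%:R * u 0 l)))); last first.
  by move=> l _; ring.
rewrite !big_split /= -!mulr_sumr !delta_sum -/(sqnorm u) ![_ == i]eq_sym; ring.
Qed.

Lemma sqr_sgn s : pole_sign s ^+ 2 = 1 :> R. Proof. exact: sqrr_sign. Qed.

Lemma sqnorm_confV u : sqnorm u = 2 * confV u - 1. Proof. by rewrite /confV; field. Qed.

Lemma lift_eq (i j : 'I_n) : (lift ord0 i == lift ord0 j) = (i == j).
Proof. exact: (inj_eq lift_inj). Qed.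

Lemma eq_lift0 (i : 'I_n) : (ord0 == lift ord0 i) = false.
Proof. exact: eq_liftF. Qed.

Lemma lift_eq0 (i : 'I_n) : (lift ord0 i == ord0) = false.
Proof. exact: lift_eqF. Qed.

Definition lifteqE := (lift_eq, eq_lift0, lift_eq0, eqxx).

End Chart.

Arguments pole_sign {R} s.

Ltac chart_field s u :=
  rewrite ?sqnorm_confV ?confVE /pole_sign; have := lt0r_neq0 (conf_gt0 u);
  move: (conf u) => r r0; case: s => /=; rewrite ?expr1 ?expr0; field.

Section ChartFrame.
Variables (R : realType) (n : nat).
Implicit Types (h g : 'rV[R]_n -> R) (u v : 'rV[R]_n) (s : bool) (k l : 'I_n)
  (c d : 'I_n.+1).

Notation e_ i := (delta_mx 0 i : 'rV[R]_n).

(** The frame vectors, suitably scaled, are an orthonormal basis of the tangent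
    space, so this sum is the orthogonal projection onto it. *)
Lemma sum_framel s c d u : \sum_k frame s c k u * frame s d k u =
  confV u ^+ 2 * ((c == d)%:R - stereo s u 0 c * stereo s u 0 d).
Proof.
elim/ord_liftP: c; [|move=> i]; (elim/ord_liftP: d; [|move=> j]);
  rewrite ?stereo0 ?stereoS ?lifteqE.
- rewrite (eq_bigr (fun k => u 0 k ^+ 2)); last first.
    by move=> k _; rewrite !frame0 mulrACA -expr2 sqr_sgn mul1r -expr2.
  by rewrite -/(sqnorm u); chart_field s u.
- rewrite (eq_bigr (fun k => (0 * (j == k)%:R + 1 * u 0 k) *
     (- pole_sign s * u 0 j * u 0 k + pole_sign s * confV u * (j == k)%:R + 0 * (j == k)%:R)));
       last first.
    by move=> k _; rewrite frame0 frameS; ring.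
  by rewrite sum_affine; chart_field s u.
- rewrite (eq_bigr (fun k => (0 * (i == k)%:R + 1 * u 0 k) *
     (- pole_sign s * u 0 i * u 0 k + pole_sign s * confV u * (i == k)%:R + 0 * (i == k)%:R)));
       last first.
    by move=> k _; rewrite frame0 frameS; ring.
  by rewrite sum_affine; chart_field s u.
- rewrite (eq_bigr (fun k => (confV u * (i == k)%:R + - u 0 i * u 0 k) *
     (- u 0 j * u 0 k + confV u * (j == k)%:R + 0 * (j == k)%:R))); last first.
    by move=> k _; rewrite !frameS; ring.
  by rewrite sum_affine; chart_field s u.
Qed.

Lemma sum_framer s k l u : \sum_c frame s c k u * frame s c l u =
  confV u ^+ 2 * (k == l)%:R.
Proof.
rewrite big_ord_recl !frame0.
rewrite (eq_bigr (fun i => (confV u * (k == i)%:R + - u 0 k * u 0 i) *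
     (- u 0 l * u 0 i + confV u * (l == i)%:R + 0 * (l == i)%:R))); last first.
  by move=> i _; rewrite !frameS ![i == _]eq_sym; ring.
by rewrite sum_affine; chart_field s u.
Qed.

Lemma sum_stereo_frame s k u : \sum_c stereo s u 0 c * frame s c k u = 0.
Proof.
rewrite big_ord_recl frame0 stereo0.
rewrite (eq_bigr (fun i => (0 * (k == i)%:R + conf u * u 0 i) *
     (- u 0 k * u 0 i + confV u * (k == i)%:R + 0 * (k == i)%:R))); last first.
  by move=> i _; rewrite frameS stereoS [i == _]eq_sym; ring.
by rewrite sum_affine; chart_field s u.
Qed.

Lemma sqnorm_smooth : smooth_fun (@sqnorm R n).
Proof.
apply: smooth_fun_sum => i.
have -> : (fun w : 'rV[R]_n => w 0 i ^+ 2) = fun w => w 0 i * w 0 i by [].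
by apply: smooth_funM => k; exact: Ck_coord.
Qed.

Lemma partial_sqnorm k u : partial (@sqnorm R n) k u = 2 * u 0 k.
Proof.
have hd j : derivable (fun w : 'rV[R]_n => w 0 j ^+ 2) u (e_ k).
  by apply: (@derivableM _ _ (fun w : 'rV[R]_n => w 0 j) (fun w => w 0 j)); exact: derivable_coord.
rewrite (partial_sum (index_enum _) hd).2.
rewrite (eq_bigr (fun j => (k == j)%:R * (2 * u 0 j))); last first.
  move=> j _; rewrite (@partialM _ _ (fun w : 'rV[R]_n => w 0 j) (fun w => w 0 j)) ?partial_coord;
    try exact: derivable_coord.
  ring.
by rewrite delta_sum.
Qed.

Lemma denom_derivable k u : derivable (fun w : 'rV[R]_n => 1 + sqnorm w) u (e_ k).
Proof.
have [qd _ _] := smooth_funP (smooth_funD (smooth_fun_cst n 1) sqnorm_smooth).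
exact: qd.
Qed.

Lemma denomV_derivable k u : derivable (fun w : 'rV[R]_n => (1 + sqnorm w)^-1) u (e_ k).
Proof. exact: (@derivableV _ _ (fun w : 'rV[R]_n => 1 + sqnorm w) u (e_ k) (denom_neq0 u)
  (@denom_derivable k u)). Qed.

Lemma conf_derivable k u : derivable (@conf R n) u (e_ k).
Proof.
exact: (@derivableM _ _ (fun=> 2) (fun w => (1 + sqnorm w)^-1) u (e_ k)
  (@derivable_cst _ _ _ _ _ _) (@denomV_derivable k u)).
Qed.

Lemma partial_conf k u : partial (@conf R n) k u = - conf u ^+ 2 * u 0 k.
Proof.
have [sd _ _] := smooth_funP sqnorm_smooth.
rewrite (partialZ (@denomV_derivable k u)) (partialV (@denom_derivable k u) (denom_neq0 u)).
rewrite (partialD (@derivable_cst _ _ _ (1 : R) u (e_ k)) (sd k u)).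
by rewrite partial_cst partial_sqnorm /conf; field; rewrite denom_neq0.
Qed.

Lemma conf_smooth : smooth_fun (@conf R n).
Proof.
elim=> [|k IH].
  have [_ _ sc] := smooth_funP sqnorm_smooth.
  move=> u; apply: (@continuousM _ _ (fun=> 2) (fun w => (1 + sqnorm w)^-1)).
    exact: cst_continuous.
  apply: (@continuousV _ _ (fun w => 1 + sqnorm w)); first exact: denom_neq0.
  by have [_ _] := smooth_funP (smooth_funD (smooth_fun_cst n 1) sqnorm_smooth); exact.
split=> [i u|i]; first exact: conf_derivable.
have -> : partial (@conf R n) i = fun w => (-1 * (conf w * conf w)) * w 0 i.
  by apply/funext => w; rewrite partial_conf mulN1r.
by apply: CkM; [apply: CkM; [exact: Ck_cst|exact: CkM]|exact: Ck_coord].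
Qed.

End ChartFrame.

(** * Gradient and Laplacian in a stereographic chart *)

Section ChartOperators.
Variables (R : realType) (n : nat).
Implicit Types (h g : 'rV[R]_n -> R) (u v : 'rV[R]_n) (s : bool) (k l : 'I_n)
  (c d : 'I_n.+1).

Notation e_ i := (delta_mx 0 i : 'rV[R]_n).
Notation x_ s u c := (stereo s u 0 c).

Lemma confV_smooth : smooth_fun (@confV R n).
Proof.
apply: smooth_funM; last exact: smooth_fun_cst.
by apply: smooth_funD; [exact: smooth_fun_cst|exact: sqnorm_smooth].
Qed.

Lemma partial_confV l u : partial (@confV R n) l u = u 0 l.
Proof.
have [sd _ _] := smooth_funP (@sqnorm_smooth R n).
have -> : @confV R n = fun w => 2^-1 * (1 + sqnorm w) by apply/funext => w; rewrite mulrC.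
rewrite (partialZ (@denom_derivable _ _ l u)).
rewrite (partialD (@derivable_cst _ _ _ (1 : R) u (e_ l)) (sd l u)).
by rewrite partial_cst partial_sqnorm; field.
Qed.

Lemma coord_smooth k : smooth_fun (fun w : 'rV[R]_n => w 0 k).
Proof. by move=> m; exact: Ck_coord. Qed.

Lemma frame_smooth s c k : smooth_fun (@frame R n s c k).
Proof.
elim/ord_liftP: c => [|j].
  have -> : @frame R n s ord0 k = fun w => pole_sign s * w 0 k by apply/funext => w; rewrite frame0.
  by apply: smooth_funM; [exact: smooth_fun_cst|exact: coord_smooth].
have -> : @frame R n s (lift ord0 j) k = fun w => (j == k)%:R * confV w + -1 * (w 0 j * w 0 k).
  by apply/funext => w; rewrite frameS mulN1r.
apply: smooth_funD; apply: smooth_funM; try exact: smooth_fun_cst.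
  exact: confV_smooth.
by apply: smooth_funM; exact: coord_smooth.
Qed.

Lemma partial_frame0 s k l u : partial (@frame R n s ord0 k) l u = pole_sign s * (k == l)%:R.
Proof.
have -> : @frame R n s ord0 k = fun w => pole_sign s * w 0 k by apply/funext => w; rewrite frame0.
by rewrite (partialZ (@derivable_coord _ _ _ _ _)) partial_coord eq_sym.
Qed.

Lemma partial_frameS s j k l u : partial (@frame R n s (lift ord0 j) k) l u =
  (j == k)%:R * u 0 l + - u 0 k * (j == l)%:R + - u 0 j * (k == l)%:R.
Proof.
have -> : @frame R n s (lift ord0 j) k = fun w => (j == k)%:R * confV w + -1 * (w 0 j * w 0 k).
  by apply/funext => w; rewrite frameS mulN1r.
have [cd _ _] := smooth_funP confV_smooth.
have dd := @derivable_coord R n.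
have [md _ _] := smooth_funP (smooth_funM (coord_smooth j) (coord_smooth k)).
have [zd _ _] := smooth_funP (smooth_funM (smooth_fun_cst n (j == k)%:R) confV_smooth).
have [wd _ _] := smooth_funP (smooth_funM (smooth_fun_cst n (-1 : R)) (smooth_funM
  (coord_smooth j) (coord_smooth k))).
rewrite (partialD (zd l u) (wd l u)) (partialZ (cd l u)) (partialZ (md l u)).
rewrite (partialM (dd _ _ _) (dd _ _ _)) !partial_coord partial_confV ![l == _]eq_sym.
ring.
Qed.

Lemma stereo_coord0 s : (fun w : 'rV[R]_n => x_ s w ord0) = fun w => pole_sign s
  + - pole_sign s * conf w.
Proof. by apply/funext => w; rewrite stereo0; ring. Qed.

Lemma stereo_coordS s j : (fun w : 'rV[R]_n => x_ s w (lift ord0 j)) = fun w => conf w * w 0 j.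
Proof. by apply/funext => w; rewrite stereoS. Qed.

Lemma stereo_smooth s c : smooth_fun (fun w : 'rV[R]_n => x_ s w c).
Proof.
elim/ord_liftP: c => [|j]; rewrite ?stereo_coord0 ?stereo_coordS.
  apply: smooth_funD; first exact: smooth_fun_cst.
  by apply: smooth_funM; [exact: smooth_fun_cst|exact: conf_smooth].
by apply: smooth_funM; [exact: conf_smooth|exact: coord_smooth].
Qed.

Lemma partial_stereo s c k u : partial (fun w => x_ s w c) k u = conf u ^+ 2 * frame s c k u.
Proof.
have [cd _ _] := smooth_funP (@conf_smooth R n).
have [ed _ _] := smooth_funP (smooth_funM (smooth_fun_cst n (- pole_sign s)) (@conf_smooth R n)).
elim/ord_liftP: c => [|j]; rewrite ?stereo_coord0 ?stereo_coordS.
  rewrite (partialD (@derivable_cst _ _ _ (pole_sign s) u (e_ k)) (ed k u)) (partialZ (cd k u)).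
  by rewrite partial_cst partial_conf frame0; ring.
rewrite (partialM (cd k u) (@derivable_coord _ _ _ _ _)) partial_coord partial_conf frameS confVE.
rewrite [k == j]eq_sym; field.
exact: lt0r_neq0 (conf_gt0 u).
Qed.

Lemma round_metricE s u : round_metric s u = (conf u ^+ 2)%:M.
Proof.
apply/matrixP => i j; rewrite !mxE.
rewrite (eq_bigr (fun c => conf u ^+ 4 * (frame s c i u * frame s c j u))); last first.
  by move=> c _; rewrite !partial_stereo; ring.
rewrite -mulr_sumr sum_framer confVE -[RHS]mulr_natr.
field; exact: lt0r_neq0 (conf_gt0 u).
Qed.

(** The chart expression of the [c]-th ambient component of the spherical gradient. *)
Definition Dch s c h u : R := \sum_k frame s c k u * partial h k u.

Lemma Dch_smooth s c h : smooth_fun h -> smooth_fun (Dch s c h).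
Proof.
move=> hs; have [_ ps _] := smooth_funP hs.
apply: smooth_fun_sum => k; apply: smooth_funM; [exact: frame_smooth|exact: ps].
Qed.

Lemma DchD s c h g u : smooth_fun h -> smooth_fun g ->
  Dch s c (fun w => h w + g w) u = Dch s c h u + Dch s c g u.
Proof.
move=> /smooth_funP[hd _ _] /smooth_funP[gd _ _].
rewrite /Dch -big_split /=; apply: eq_bigr => k _.
by rewrite (partialD (hd k u) (gd k u)) mulrDr.
Qed.

Lemma DchM s c h g u : smooth_fun h -> smooth_fun g ->
  Dch s c (fun w => h w * g w) u = Dch s c h u * g u + h u * Dch s c g u.
Proof.
move=> /smooth_funP[hd _ _] /smooth_funP[gd _ _].
rewrite /Dch mulr_suml mulr_sumr -big_split /=; apply: eq_bigr => k _.
by rewrite (partialM (hd k u) (gd k u)); ring.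
Qed.

Lemma Dch_cst s c a u : Dch s c (fun=> a) u = 0.
Proof. by rewrite /Dch big1 // => k _; rewrite partial_cst mulr0. Qed.

Lemma Dch_stereo s c d u : Dch s c (fun w => x_ s w d) u = (c == d)%:R - x_ s u c * x_ s u d.
Proof.
rewrite /Dch (eq_bigr (fun k => conf u ^+ 2 * (frame s c k u * frame s d k u))); last first.
  by move=> k _; rewrite partial_stereo; ring.
rewrite -mulr_sumr sum_framel confVE; field; exact: lt0r_neq0 (conf_gt0 u).
Qed.

Lemma sum_stereo_Dch s h u : \sum_c x_ s u c * Dch s c h u = 0.
Proof.
rewrite /Dch (eq_bigr (fun c => \sum_k x_ s u c * frame s c k u * partial h k u)); last first.
  by move=> c _; rewrite mulr_sumr; apply: eq_bigr => k _; rewrite mulrA.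
rewrite exchange_big big1 //= => k _.
by rewrite -mulr_suml sum_stereo_frame mul0r.
Qed.

Lemma Dch_frame s c k u : Dch s c (frame s ord0 k) u = pole_sign s * frame s c k u.
Proof.
rewrite /Dch (eq_bigr (fun l => pole_sign s * ((k == l)%:R * frame s c l u))); last first.
  by move=> l _; rewrite partial_frame0; ring.
by rewrite -mulr_sumr delta_sum.
Qed.

Lemma Dch0_frameS s j k u : Dch s ord0 (frame s (lift ord0 j) k) u =
  pole_sign s * ((j == k)%:R * sqnorm u - u 0 k * u 0 j *+ 2).
Proof.
rewrite /Dch (eq_bigr (fun l => (0 * (j == l)%:R + pole_sign s * u 0 l) *
  ((j == k)%:R * u 0 l + - u 0 k * (j == l)%:R + - u 0 j * (k == l)%:R))); last first.
  by move=> l _; rewrite partial_frameS frame0; ring.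
by rewrite sum_affine; ring.
Qed.

Lemma DchS_frameS s i j k u : Dch s (lift ord0 i) (frame s (lift ord0 j) k) u =
  confV u * ((j == k)%:R * u 0 i - u 0 k * (i == j)%:R - u 0 j * (i == k)%:R) -
  u 0 i * ((j == k)%:R * sqnorm u - u 0 k * u 0 j *+ 2).
Proof.
rewrite /Dch (eq_bigr (fun l => (confV u * (i == l)%:R + - u 0 i * u 0 l) *
  ((j == k)%:R * u 0 l + - u 0 k * (j == l)%:R + - u 0 j * (k == l)%:R))); last first.
  by move=> l _; rewrite partial_frameS frameS; ring.
by rewrite sum_affine; ring.
Qed.

(** The components of the gradient do not commute: this is their bracket on the
    level of coefficients. *)
Lemma frame_bracket s c d k u :
  Dch s c (frame s d k) u - Dch s d (frame s c k) u =
  x_ s u c * frame s d k u - x_ s u d * frame s c k u.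
Proof.
elim/ord_liftP: c; [|move=> i]; (elim/ord_liftP: d; [|move=> j]);
  rewrite ?Dch_frame ?Dch0_frameS ?DchS_frameS ?stereo0 ?stereoS ?frame0 ?frameS.
- ring.
- by chart_field s u.
- by chart_field s u.
- rewrite [j == i]eq_sym; by chart_field s u.
Qed.

(** The first-order term of the sum of squares, which makes it agree with the
    Laplace-Beltrami operator. *)
Lemma sum_Dch_frame s l u : \sum_c Dch s c (frame s c l) u = - (n%:R - 2) * confV u * u 0 l.
Proof.
rewrite big_ord_recl Dch_frame frame0.
rewrite (eq_bigr (fun j => - (confV u * u 0 l) +
   ((l == j)%:R * (- sqnorm u * u 0 j) + 2 * u 0 l * u 0 j ^+ 2))); last first.
  move=> j _; rewrite DchS_frameS eqxx [l == j]eq_sym.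
  by have [->|_] := eqVneq j l; rewrite /=; ring.
rewrite !big_split /= delta_sum -mulr_sumr -/(sqnorm u) sumr_const card_ord -mulr_natr.
rewrite mulrA -expr2 sqr_sgn sqnorm_confV; ring.
Qed.

Lemma Dch_Dch s c d h u : smooth_fun h ->
  Dch s c (Dch s d h) u =
    \sum_k Dch s c (frame s d k) u * partial h k u +
    \sum_k \sum_l frame s d k u * frame s c l u * partial (partial h k) l u.
Proof.
move=> hs; have [_ ps _] := smooth_funP hs.
rewrite -big_split /=.
have dk k : smooth_fun (fun w => frame s d k w * partial h k w).
  by apply: smooth_funM; [exact: frame_smooth|exact: ps].
rewrite {1}/Dch (eq_bigr (fun l => \sum_k frame s c l u * partial
  (fun w => frame s d k w * partial h k w) l u)); last first.
  move=> l _; rewrite -mulr_sumr; congr (_ * _).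
  by rewrite (partial_sum (index_enum _) (fun k => let: And3 dd _ _ := smooth_funP (dk k) in dd l u)).2.
rewrite exchange_big /=; apply: eq_bigr => k _.
rewrite -/(Dch s c (fun w => frame s d k w * partial h k w) u) DchM //; last exact: frame_smooth.
congr (_ + _); rewrite /Dch mulr_sumr; apply: eq_bigr => l _; exact: mulrA.
Qed.

Lemma DchC s c d h u : smooth_fun h ->
  Dch s c (Dch s d h) u - Dch s d (Dch s c h) u =
  x_ s u c * Dch s d h u - x_ s u d * Dch s c h u.
Proof.
move=> hs; rewrite !Dch_Dch //.
have -> : \sum_k \sum_l frame s c k u * frame s d l u * partial (partial h k) l u =
   \sum_k \sum_l frame s d k u * frame s c l u * partial (partial h k) l u.
  rewrite exchange_big /=; apply: eq_bigr => k _; apply: eq_bigr => l _.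
  by rewrite (partialC hs) [frame s c l u * _]mulrC.
rewrite opprD addrACA subrr addr0 -sumrB !mulr_sumr -sumrB.
apply: eq_bigr => k _; rewrite -mulrBl frame_bracket; ring.
Qed.

Lemma partial_conf_exp m k u :
  derivable (fun w : 'rV[R]_n => conf w ^+ m) u (e_ k) /\
  partial (fun w : 'rV[R]_n => conf w ^+ m) k u = - m%:R * conf u ^+ m.+1 * u 0 k.
Proof.
elim: m => [|m [IHd IHp]].
  have -> : (fun w : 'rV[R]_n => conf w ^+ 0) = fun=> 1 by [].
  by rewrite partial_cst oppr0 !mul0r; split; first exact: derivable_cst.
have -> : (fun w : 'rV[R]_n => conf w ^+ m.+1) = fun w => conf w * conf w ^+ m.
  by apply/funext => w; rewrite exprS.
have cd := @conf_derivable R n k u.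
split; first exact: (derivableM cd IHd).
rewrite (partialM cd IHd) IHp partial_conf -natr1 !exprS; ring.
Qed.

(** The Laplace-Beltrami operator of the chart on real functions: the metric is
    [conf ^+ 2] times the identity, so the volume is [conf ^+ n]. *)
Definition laplace_ch h u : R :=
  (conf u ^+ n)^-1 * \sum_k partial (fun w => conf w ^+ (n - 2) * partial h k w) k u.

Lemma laplace_chE h u : (2 <= n)%N -> smooth_fun h ->
  laplace_ch h u = - (n - 2)%:R * confV u * (\sum_k u 0 k * partial h k u) +
    confV u ^+ 2 * \sum_k partial (partial h k) k u.
Proof.
move=> n2 hs; have [hd ps _] := smooth_funP hs.
have c0 := lt0r_neq0 (conf_gt0 u).
rewrite /laplace_ch !mulr_sumr -big_split /=; apply: eq_bigr => k _.
have [pd _ _] := smooth_funP (ps k).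
have [ed ep] := partial_conf_exp (n - 2) k u.
rewrite (partialM ed (pd k u)) ep confVE.
have -> : conf u ^+ n = conf u ^+ (n - 2) * conf u ^+ 2 by rewrite -exprD subnK.
have := expf_neq0 (n - 2) c0; rewrite (exprS _ (n - 2)).
move: (conf u ^+ (n - 2)) => y y0; field.
by rewrite y0 c0.
Qed.

(** The Laplacian is the sum of the squares of the ambient gradient components:
    the frame is orthogonal and its first-order part is [sum_Dch_frame]. *)
Lemma laplace_Dch s h u : (2 <= n)%N -> smooth_fun h ->
  laplace_ch h u = \sum_c Dch s c (Dch s c h) u.
Proof.
move=> n2 hs; rewrite laplace_chE //.
rewrite (eq_bigr _ (fun c _ => Dch_Dch s c c u hs)) big_split /=; congr (_ + _).
  rewrite exchange_big /= mulr_sumr; apply: eq_bigr => k _.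
  by rewrite -mulr_suml sum_Dch_frame natrB //; ring.
rewrite exchange_big /= mulr_sumr; apply: eq_bigr => k _.
rewrite exchange_big /=.
rewrite (eq_bigr (fun l => (k == l)%:R * (confV u ^+ 2 * partial (partial h k) l u))); last first.
  by move=> l _; rewrite -mulr_suml sum_framer; ring.
by rewrite delta_sum.
Qed.

End ChartOperators.

(** * The operators of the round metric in a chart *)

Section ComplexChart.
Variables (R : realType) (n : nat).
Implicit Types (u v : 'rV[R]_n) (s : bool).
Local Open Scope complex_scope.

Lemma Re_rmul (a : R) (z : R[i]) : complex.Re (a%:C * z) = a * complex.Re z.
Proof. by case: z => x y /=; rewrite mul0r subr0. Qed.

Lemma Im_rmul (a : R) (z : R[i]) : complex.Im (a%:C * z) = a * complex.Im z.
Proof. by case: z => x y /=; rewrite mul0r addr0. Qed.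

Lemma complex_eta (z : R[i]) : z = complex.Re z +i* complex.Im z.
Proof. by case: z. Qed.

Lemma volume_round s u : volume (round_metric s) u = conf u ^+ n.
Proof.
rewrite /volume round_metricE det_scalar -exprM mulnC exprM sqrtr_sqr ger0_norm //.
by rewrite exprn_ge0 // ltW // conf_gt0.
Qed.

Lemma grad_round s (phi : 'rV[R]_n -> R[i]) u i :
  grad (round_metric s) phi u 0 i = ((conf u ^+ 2)^-1)%:C * cpartial phi i u.
Proof.
rewrite /grad mxE /cmetric round_metricE map_scalar_mx /=.
rewrite invmx_scalar (bigD1 i) //= mxE eqxx mulr1n big1 ?addr0; last first.
  by move=> j ji; rewrite mxE eq_sym (negbTE ji) mulr0n mul0r.
by rewrite fmorphV.
Qed.

Lemma tau_round s (phi : 'rV[R]_n -> R[i]) u : (2 <= n)%N ->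
  tau (round_metric s) phi u =
  laplace_ch (fun w => complex.Re (phi w)) u +i* laplace_ch (fun w => complex.Im (phi w)) u.
Proof.
move=> n2; rewrite /tau /divergence volume_round -fmorphV.
have E w : conf w ^+ n * (conf w ^+ 2)^-1 = conf w ^+ (n - 2).
  by rewrite -{1}(subnK n2) exprD mulfK // expf_neq0 // lt0r_neq0 // conf_gt0.
rewrite [LHS]complex_eta Re_rmul Im_rmul /laplace_ch !raddf_sum.
congr Complex; congr (_ * _); apply: eq_bigr => i _ /=; congr (partial _ i u); apply/funext => w.
- by rewrite Re_rmul volume_round grad_round Re_rmul mulrA E.
- by rewrite Im_rmul volume_round grad_round Im_rmul mulrA E.
Qed.

(** Complex-linear extension of [Dch]. *)
Definition cDch s c (phi : 'rV[R]_n -> R[i]) u : R[i] :=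
  Dch s c (fun w => complex.Re (phi w)) u +i* Dch s c (fun w => complex.Im (phi w)) u.

Lemma cDchE s c (phi : 'rV[R]_n -> R[i]) u :
  cDch s c phi u = \sum_k (frame s c k u)%:C * cpartial phi k u.
Proof.
rewrite [RHS]complex_eta !raddf_sum /cDch /Dch.
congr Complex; apply: eq_bigr => k _.
- exact: (esym (Re_rmul (frame s c k u) (cpartial phi k u))).
- exact: (esym (Im_rmul (frame s c k u) (cpartial phi k u))).
Qed.

Lemma kappa_round s (phi : 'rV[R]_n -> R[i]) u :
  kappa (round_metric s) phi phi u = \sum_c cDch s c phi u ^+ 2.
Proof.
transitivity (\sum_k ((confV u ^+ 2)%:C * cpartial phi k u ^+ 2)).
  rewrite /kappa; apply: eq_bigr => i _.
  rewrite (bigD1 i) //= big1 ?addr0; last first.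
    move=> j ji; rewrite /cmetric round_metricE map_scalar_mx mxE eq_sym (negbTE ji).
    by rewrite mulr0n !mul0r.
  rewrite /cmetric round_metricE map_scalar_mx mxE eqxx mulr1n !grad_round confVE.
  rewrite exprVn !fmorphV /=.
  have : ((conf u ^+ 2)%:C : R[i]) != 0.
    by rewrite fmorph_eq0 expf_neq0 // lt0r_neq0 // conf_gt0.
  by move: ((conf u ^+ 2)%:C) (cpartial phi i u) => a z a0; field.
rewrite (eq_bigr (fun c => \sum_k \sum_l (frame s c k u * frame s c l u)%:C *
  (cpartial phi k u * cpartial phi l u))); last first.
  move=> c _; rewrite cDchE expr2 mulr_suml; apply: eq_bigr => k _.
  by rewrite mulr_sumr; apply: eq_bigr => l _; rewrite rmorphM /=; ring.
rewrite exchange_big; apply: eq_bigr => k _; rewrite exchange_big.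
transitivity (\sum_l (k == l)%:R * ((confV u ^+ 2)%:C * (cpartial phi k u * cpartial phi l u))).
  rewrite (bigD1 k) // eqxx mul1r big1 => [|l /negbTE lk]; last by rewrite eq_sym lk mul0r.
  exact: (esym (addr0 _)).
apply: eq_bigr => l _; rewrite -mulr_suml -(raddf_sum (real_complex R)) sum_framer.
have [->|_] := eqVneq k l; first by rewrite mulr1 mul1r.
by rewrite mulr0 rmorph0 !mul0r.
Qed.

End ComplexChart.

(** * Functions on the sphere and their gradient *)

Lemma is_derive_inv (R : realType) (f : R -> R) (t df : R) : f t != 0 ->
  is_derive t 1 f df -> is_derive t 1 (fun s => (f s)^-1) (- (f t) ^- 2 * df).
Proof.
move=> f0 [fd fe]; split; first exact: (@derivableV _ _ f t 1 f0 fd).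
by rewrite (@deriveV _ _ f t 1 f0 fd) fe.
Qed.

Section SphereFunctions.
Variables (R : realType) (n : nat).
Notation S := (sphere_point R n).
Implicit Types (phi psi : S -> R) (p : S) (u v : 'rV[R]_n) (s : bool) (k l : 'I_n)
  (c d : 'I_n.+1).

Definition pcoord c p : R := sval p 0 c.

Lemma sum_pcoord p : \sum_c pcoord c p ^+ 2 = 1.
Proof. by have /eqP := valP p. Qed.

Lemma pcoord_chart s u c : pcoord c (sphere_chart s u) = stereo s u 0 c.
Proof. by []. Qed.

(** The denominator of the stereographic projection. *)
Definition pole_gap s p : R := 1 - pole_sign s * pcoord ord0 p.

Definition stereo_proj s p : 'rV[R]_n := \row_k (pcoord (lift ord0 k) p / pole_gap s p).

Lemma sum_tail_sqr p : \sum_k pcoord (lift ord0 k) p ^+ 2 = 1 - pcoord ord0 p ^+ 2.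
Proof. by have := sum_pcoord p; rewrite big_ord_recl /= => <-; ring. Qed.

Lemma conf_proj s p : pole_gap s p != 0 -> conf (stereo_proj s p) = pole_gap s p.
Proof.
move=> g0; rewrite /conf.
have -> : sqnorm (stereo_proj s p) = (1 - pcoord ord0 p ^+ 2) / pole_gap s p ^+ 2.
  rewrite -sum_tail_sqr mulr_suml; apply: eq_bigr => k _.
  by rewrite mxE expr_div_n.
have -> : 1 - pcoord ord0 p ^+ 2 = pole_gap s p * (2 - pole_gap s p).
  by rewrite /pole_gap /pole_sign; case: s {g0} => /=; rewrite ?expr0 ?expr1; ring.
have -> : 1 + pole_gap s p * (2 - pole_gap s p) / pole_gap s p ^+ 2 = 2 / pole_gap s p by field.
by rewrite invf_div mulrC divfK // pnatr_eq0.
Qed.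

Lemma stereo_projK s p : pole_gap s p != 0 -> sphere_chart s (stereo_proj s p) = p.
Proof.
move=> g0; apply: val_inj => /=; apply/rowP; elim/ord_liftP => [|k].
  rewrite stereo0 conf_proj // /pole_gap opprB addrC subrK mulrA -expr2 sqr_sgn mul1r.
  by [].
rewrite stereoS conf_proj // mxE mulrC divfK //.
Qed.

(** A chart whose missing point is far from [p]. *)
Definition chart_of p : bool := 0 < pcoord ord0 p.

Lemma pole_gap_chart_of p : pole_gap (chart_of p) p != 0.
Proof.
rewrite /pole_gap /pole_sign /chart_of; case: ltrP => x0.
  by rewrite expr1 mulN1r opprK gt_eqF // addr_gt0.
by rewrite expr0 mul1r gt_eqF // subr_gt0 (le_lt_trans x0).
Qed.

Definition rsmooth phi := forall s, smooth_fun (fun u => phi (sphere_chart s u)).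

Section Curve.
Variables (g : R -> S) (dg : 'I_n.+1 -> R) (t : R).
Hypothesis gd : forall c, is_derive t 1 (fun r => pcoord c (g r)) (dg c).

Lemma curve_tangent : \sum_c pcoord c (g t) * dg c = 0.
Proof.
pose X c : R -> R := fun r => pcoord c (g r).
have : is_derive t 1 (\sum_c (X c * X c)) (\sum_c (X c t *: dg c + X c t *: dg c)).
  by apply: is_derive_sum => c; apply: is_deriveM.
have -> : \sum_c (X c * X c) = fun=> 1.
  by apply/funext => r; rewrite fct_sumE -(sum_pcoord (g r)); apply: eq_bigr.
move=> [_]; rewrite derive_cst => /esym.
rewrite (eq_bigr (fun c => 2 * (pcoord c (g t) * dg c))); last first.
  by move=> c _; rewrite /X /GRing.scale /=; ring.
by rewrite -mulr_sumr => /eqP; rewrite mulf_eq0 pnatr_eq0 /= => /eqP.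
Qed.

(** The chain rule in ambient coordinates: the velocity [dg] is tangent to the
    sphere, so its pairing with the ambient gradient is the derivative. *)
Lemma curve_chart phi s : rsmooth phi -> pole_gap s (g t) != 0 ->
  is_derive t 1 (phi \o g)
   (\sum_c dg c * Dch s c (fun u => phi (sphere_chart s u)) (stereo_proj s (g t))).
Proof.
move=> ps g0; set h := fun u => _; set u := stereo_proj s (g t).
have [hd hc _] := smooth_funP (ps s).
have gapd : is_derive t 1 (fun r => pole_gap s (g r)) (- (pole_sign s * dg ord0)).
  rewrite /pole_gap -[X in is_derive _ _ _ X]add0r.
  by apply: is_deriveB; exact: is_deriveZ.
have wd k : is_derive t 1 (fun r => stereo_proj s (g r) 0 k)
    ((dg (lift ord0 k) * pole_gap s (g t) + pole_sign s * pcoord (lift ord0 k) (g t) * dg ord0)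
      / pole_gap s (g t) ^+ 2).
  pose F : R -> R := fun r => pcoord (lift ord0 k) (g r).
  pose G : R -> R := fun r => (pole_gap s (g r))^-1.
  have -> : (fun r => stereo_proj s (g r) 0 k) = F * G.
    by apply/funext => r; rewrite mxE.
  have Gd := @is_derive_inv R (fun r => pole_gap s (g r)) t _ g0 gapd.
  have Z := (@is_deriveM _ _ F G t 1 _ _ (gd (lift ord0 k)) Gd). refine (is_derive_eq Z _).
  by rewrite /F /G /GRing.scale /=; field.
have D := C1_curve hd (fun i => let: And3 _ _ c := smooth_funP (hc i) in c)
  (dw := \row_k ((dg (lift ord0 k) * pole_gap s (g t) + pole_sign s * pcoord (lift ord0 k)
    (g t) * dg ord0)
      / pole_gap s (g t) ^+ 2)) (w := fun r => stereo_proj s (g r)) (t := t).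
have {}D : is_derive t 1 (h \o (fun r => stereo_proj s (g r)))
   (\sum_c dg c * Dch s c h u).
  apply: is_derive_eq; first by apply: D => i; rewrite mxE; exact: wd.
  rewrite /Dch.
  rewrite [RHS](eq_bigr (fun c => \sum_k dg c * frame s c k u * partial h k u)); last first.
    by move=> c _; rewrite mulr_sumr; apply: eq_bigr => k _; rewrite mulrA.
  rewrite exchange_big /=; apply: eq_bigr => k _; rewrite -mulr_suml mxE.
  congr (_ * _); rewrite big_ord_recl frame0.
  rewrite (eq_bigr (fun j => (k == j)%:R * (dg (lift ord0 j) * confV u) -
     u 0 k / pole_gap s (g t) * (pcoord (lift ord0 j) (g t) * dg (lift ord0 j)))); last first.
    by move=> j _; rewrite frameS [j == k]eq_sym [u 0 j]mxE; field.
  rewrite sumrB delta_sum -mulr_sumr confVE conf_proj //.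
  have := curve_tangent; rewrite big_ord_recl => /eqP; rewrite addrC addr_eq0 => /eqP ->.
  rewrite /u mxE; move: g0; rewrite /pole_gap /pole_sign; case: (s) => /=;
    rewrite ?expr0 ?expr1 => g0; field.
    by move: g0; rewrite mulN1r opprK.
  by move: g0; rewrite mul1r.
apply: near_eq_is_derive D.
have : \forall r \near t, pole_gap s (g r) != 0.
  have := differentiable_continuous ((derivable1_diffP _ _).1 (@ex_derive _ _ _ _ _ _ _ gapd)).
  move=> /cvgrPdist_lt /(_ `|pole_gap s (g t)|); rewrite normr_gt0 => /(_ g0).
  apply: filterS => r; apply: contraTneq => ->; by rewrite subr0 ltxx.
by apply: filterS => r gr; rewrite /= /h stereo_projK.
Qed.

End Curve.

(** The [c]-th ambient component of the spherical gradient.  It is read in the chart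
    [chart_of p]; [Sd_chart] shows that every chart gives the same value. *)
Definition Sd c phi p : R :=
  Dch (chart_of p) c (fun u => phi (sphere_chart (chart_of p) u)) (stereo_proj (chart_of p) p).

(** Both sides are the derivative of [phi] along the curve which leaves [p] in
    the direction of the projection of the [c]-th basis vector. *)
Lemma Sd_chart c phi s u : rsmooth phi ->
  Sd c phi (sphere_chart s u) = Dch s c (fun u => phi (sphere_chart s u)) u.
Proof.
move=> ps; set p := sphere_chart s u; set s' := chart_of p.
pose w (t : R) : 'rV[R]_n := u + t *: \row_k frame s c k u.
have w0 : w 0 = u by rewrite /w scale0r addr0.
have wd i : is_derive (0 : R) 1 (fun t => w t 0 i) ((\row_k frame s c k u) 0 i).
  have Z := is_derive_line (@derivable_coord R n i (u + 0 *: \row_k frame s c k u)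
    (\row_k frame s c k u)).
  by refine (is_derive_eq Z _); rewrite derive_coord.
have along h : smooth_fun h -> is_derive (0 : R) 1 (h \o w) (Dch s c h u).
  move=> hs; have [hd hc _] := smooth_funP hs.
  apply: is_derive_eq.
    exact: (C1_curve hd (fun i => let: And3 _ _ c := smooth_funP (hc i) in c) wd).
  by rewrite w0 /Dch; apply: eq_bigr => k _; rewrite mxE.
have D1 := along _ (ps s).
pose g t := sphere_chart s (w t).
have g0 : g 0 = p by rewrite /g w0.
have D2 : is_derive (0 : R) 1 (phi \o g)
   (\sum_d ((c == d)%:R - pcoord c p * pcoord d p) * Dch s' d (fun u => phi (sphere_chart s' u))
     (stereo_proj s' p)).
  rewrite -[in stereo_proj s' p]g0; apply: curve_chart => //; last by rewrite g0 pole_gap_chart_of.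
  move=> d; rewrite -[X in is_derive _ _ _ X]Dch_stereo; apply: along.
  exact: stereo_smooth.
have <- := @derive_val _ _ _ _ _ _ _ D1.
apply: (etrans _ (esym (@derive_val _ _ _ _ _ _ _ D2))); rewrite /Sd -/s'.
under [RHS]eq_bigr do rewrite mulrBl.
rewrite sumrB [X in _ - X](eq_bigr (fun d => pcoord c p * (stereo s' (stereo_proj s' p) 0 d *
   Dch s' d (fun u => phi (sphere_chart s' u)) (stereo_proj s' p)))); last first.
  move=> d _; rewrite -mulrA; congr (_ * (_ * _)).
  by rewrite -pcoord_chart stereo_projK // pole_gap_chart_of.
rewrite -mulr_sumr sum_stereo_Dch mulr0 subr0.
rewrite (bigD1 c) //= eqxx mul1r big1 ?addr0 // => d dc.
by rewrite eq_sym (negbTE dc) mul0r.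
Qed.

Lemma sphere_curve phi (g : R -> S) (dg : 'I_n.+1 -> R) (t : R) : rsmooth phi ->
  (forall c, is_derive t 1 (fun r => pcoord c (g r)) (dg c)) ->
  is_derive t 1 (phi \o g) (\sum_c dg c * Sd c phi (g t)).
Proof.
move=> ps gd; have g0 := pole_gap_chart_of (g t).
exact: (curve_chart gd ps g0).
Qed.

End SphereFunctions.

(** * Calculus on the sphere and the maximum principle *)

Section SphereCalculus.
Variables (R : realType) (n : nat).
Notation S := (sphere_point R n).
Implicit Types (phi psi : S -> R) (p : S) (u v : 'rV[R]_n) (s : bool) (k l : 'I_n)
  (c d : 'I_n.+1).
Notation x_ c := (fun p : S => pcoord c p).

Lemma chart_forall (P : S -> Prop) : (forall s u, P (sphere_chart s u)) -> forall p, P p.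
Proof. by move=> H p; have [s [u <-]] := sphere_cover p. Qed.

Lemma rsmooth_cst a : rsmooth (fun _ : S => a).
Proof. by move=> s; exact: smooth_fun_cst. Qed.

Lemma rsmoothD phi psi : rsmooth phi -> rsmooth psi -> rsmooth (fun p => phi p + psi p).
Proof. by move=> h1 h2 s; exact: smooth_funD. Qed.

Lemma rsmoothM phi psi : rsmooth phi -> rsmooth psi -> rsmooth (fun p => phi p * psi p).
Proof. by move=> h1 h2 s; exact: smooth_funM. Qed.

Lemma rsmoothZ a phi : rsmooth phi -> rsmooth (fun p => a * phi p).
Proof. by move=> h; apply: rsmoothM => //; exact: rsmooth_cst. Qed.

Lemma rsmoothB phi psi : rsmooth phi -> rsmooth psi -> rsmooth (fun p => phi p - psi p).
Proof.
move=> h1 h2; have -> : (fun p => phi p - psi p) = fun p => phi p + -1 * psi p.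
  by apply/funext => p; rewrite mulN1r.
by apply: rsmoothD => //; exact: rsmoothZ.
Qed.

Lemma rsmooth_sum (I : Type) (r : seq I) (F : I -> S -> R) :
  (forall i, rsmooth (F i)) -> rsmooth (fun p => \sum_(i <- r) F i p).
Proof. by move=> h s; apply: smooth_fun_sum => i; exact: h. Qed.

Lemma rsmooth_pcoord c : rsmooth (x_ c).
Proof. by move=> s; exact: stereo_smooth. Qed.

Lemma Sd_chart_fun c phi s : rsmooth phi ->
  (fun u => Sd c phi (sphere_chart s u)) = Dch s c (fun u => phi (sphere_chart s u)).
Proof. by move=> ps; apply/funext => u; exact: Sd_chart. Qed.

Lemma rsmooth_Sd c phi : rsmooth phi -> rsmooth (Sd c phi).
Proof. by move=> ps s; rewrite Sd_chart_fun //; apply: Dch_smooth; exact: ps. Qed.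

Lemma SdD c phi psi : rsmooth phi -> rsmooth psi ->
  Sd c (fun p => phi p + psi p) = fun p => Sd c phi p + Sd c psi p.
Proof.
move=> h1 h2; apply/funext; apply: chart_forall => s u.
by rewrite !Sd_chart ?DchD //; exact: rsmoothD.
Qed.

Lemma SdM c phi psi : rsmooth phi -> rsmooth psi ->
  Sd c (fun p => phi p * psi p) = fun p => Sd c phi p * psi p + phi p * Sd c psi p.
Proof.
move=> h1 h2; apply/funext; apply: chart_forall => s u.
by rewrite !Sd_chart ?DchM //; exact: rsmoothM.
Qed.

Lemma Sd_cst c a : Sd c (fun _ : S => a) = fun=> 0.
Proof. by apply/funext => p; rewrite /Sd Dch_cst. Qed.

Lemma SdZ c a phi : rsmooth phi -> Sd c (fun p => a * phi p) = fun p => a * Sd c phi p.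
Proof.
move=> h; rewrite (SdM c (rsmooth_cst a) h) Sd_cst; apply/funext => p.
by rewrite mul0r add0r.
Qed.

Lemma SdB c phi psi : rsmooth phi -> rsmooth psi ->
  Sd c (fun p => phi p - psi p) = fun p => Sd c phi p - Sd c psi p.
Proof.
move=> h1 h2; have -> : (fun p => phi p - psi p) = fun p => phi p + -1 * psi p.
  by apply/funext => p; rewrite mulN1r.
rewrite SdD ?SdZ //; last exact: rsmoothZ.
by apply/funext => p; rewrite mulN1r.
Qed.

Lemma Sd_sum c (I : Type) (r : seq I) (F : I -> S -> R) : (forall i, rsmooth (F i)) ->
  Sd c (fun p => \sum_(i <- r) F i p) = fun p => \sum_(i <- r) Sd c (F i) p.
Proof.
move=> h; elim: r => [|i r IH].
  rewrite (_ : (fun p => _) = fun=> 0) ?Sd_cst; apply/funext => p; rewrite big_nil //.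
rewrite (_ : (fun p => \sum_(k <- i :: r) F k p) = fun p => F i p + \sum_(k <- r) F k p).
  by rewrite SdD ?IH //; [apply/funext => p; rewrite big_cons|exact: rsmooth_sum].
by apply/funext => p; rewrite big_cons.
Qed.

Lemma Sd_pcoord c d : Sd c (x_ d) = fun p => (c == d)%:R - pcoord c p * pcoord d p.
Proof.
apply/funext; apply: chart_forall => s u; rewrite Sd_chart; last exact: rsmooth_pcoord.
exact: Dch_stereo.
Qed.

Lemma sum_pcoord_Sd phi p : rsmooth phi -> \sum_c pcoord c p * Sd c phi p = 0.
Proof.
move: p; apply: chart_forall => s u ps.
apply: etrans (sum_stereo_Dch s (fun u => phi (sphere_chart s u)) u).
by apply: eq_bigr => c _; rewrite Sd_chart.
Qed.

Lemma SdC c d phi p : rsmooth phi -> Sd c (Sd d phi) p - Sd d (Sd c phi) p =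
  pcoord c p * Sd d phi p - pcoord d p * Sd c phi p.
Proof.
move: p; apply: chart_forall => s u ps.
rewrite !Sd_chart ?Sd_chart_fun //; try exact: rsmooth_Sd.
by rewrite DchC //; exact: ps.
Qed.

(** The Laplace-Beltrami operator, see [lap_chart]. *)
Definition lap phi p : R := \sum_c Sd c (Sd c phi) p.

Lemma lap_chart phi s u : (2 <= n)%N -> rsmooth phi ->
  lap phi (sphere_chart s u) = laplace_ch (fun u => phi (sphere_chart s u)) u.
Proof.
move=> n2 ps; rewrite (laplace_Dch s u n2 (ps s)); apply: eq_bigr => c _.
by rewrite Sd_chart ?Sd_chart_fun //; exact: rsmooth_Sd.
Qed.

Lemma lap_mul phi psi p : rsmooth phi -> rsmooth psi ->
  lap (fun p => phi p * psi p) p =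
  lap phi p * psi p + phi p * lap psi p + 2 * \sum_c Sd c phi p * Sd c psi p.
Proof.
move=> h1 h2; rewrite /lap mulr_suml !mulr_sumr -!big_split /=; apply: eq_bigr => c _.
have h1' := rsmooth_Sd c h1; have h2' := rsmooth_Sd c h2.
rewrite (SdM c h1 h2) SdD; [|exact: rsmoothM..].
rewrite (SdM c h1' h2) (SdM c h1 h2').
move: (Sd c (Sd c phi) p) (Sd c (Sd c psi) p) (Sd c phi p) (Sd c psi p) (phi p) (psi p).
by move=> x y z w a b; ring.
Qed.

Lemma lapD phi psi p : rsmooth phi -> rsmooth psi ->
  lap (fun p => phi p + psi p) p = lap phi p + lap psi p.
Proof.
move=> h1 h2; rewrite /lap -!big_split /=; apply: eq_bigr => c _.
by rewrite !SdD //; exact: rsmooth_Sd.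
Qed.

Lemma lapZ a phi p : rsmooth phi -> lap (fun p => a * phi p) p = a * lap phi p.
Proof.
move=> h1; rewrite /lap mulr_sumr /=; apply: eq_bigr => c _.
by rewrite !SdZ //; exact: rsmooth_Sd.
Qed.

Lemma lap_sum (I : Type) (r : seq I) (F : I -> S -> R) p : (forall i, rsmooth (F i)) ->
  lap (fun p => \sum_(i <- r) F i p) p = \sum_(i <- r) lap (F i) p.
Proof.
move=> h; rewrite /lap [RHS]exchange_big; apply: eq_bigr => c _.
by rewrite !Sd_sum // => i; exact: rsmooth_Sd.
Qed.

(** Every point lies in the image of the unit cube under one of the two charts,
    so that a continuous function attains its maximum. *)
Lemma sphere_max phi : rsmooth phi -> exists p, forall q, phi q <= phi p.
Proof.
move=> ps; pose A : set 'rV[R]_n := [set v | forall i, `[(-1 : R), 1]%classic (v ord0 i)].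
have cA : compact A by apply: (@rV_compact _ _ (fun=> _)) => _; exact: segment_compact.
have A0 : A !=set0.
  by exists 0 => i /=; rewrite mxE in_itv /= lerN10 ler01.
have mx s : exists2 c, c \in A & forall t, t \in A ->
    phi (sphere_chart s t) <= phi (sphere_chart s c).
  apply: EVT_max_rV => //; apply: continuous_subspaceT.
  by have [_ _] := smooth_funP (ps s).
have [u0 _ m0] := mx false; have [u1 _ m1] := mx true.
have pc (q : S) c : `|pcoord c q| <= 1.
  rewrite -(@expr_le1 _ 2) // real_normK ?num_real // -(sum_pcoord q) (bigD1 c) //= lerDl.
  by apply: sumr_ge0 => k _; exact: sqr_ge0.
have cov (q : S) : exists s u, u \in A /\ sphere_chart s u = q.
  exists (chart_of q), (stereo_proj (chart_of q) q); split; last first.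
    by rewrite stereo_projK // pole_gap_chart_of.
  rewrite inE => i /=; rewrite mxE in_itv /= -ler_norml.
  have g1 : 1 <= pole_gap (chart_of q) q.
    rewrite /pole_gap /chart_of /pole_sign; case: ltrP => q0.
      by rewrite expr1 mulN1r opprK lerDl ltW.
    by rewrite expr0 mul1r lerDl oppr_ge0.
  rewrite normrM normfV [`|pole_gap _ _|]ger0_norm; last exact: le_trans g1.
  by rewrite ler_pdivrMr ?(lt_le_trans _ g1) // mul1r (le_trans (pc _ _)).
have [le01|le10] := lerP (phi (sphere_chart false u0)) (phi (sphere_chart true u1)).
- exists (sphere_chart true u1) => q; have [[|] [u [uA <-]]] := cov q; first exact: m1.
  exact: le_trans (m0 _ uA) le01.
- exists (sphere_chart false u0) => q; have [[|] [u [uA <-]]] := cov q; last exact: m0.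
  exact: le_trans (m1 _ uA) (ltW le10).
Qed.

(** At a maximum the gradient vanishes and the second partial derivatives in a
    chart are nonpositive. *)
Lemma lap_at_max phi p : (2 <= n)%N -> rsmooth phi ->
  (forall q, phi q <= phi p) -> lap phi p <= 0.
Proof.
move=> n2 ps; move: p; apply: chart_forall => s u mx.
rewrite (lap_chart s u n2 ps) (laplace_chE u n2 (ps s)).
set h := fun u => phi _.
have [hd hp _] := smooth_funP (ps s).
have key k : partial h k u = 0 /\ partial (partial h k) k u <= 0.
  have [pd _ _] := smooth_funP (hp k).
  have D1 t := is_derive_line (hd k (u + t *: delta_mx 0 k)).
  have D2 := is_derive_line (pd k (u + 0 *: delta_mx 0 k)).
  have [] := second_derivative_at_max D1 D2.
    by move=> t; rewrite scale0r addr0; exact: mx.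
  by rewrite scale0r addr0.
rewrite big1 ?mulr0 ?add0r; last by move=> k _; rewrite (key k).1 mulr0.
by rewrite mulr_ge0_le0 ?sqr_ge0 //; apply: sumr_le0 => k _; exact: (key k).2.
Qed.

End SphereCalculus.

(** * Infinitesimal rotations *)

Section Rotations.
Variables (R : realType) (n : nat).
Notation S := (sphere_point R n).
Implicit Types (phi psi a b : S -> R) (p q : S) (c d i j : 'I_n.+1).

(** The infinitesimal rotation in the plane of the axes [i] and [j]. *)
Definition axis_rot i j phi p : R := pcoord i p * Sd j phi p - pcoord j p * Sd i phi p.

Lemma rsmooth_axis_rot i j phi : rsmooth phi -> rsmooth (axis_rot i j phi).
Proof.
by move=> h; apply: rsmoothB; apply: rsmoothM; try exact: rsmooth_pcoord; exact: rsmooth_Sd.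
Qed.

Lemma Sd_axis_rot c i j phi : rsmooth phi -> Sd c (axis_rot i j phi) =
  fun p => axis_rot i j (Sd c phi) p + ((c == i)%:R * Sd j phi p - (c == j)%:R * Sd i phi p).
Proof.
move=> h; have xs := @rsmooth_pcoord R n; have ds k := rsmooth_Sd k h.
rewrite /axis_rot SdB; try by apply: rsmoothM.
rewrite !SdM // !Sd_pcoord; apply/funext => p.
have := SdC c j p h; have := SdC c i p h.
move=> /eqP; rewrite subr_eq => /eqP -> /eqP; rewrite subr_eq => /eqP ->.
ring.
Qed.

Lemma axis_rotD i j phi psi : rsmooth phi -> rsmooth psi ->
  axis_rot i j (fun p => phi p + psi p) = fun p => axis_rot i j phi p + axis_rot i j psi p.
Proof. by move=> h1 h2; apply/funext => p; rewrite /axis_rot !SdD //; ring. Qed.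

Lemma axis_rotZ i j s phi : rsmooth phi ->
  axis_rot i j (fun p => s * phi p) = fun p => s * axis_rot i j phi p.
Proof. by move=> h1; apply/funext => p; rewrite /axis_rot !SdZ //; ring. Qed.

Lemma axis_rot_sum i j (I : Type) (r : seq I) (F : I -> S -> R) : (forall k, rsmooth (F k)) ->
  axis_rot i j (fun p => \sum_(k <- r) F k p) = fun p => \sum_(k <- r) axis_rot i j (F k) p.
Proof.
by move=> h; apply/funext => p; rewrite /axis_rot !Sd_sum // !mulr_sumr -sumrB.
Qed.

Lemma delta_sumS c (F : 'I_n.+1 -> R) : \sum_d (d == c)%:R * F d = F c.
Proof.
rewrite (bigD1 c) //= eqxx mul1r big1 ?addr0 // => d dc.
by rewrite (negbTE dc) mul0r.
Qed.

(** Rotations are isometries: the commutators of [axis_rot i j] with the two factors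
    of [Sd c \o Sd c] cancel in the sum over [c]. *)
Lemma lap_axis_rot i j phi p : rsmooth phi -> lap (axis_rot i j phi) p = axis_rot i j (lap phi) p.
Proof.
move=> h; have ds k : rsmooth (Sd k phi) by exact: rsmooth_Sd.
have dds k l : rsmooth (Sd k (Sd l phi)) by exact: rsmooth_Sd.
rewrite /lap axis_rot_sum //.
rewrite (eq_bigr (fun c => axis_rot i j (Sd c (Sd c phi)) p +
   ((c == i)%:R * (Sd j (Sd c phi) p + Sd c (Sd j phi) p) -
    (c == j)%:R * (Sd i (Sd c phi) p + Sd c (Sd i phi) p)))); last first.
  move=> c _; rewrite Sd_axis_rot // SdD; last first.
  - by apply: rsmoothB; apply: rsmoothZ.
  - exact: rsmooth_axis_rot.
  rewrite Sd_axis_rot // SdB; try exact: rsmoothZ.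
  by rewrite !SdZ //; ring.
by rewrite big_split /= [X in _ + X]sumrB !delta_sumS; ring.
Qed.

(** Lagrange identity for the position and the gradient, which are orthogonal. *)
Lemma sum_axis_rot_sqr phi p : rsmooth phi ->
  \sum_i \sum_j axis_rot i j phi p ^+ 2 = 2 * \sum_c Sd c phi p * Sd c phi p.
Proof.
move=> h; have E1 := sum_pcoord_Sd p h; have E2 := sum_pcoord p.
set X := \sum_c _ * _.
transitivity (\sum_i (pcoord i p ^+ 2 * X + Sd i phi p ^+ 2 * 1
   - 2 * (pcoord i p * Sd i phi p * 0))).
  apply: eq_bigr => i _.
  rewrite (eq_bigr (fun j => pcoord i p ^+ 2 * (Sd j phi p * Sd j phi p) +
    Sd i phi p ^+ 2 * pcoord j p ^+ 2 -
    2 * (pcoord i p * Sd i phi p) * (pcoord j p * Sd j phi p))); last first.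
    by move=> j _; rewrite /axis_rot; ring.
  by rewrite sumrB big_split /= -!mulr_sumr E1 E2 -/X; ring.
rewrite sumrB big_split /= -!mulr_suml E2 -!mulr_sumr.
have -> : \sum_i Sd i phi p ^+ 2 = X by apply: eq_bigr => c _; rewrite expr2.
by rewrite big1 => [|i _]; rewrite ?mulr0 //; ring.
Qed.

End Rotations.

(** * The gradient estimate for eigenfunctions *)

Section Bernstein.
Variables (R : realType) (n : nat) (lr li : R).
Hypothesis n2 : (2 <= n)%N.
Notation S := (sphere_point R n).
Implicit Types (phi psi a b : S -> R) (p q : S) (c d i j : 'I_n.+1).

(** [a + i b] is an eigenfunction for the eigenvalue [lr + i li]. *)
Definition eigenpair a b := [/\ rsmooth a, rsmooth b,
  forall p, lap a p = lr * a p - li * b p & forall p, lap b p = li * a p + lr * b p].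

Definition normsq a b p : R := a p * a p + b p * b p.

Lemma rsmooth_normsq a b : rsmooth a -> rsmooth b -> rsmooth (normsq a b).
Proof. by move=> h1 h2; apply: rsmoothD; exact: rsmoothM. Qed.

Lemma normsq_ge0 a b p : 0 <= normsq a b p.
Proof. by rewrite /normsq -!expr2 addr_ge0 // sqr_ge0. Qed.

Lemma eigenpair_axis_rot i j a b : eigenpair a b -> eigenpair (axis_rot i j a) (axis_rot i j b).
Proof.
move=> [as_ bs ea eb]; split; try exact: rsmooth_axis_rot.
- move=> p; rewrite lap_axis_rot // (_ : lap a = fun q => lr * a q + - li * b q); last first.
    by apply/funext => q; rewrite ea mulNr.
  by rewrite axis_rotD ?axis_rotZ //; [ring|exact: rsmoothZ..].
- move=> p; rewrite lap_axis_rot // (_ : lap b = fun q => li * a q + lr * b q); last exact/funext.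
  by rewrite axis_rotD ?axis_rotZ //; exact: rsmoothZ.
Qed.

(** The imaginary part [li] of the eigenvalue disappears from this formula, so the
    maximum principle applies to complex eigenvalues as well. *)
Lemma lap_normsq a b p : eigenpair a b -> lap (normsq a b) p =
  2 * lr * normsq a b p +
  2 * (\sum_c Sd c a p * Sd c a p + \sum_c Sd c b p * Sd c b p).
Proof.
move=> [as_ bs ea eb]; rewrite /normsq lapD; try exact: rsmoothM.
by rewrite !lap_mul // ea eb; ring.
Qed.

(** Twice the squared norm of the gradient ([rotnormE]), written with operators
    which commute with the Laplacian. *)
Definition rotnorm a b p : R := \sum_i \sum_j normsq (axis_rot i j a) (axis_rot i j b) p.

Lemma rotnormE a b p : rsmooth a -> rsmooth b -> rotnorm a b p =
  2 * (\sum_c Sd c a p * Sd c a p + \sum_c Sd c b p * Sd c b p).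
Proof.
move=> h1 h2; rewrite mulrDr -!sum_axis_rot_sqr // -big_split /=; apply: eq_bigr => i _.
by rewrite -big_split /=; apply: eq_bigr => j _; rewrite /normsq !expr2.
Qed.

Lemma rotnorm_ge0 a b p : 0 <= rotnorm a b p.
Proof. by apply: sumr_ge0 => i _; apply: sumr_ge0 => j _; exact: normsq_ge0. Qed.

(** Chosen so that [2 * lr + growth] is at least 2, see [bernstein]. *)
Definition growth : R := 2 * (1 + `|lr|).

(** Bernstein's gradient estimate: apply the maximum principle to
    [rotnorm a b + growth * normsq a b], whose Laplacian is at least
    [2 * rotnorm a b] up to a multiple of [normsq a b]. *)
Lemma bernstein a b M : eigenpair a b -> (forall p, normsq a b p <= M) ->
  forall p, rotnorm a b p <= growth ^+ 2 * M.
Proof.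
move=> eab bound; have [as_ bs _ _] := eab.
have Ls i j : rsmooth (normsq (axis_rot i j a) (axis_rot i j b)).
  by apply: rsmooth_normsq; exact: rsmooth_axis_rot.
have gs : rsmooth (rotnorm a b) by do 2! apply: rsmooth_sum => ?.
have ns := rsmooth_normsq as_ bs.
set B := growth.
pose Phi p := rotnorm a b p + B * normsq a b p.
have Ps : rsmooth Phi by apply: rsmoothD => //; exact: rsmoothZ.
have [p pmax] := sphere_max Ps.
have lr0 := normr_ge0 lr; have lrl : - lr <= `|lr| by rewrite -normrN ler_norm.
have B0 : 0 <= B by rewrite /B /growth mulr_ge0 // addr_ge0.
(* the squared gradients of the rotational derivatives are nonnegative and dropped *)
have lapP : 2 * lr * rotnorm a b p + B * (2 * lr * normsq a b p + rotnorm a b p) <= lap Phi p.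
  rewrite lapD //; last exact: rsmoothZ.
  rewrite lapZ // lap_normsq // -rotnormE // lerD2r /rotnorm.
  rewrite lap_sum; last by move=> i; apply: rsmooth_sum.
  rewrite mulr_sumr; apply: ler_sum => i _.
  rewrite lap_sum // mulr_sumr; apply: ler_sum => j _.
  rewrite lap_normsq; last exact: eigenpair_axis_rot.
  rewrite lerDl mulr_ge0 // addr_ge0 //; apply: sumr_ge0 => c _;
    by rewrite -expr2 sqr_ge0.
have lap0 := lap_at_max n2 Ps pmax.
have G0 := rotnorm_ge0 a b p; have N0 := normsq_ge0 a b p; have NM := bound p.
have M0 : 0 <= M := le_trans N0 NM.
have key : rotnorm a b p <= B * `|lr| * M.
  have h1 : (2 * lr + B) * rotnorm a b p <= - lr * (2 * B * normsq a b p).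
    by have := le_trans lapP lap0; lra.
  have h2 : 2 * rotnorm a b p <= (2 * lr + B) * rotnorm a b p.
    apply: ler_wpM2r => //; rewrite /B /growth; lra.
  have h3 : - lr * (2 * B * normsq a b p) <= `|lr| * (2 * B * M).
    apply: (@le_trans _ _ (`|lr| * (2 * B * normsq a b p))).
      by apply: ler_wpM2r => //; rewrite !mulr_ge0.
    by apply: ler_wpM2l => //; apply: ler_wpM2l => //; rewrite mulr_ge0.
  have := le_trans h2 (le_trans h1 h3).
  by rewrite [leRHS](_ : _ = 2 * (B * `|lr| * M)) ?ler_pM2l //; ring.
move=> q; apply: (@le_trans _ _ (Phi q)).
  by rewrite /Phi lerDl mulr_ge0 // normsq_ge0.
apply: (le_trans (pmax q)); rewrite /Phi.
apply: (@le_trans _ _ (B * `|lr| * M + B * M)).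
  by apply: lerD => //; exact: ler_wpM2l.
have -> : B * `|lr| * M + B * M = (1 + `|lr|) * (B * M) by ring.
rewrite expr2 -mulrA; apply: ler_wpM2r; first exact: mulr_ge0.
by rewrite /B /growth; lra.
Qed.

End Bernstein.

(** * Derivatives along great circles *)

Section DirectionalRotation.
Variables (R : realType) (n : nat).
Notation S := (sphere_point R n).
Implicit Types (phi psi a b : S -> R) (p q : S) (c d i j : 'I_n.+1) (v : 'I_n.+1 -> R).

(** The infinitesimal rotation from the axis [j] towards [v]. *)
Definition dir_rot j v phi p : R := \sum_c v c * axis_rot j c phi p.

Lemma rsmooth_dir_rot j v phi : rsmooth phi -> rsmooth (dir_rot j v phi).
Proof. by move=> h; apply: rsmooth_sum => c; apply: rsmoothZ; exact: rsmooth_axis_rot. Qed.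

Lemma rsmooth_iter_dir_rot m j v phi : rsmooth phi -> rsmooth (iter m (dir_rot j v) phi).
Proof. by move=> h; elim: m => //= m IH; exact: rsmooth_dir_rot. Qed.

Lemma dir_rot_sum j v (I : Type) (r : seq I) (F : I -> S -> R) : (forall k, rsmooth (F k)) ->
  dir_rot j v (fun p => \sum_(k <- r) F k p) = fun p => \sum_(k <- r) dir_rot j v (F k) p.
Proof.
move=> h; apply/funext => p; rewrite /dir_rot exchange_big; apply: eq_bigr => c _.
by rewrite axis_rot_sum // mulr_sumr.
Qed.

Lemma dir_rotZ j v s phi : rsmooth phi -> dir_rot j v (fun p => s * phi p)
  = fun p => s * dir_rot j v phi p.
Proof.
move=> h; apply/funext => p; rewrite /dir_rot mulr_sumr; apply: eq_bigr => c _.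
by rewrite axis_rotZ // mulrCA.
Qed.

Lemma iter_dir_rotZ m j v s phi : rsmooth phi ->
  iter m (dir_rot j v) (fun p => s * phi p) = fun p => s * iter m (dir_rot j v) phi p.
Proof. by move=> h; elim: m => //= m ->; rewrite dir_rotZ //; exact: rsmooth_iter_dir_rot. Qed.

Lemma iter_dir_rot_sum m j v (I : Type) (r : seq I) (F : I -> S -> R) : (forall k, rsmooth (F k)) ->
  iter m (dir_rot j v) (fun p => \sum_(k <- r) F k p) = fun p => \sum_(k <- r) iter m
    (dir_rot j v) (F k) p.
Proof.
by move=> h; elim: m => //= m ->; rewrite dir_rot_sum // => k; exact: rsmooth_iter_dir_rot.
Qed.

Lemma iter_dir_rot_scale m j v s phi : rsmooth phi ->
  iter m (dir_rot j (fun c => s * v c)) phi = fun p => s ^+ m * iter m (dir_rot j v) phi p.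
Proof.
move=> h; elim: m => [|m IH]; first by apply/funext => p; rewrite mul1r.
rewrite !iterS IH; apply/funext => p; rewrite {1}/dir_rot.
rewrite (eq_bigr (fun c => s * (v c * axis_rot j c (fun q => s ^+ m * iter m (dir_rot j v) phi q) p))).
  by rewrite -mulr_sumr -/(dir_rot _ _ _ _) dir_rotZ ?exprS ?mulrA //; exact: rsmooth_iter_dir_rot.
by move=> c _; rewrite mulrA.
Qed.

Lemma eigenpair_dir_rot lr li j v a b : eigenpair lr li a b -> eigenpair lr li (dir_rot j v a)
  (dir_rot j v b).
Proof.
move=> eab; have [as_ bs _ _] := eab; have eL c := eigenpair_axis_rot j c eab.
split; try exact: rsmooth_dir_rot.
- move=> p; rewrite /dir_rot lap_sum => [|c]; last by have [? ? _ _] := eL c; exact: rsmoothZ.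
  rewrite !mulr_sumr -sumrB; apply: eq_bigr => c _; have [s1 s2 e1 e2] := eL c.
  by rewrite lapZ // e1; ring.
- move=> p; rewrite /dir_rot lap_sum => [|c]; last by have [? ? _ _] := eL c; exact: rsmoothZ.
  rewrite !mulr_sumr -big_split /=; apply: eq_bigr => c _; have [s1 s2 e1 e2] := eL c.
  by rewrite lapZ // e2; ring.
Qed.

Lemma sqr_sum_unit v (w : 'I_n.+1 -> R) : \sum_c v c ^+ 2 = 1 ->
  (\sum_c v c * w c) ^+ 2 <= \sum_c w c ^+ 2.
Proof.
move=> v1; set s := \sum_c _; rewrite -subr_ge0.
have -> : \sum_c w c ^+ 2 - s ^+ 2 = \sum_c (w c - v c * s) ^+ 2.
  rewrite [RHS](eq_bigr (fun c => w c ^+ 2 + (s ^+ 2 * v c ^+ 2 - 2 * s * (v c * w c)))); last first.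
    by move=> c _; ring.
  rewrite big_split /= sumrB -!mulr_sumr v1 -/s; ring.
by apply: sumr_ge0 => c _; exact: sqr_ge0.
Qed.

(** Cauchy-Schwarz in the row [j] of the sum. *)
Lemma normsq_dir_rot j v a b p : \sum_c v c ^+ 2 = 1 ->
  normsq (dir_rot j v a) (dir_rot j v b) p <= rotnorm a b p.
Proof.
move=> v1; rewrite /rotnorm (bigD1 j) //=.
rewrite -[leLHS]addr0; apply: lerD; last first.
  by apply: sumr_ge0 => i _; apply: sumr_ge0 => c _; exact: normsq_ge0.
rewrite big_split /= /normsq; apply: lerD; rewrite -expr2.
  by apply: le_trans (sqr_sum_unit _ v1) _; apply: ler_sum => c _; rewrite expr2.
by apply: le_trans (sqr_sum_unit _ v1) _; apply: ler_sum => c _; rewrite expr2.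
Qed.

(** Rotations map eigenpairs to eigenpairs with the same eigenvalue, so the
    gradient estimate can be iterated. *)
Lemma iter_dir_rot_bound lr li j v a b A : (2 <= n)%N -> \sum_c v c ^+ 2 = 1 ->
  eigenpair lr li a b -> 0 <= A -> (forall p, normsq a b p <= A ^+ 2) ->
  forall m p, `|iter m (dir_rot j v) a p| <= A * growth lr ^+ m /\
              `|iter m (dir_rot j v) b p| <= A * growth lr ^+ m.
Proof.
move=> n2 v1 eab A0 bd m.
have gr0 : 0 <= growth lr by rewrite /growth mulr_ge0 // addr_ge0.
have em k : eigenpair lr li (iter k (dir_rot j v) a) (iter k (dir_rot j v) b).
  by elim: k => //= k IH; exact: eigenpair_dir_rot.
have key : forall p, normsq (iter m (dir_rot j v) a) (iter m (dir_rot j v) b) p <=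
  (A * growth lr ^+ m) ^+ 2.
  elim: m => [|m IH] p; first by rewrite expr0 mulr1.
  apply: le_trans (normsq_dir_rot _ _ _ _ v1) _.
  apply: le_trans (bernstein n2 (em m) IH p) _.
  by rewrite (exprS _ m); move: (growth lr ^+ m) => y; rewrite [leRHS](_ : _ = growth lr ^+ 2 *
    (A * y) ^+ 2) //; ring.
have C0 : 0 <= A * growth lr ^+ m by rewrite mulr_ge0 // exprn_ge0.
move=> p; have := key p; rewrite /normsq -!expr2 => kp.
by split; rewrite -[leRHS]ger0_norm // -ler_sqr ?nnegrE // !real_normK ?num_real //;
  apply: le_trans kp; rewrite ?lerDl ?lerDr sqr_ge0.
Qed.

Section GreatCircle.
Variables (j : 'I_n.+1) (v : 'I_n.+1 -> R).
Hypotheses (vj : v j = 0) (v1 : \sum_c v c ^+ 2 = 1).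

Lemma great_circle_on_sphere t :
  sqnorm (\row_c (cos t * (j == c)%:R + sin t * v c) : 'rV[R]_n.+1) == 1.
Proof.
apply/eqP; rewrite /sqnorm.
rewrite (eq_bigr (fun c => (c == j)%:R * (cos t ^+ 2 + 2 * cos t * sin t * v c)
  + sin t ^+ 2 * v c ^+ 2)).
  by rewrite big_split /= -mulr_sumr v1 delta_sumS vj -[RHS](cos2Dsin2 t); ring.
by move=> c _; rewrite mxE eq_sym; case: (c == j); rewrite /=; ring.
Qed.

Definition great_circle t : S :=
  exist (fun x : 'rV[R]_n.+1 => sqnorm x == 1) _ (great_circle_on_sphere t).

Lemma pcoord_great_circle t c :
  pcoord c (great_circle t) = cos t * (j == c)%:R + sin t * v c.
Proof. by rewrite /pcoord /= mxE. Qed.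

Lemma great_circleD2pi t : great_circle (t + pi *+ 2) = great_circle t.
Proof. by apply: val_inj; apply/rowP => c; rewrite !mxE sinD2pi cosD2pi. Qed.

(** The great circle is an orbit of the one-parameter group generated by
    [dir_rot j v]. *)
Lemma great_circle_derive phi (t : R) : rsmooth phi ->
  is_derive t 1 (phi \o great_circle) (dir_rot j v phi (great_circle t)).
Proof.
move=> ps.
have D c : is_derive t 1 (fun r => pcoord c (great_circle r))
    (- sin t * (j == c)%:R + cos t * v c).
  have -> : (fun r => pcoord c (great_circle r)) =
     (j == c)%:R \*: (cos : R -> R) + v c \*: (sin : R -> R).
    by apply/funext => r; rewrite pcoord_great_circle mulrC [sin r * _]mulrC.
  have Z := @is_deriveD _ _ _ _ _ t 1 _ _ (@is_deriveZ _ _ _ cos (j == c)%:R t 1 _ (is_derive_cos t))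
     (@is_deriveZ _ _ _ sin (v c) t 1 _ (is_derive_sin t)).
  by refine (is_derive_eq Z _); rewrite /GRing.scale /=; ring.
refine (is_derive_eq (sphere_curve ps D) _).
set p := great_circle t.
rewrite (eq_bigr (fun c => (c == j)%:R * (- sin t * Sd c phi p) + cos t * (v c * Sd c phi p)));
  last first.
  by move=> c _; rewrite eq_sym; ring.
rewrite big_split /= delta_sumS -mulr_sumr /dir_rot /axis_rot.
rewrite [RHS](eq_bigr (fun c => pcoord j p * (v c * Sd c phi p) - Sd j phi p *
  (v c * pcoord c p))); last first.
  by move=> c _; ring.
rewrite sumrB -!mulr_sumr.
have -> : pcoord j p = cos t by rewrite pcoord_great_circle vj eqxx mulr1 mulr0 addr0.
have -> : \sum_c v c * pcoord c p = sin t.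
  rewrite (eq_bigr (fun c => (c == j)%:R * (cos t * v c) + sin t * v c ^+ 2)); last first.
    by move=> c _; rewrite pcoord_great_circle eq_sym; ring.
  by rewrite big_split /= delta_sumS -mulr_sumr v1 vj; ring.
ring.
Qed.

End GreatCircle.
End DirectionalRotation.

(** * Periodic functions of small exponential type *)

Section Towers.
Variable R : realType.
Implicit Types (f g h : nat -> R -> R) (A C P L s t : R).

Lemma is_derive_shift_comp (f : R -> R) (c t df : R) : is_derive (t + c) 1 f df ->
  is_derive t 1 (fun r => f (r + c)) df.
Proof.
move=> fd; have Z := @is_derive1_comp R f (shift c) t df 1 fd (is_derive_shift t 1 c).
by refine (is_derive_eq Z _); rewrite mulr1.
Qed.

(** The derivatives of [g 0] are carried as a family, so that an operation on [g 0]
    is defined on all of them at once. *)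
Definition tower g := forall m t, is_derive t 1 (g m) (g m.+1 t).

(** Over half a period on each side of [t] the primitive [psi] returns to its
    value, so [phi] cannot stay far from 0. *)
Lemma bohr_favard (psi phi dphi : R -> R) (P L : R) : 0 < P ->
  (forall t : R, is_derive t 1 psi (phi t)) -> (forall t : R, is_derive t 1 phi (dphi t)) ->
  (forall t, psi (t + P) = psi t) -> (forall t, `|dphi t| <= L) ->
  forall t, `|phi t| <= L * P / 4.
Proof.
move=> P0 psid phid per dL.
have half (psi' phi' : R -> R) (dphi' : R -> R) : (forall t : R, is_derive t 1 psi' (phi' t)) ->
    (forall t : R, is_derive t 1 phi' (dphi' t)) ->
    (forall t, psi' (t + P) = psi' t) -> (forall t, `|dphi' t| <= L) ->
    forall t, phi' t <= L * P / 4.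
  move=> {}psid {}phid {}per {}dL t.
  have lip a b : `|phi' b - phi' a| <= L * `|b - a|.
    by have [c _ ->] := mean_value a b phid; rewrite normrM ler_wpM2r.
  (* the Lipschitz bound on [phi] makes [H] nondecreasing on the right of 0, and
     the values of [psi] cancel in [H (P / 2)] by periodicity *)
  pose H s := psi' (s + t) - psi' (- s + t) - 2 * phi' t * s + L * s ^+ 2.
  have Hd s : is_derive s 1 H (phi' (s + t) + phi' (- s + t) - 2 * phi' t + 2 * L * s).
    have D1 := @is_derive_shift_comp _ t s _ (psid (s + t)).
    have D2 : is_derive s 1 (fun r => psi' (- r + t)) (- phi' (- s + t)).
      have := is_derive1_comp (@is_derive_shift_comp _ t (- s) _ (psid (- s + t)))
        (is_deriveN (is_derive_id s 1)).
      by move=> Z; refine (is_derive_eq Z _); rewrite mulrN1.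
    have D3 := is_deriveZ (2 * phi' t) (is_derive_id s 1).
    have D4 := is_deriveZ L (is_deriveX 2 (is_derive_id s 1)).
    have Z := is_deriveD (is_deriveB (is_deriveB D1 D2) D3) D4.
    refine (is_derive_eq Z _); rewrite /GRing.scale /= !mulr1; ring.
  have P2 : 0 < P / 2 by rewrite divr_gt0.
  have [c cP E] := MVT P2 (fun x _ => Hd x)
    (continuous_subspaceT (fun x => differentiable_continuous
       ((derivable1_diffP _ _).1 (@ex_derive _ _ _ _ _ _ _ (Hd x))))).
  move: cP; rewrite in_itv /= => /andP[c0 _].
  have H0 : H 0 = 0 by rewrite /H oppr0 subrr mulr0 expr0n /= mulr0 subrr addr0.
  have HP : H (P / 2) = - phi' t * P + L * P ^+ 2 / 4.
    rewrite /H; have -> : P / 2 + t = (- (P / 2) + t) + P by field.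
    by rewrite per; field.
  have : 0 <= H (P / 2) - H 0.
    rewrite E; apply: mulr_ge0; last by rewrite subr0 ltW.
    have := lip t (c + t); have := lip t (- c + t).
    rewrite !addrK normrN !(ger0_norm (ltW c0)) => /ler_normlP[h1 _] /ler_normlP[h2 _]; lra.
  rewrite HP H0 subr0 => h; have h2 : phi' t * P <= (L * P / 4) * P by lra.
  by rewrite ler_pM2r in h2.
move=> t; rewrite ler_norml; apply/andP; split; last exact: half psid phid per dL t.
rewrite lerNl; apply: (half (fun s => - psi s) (fun s => - phi s) (fun s => - dphi s)).
- by move=> s; rewrite per.
- by move=> s; rewrite normrN.
Qed.

Definition bounded_tower A C g := forall m t, `|g m t| <= A * C ^+ m.
Definition periodic_tower P g := forall m t, g m (t + P) = g m t.

(** Each application of [bohr_favard] trades one derivative for a factor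
    [C * P / 4 < 1] in the bound of the first derivative. *)
Lemma periodic_tower_cst A C P g : 0 < P -> 0 <= A -> 0 <= C -> C * P < 4 ->
  tower g -> periodic_tower P g -> bounded_tower A C g -> forall t, g 0%N t = g 0%N 0.
Proof.
move=> P0 A0 C0 CP tg pg bg.
have claim k : forall m t, `|g m.+1 t| <= A * C ^+ m.+1 * (C * P / 4) ^+ k.
  elim: k => [|k IH] m t; first by rewrite mulr1; exact: bg.
  apply: le_trans (bohr_favard P0 (tg m) (tg m.+1) (pg m) (IH m.+1) t) _.
  rewrite [leRHS](_ : _ = A * C ^+ m.+2 * (C * P / 4) ^+ k * P / 4) //.
  rewrite (exprS C m.+1) (exprS _ k); by field.
have d0 t : g 1%N t = 0.
  apply/eqP; rewrite -normr_le0; apply/ler_addgt0Pl => e e0; rewrite addr0.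
  have r1 : `|C * P / 4| < 1.
    by rewrite ger0_norm ?ltr_pdivrMr ?mul1r // divr_ge0 // mulr_ge0 // ltW.
  have /cvgrPdist_lt /(_ (e / (A * C + 1))) := cvg_expr r1.
  have AC0 : 0 <= A * C by exact: mulr_ge0.
  have AC1 : 0 < A * C + 1 by rewrite ltr_wpDl.
  rewrite divr_gt0 // => /(_ isT)[N _ /(_ N (leqnn N))] /=.
  rewrite sub0r normrN => /ltW h.
  apply: le_trans (claim N 0%N t) _; rewrite expr1.
  apply: (@le_trans _ _ ((A * C + 1) * (e / (A * C + 1)))); last by rewrite mulrC divfK // gt_eqF.
  apply: (@le_trans _ _ (A * C * (e / (A * C + 1)))).
    by apply: ler_wpM2l => //; exact: le_trans (ler_norm _) h.
  by apply: ler_wpM2r; rewrite ?lerDl // divr_ge0 // ltW.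
move=> t; have [c _ e] := mean_value 0 t (tg 0%N).
by apply/eqP; rewrite -subr_eq0 e d0 mul0r.
Qed.

(** The towers of the products [g i * h j], organised so that no binomial
    coefficient is needed. *)
Fixpoint mul_tower g h m i j : R -> R :=
  if m is m'.+1 then fun t => mul_tower g h m' i.+1 j t + mul_tower g h m' i j.+1 t
  else fun t => g i t * h j t.

Lemma mul_towerP g h : tower g -> tower h ->
  forall m i j t, is_derive t 1 (mul_tower g h m i j) (mul_tower g h m.+1 i j t).
Proof.
move=> tg th; elim=> [|m IH] i j t.
  have Z := is_deriveM (tg i t) (th j t).
  by refine (is_derive_eq Z _); rewrite /GRing.scale /=; ring.
have Z := is_deriveD (IH i.+1 j t) (IH i j.+1 t).
exact: (is_derive_eq Z).
Qed.

Lemma mul_tower_bound A C A' C' g h : 0 <= A -> 0 <= C -> 0 <= A' -> 0 <= C' ->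
  bounded_tower A C g -> bounded_tower A' C' h -> forall m i j t,
  `|mul_tower g h m i j t| <= A * A' * C ^+ i * C' ^+ j * (C + C') ^+ m.
Proof.
move=> A0 C0 A0' C0' bg bh; elim=> [|m IH] i j t /=.
  rewrite normrM [leRHS](_ : _ = A * C ^+ i * (A' * C' ^+ j)); last by rewrite expr0; ring.
  by apply: ler_pM; [exact: normr_ge0|exact: normr_ge0|exact: bg|exact: bh].
apply: le_trans (ler_normD _ _) _; apply: le_trans (lerD (IH _ _ _) (IH _ _ _)) _.
by rewrite [leLHS](_ : _ = A * A' * C ^+ i * C' ^+ j * (C + C') ^+ m.+1) // !exprS; ring.
Qed.

Lemma mul_tower_periodic P g h : periodic_tower P g -> periodic_tower P h ->
  forall m i j t, mul_tower g h m i j (t + P) = mul_tower g h m i j t.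
Proof. by move=> pg ph; elim=> [|m IH] i j t /=; rewrite ?pg ?ph ?IH. Qed.

(** Averaging over the [M.+1]-st parts of a period divides the period by [M.+1]
    and keeps the exponential type, so that [periodic_tower_cst] applies. *)
Lemma average_cst A C P g M : 0 < P -> 0 <= A -> 0 <= C -> C * (P / M.+1%:R) < 4 ->
  tower g -> periodic_tower P g -> bounded_tower A C g -> forall t,
  \sum_(j < M.+1) g 0%N (t + P / M.+1%:R * j%:R) =
  \sum_(j < M.+1) g 0%N (0 + P / M.+1%:R * j%:R).
Proof.
move=> P0 A0 C0 CP tg pg bg.
set Q := P / M.+1%:R.
pose V m t := \sum_(j < M.+1) g m (t + Q * j%:R).
have Q0 : 0 < Q by rewrite divr_gt0.
apply: (@periodic_tower_cst (A *+ M.+1) C Q V) => //.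
- by rewrite mulrn_wge0.
- move=> m t.
  have -> : V m = \sum_(j < M.+1) (fun r => g m (r + Q * j%:R)).
    by apply/funext => r; rewrite fct_sumE.
  apply: is_derive_sum => j; apply: is_derive_shift_comp; exact: tg.
- move=> m t; rewrite /V big_ord_recr big_ord_recl /= addrC; congr (_ + _).
    have -> : t + Q + Q * M%:R = t + P; last by rewrite pg mulr0 addr0.
    by rewrite -addrA -{1}[Q]mulr1 -mulrDr nat1r divfK // pnatr_eq0.
  by apply: eq_bigr => j _; rewrite /bump /= -nat1r mulrDr mulr1 !addrA.
- move=> m t; rewrite /V; apply: le_trans (ler_norm_sum _ _ _) _.
  rewrite mulrnAl -[leRHS]/(_ *+ _) -[X in _ *+ X]card_ord -sumr_const.
  by apply: ler_sum => j _; exact: bg.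
Qed.

End Towers.

(** * Exact sampling by the Dirichlet kernel *)

Section Dirichlet.
Variable R : realType.
Implicit Types (A C t s u : R) (K k j m : nat).

Definition dweight k : R := if k is 0%N then 1 else 2.

Definition dirichlet K u : R := \sum_(k < K.+1) dweight k * cos (k%:R * u).

Lemma dirichlet_sin K u : sin (u / 2) * dirichlet K u = sin (K%:R * u + u / 2).
Proof.
elim: K => [|K IH].
  by rewrite /dirichlet big_ord_recl big_ord0 /= !mul0r cos0 add0r addr0 !mulr1.
rewrite /dirichlet big_ord_recr /= mulrDr -/(dirichlet K u) IH.
have -> : K%:R * u + u / 2 = K.+1%:R * u - u / 2 by rewrite -natr1; field.
by rewrite sinB sinD; ring.
Qed.

Lemma dirichlet0 K : dirichlet K 0 = (K.*2.+1)%:R.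
Proof.
elim: K => [|K IH]; first by rewrite /dirichlet big_ord_recl big_ord0 /= mul0r cos0 addr0 mulr1.
rewrite /dirichlet big_ord_recr /= -/(dirichlet K 0) IH mulr0 cos0 mulr1.
by rewrite doubleS -addn2 natrD addrC -natr1 -[in RHS]natr1; ring.
Qed.

Lemma dirichletN K u : dirichlet K (- u) = dirichlet K u.
Proof. by apply: eq_bigr => k _; rewrite mulrN cosN. Qed.

Lemma sin_pi_mul j : sin (j%:R * pi) = 0 :> R.
Proof.
elim: j => [|j IH]; first by rewrite mul0r sin0.
by rewrite -natr1 mulrDl mul1r sinD IH sinpi mul0r mulr0 addr0.
Qed.

Lemma dirichlet_node K j : (0 < j < K.*2.+1)%N ->
  dirichlet K (pi *+ 2 / (K.*2.+1)%:R * j%:R) = 0.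
Proof.
move=> /andP[j0 jM]; set M := (K.*2.+1)%:R; set u := _ * _.
have M0 : 0 < M :> R by rewrite ltr0n.
have u2 : u / 2 = pi * (j%:R / M).
  by rewrite /u -mulr_natr; field; rewrite gt_eqF.
have su : sin (u / 2) != 0.
  rewrite gt_eqF // sin_gt0_pi // u2 mulr_gt0 ?pi_gt0 ?divr_gt0 ?ltr0n //=.
  by rewrite -[ltRHS]mulr1 ltr_pM2l ?pi_gt0 // ltr_pdivrMr // mul1r ltr_nat.
apply: (mulfI su); rewrite mulr0 dirichlet_sin -(sin_pi_mul j); congr (sin _).
have -> : K%:R * u + u / 2 = M * (u / 2).
  have -> : M = 2 * K%:R + 1 by rewrite /M -addn1 natrD -muln2 natrM mulrC.
  by field.
by rewrite u2; field; rewrite gt_eqF.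
Qed.

(** The tower of [fun s => dirichlet K (t - s)]; each derivative of a cosine is
    a shift by a quarter of a period. *)
Definition dirichlet_tower K t m s : R :=
  \sum_(k < K.+1) dweight k * (k%:R ^+ m * cos (k%:R * (t - s) - m%:R * (pi / 2))).

Lemma dirichlet_tower0 K t s : dirichlet_tower K t 0 s = dirichlet K (t - s).
Proof. by apply: eq_bigr => k _; rewrite mul0r subr0 mul1r. Qed.

Lemma dirichlet_towerP K t : tower (dirichlet_tower K t).
Proof.
move=> m s.
have -> : dirichlet_tower K t m = \sum_(k < K.+1) (fun s => dweight k * (k%:R ^+ m * cos (k%:R *
  (t - s) - m%:R * (pi / 2)))).
  by apply/funext => r; rewrite fct_sumE.
apply: is_derive_sum => k.
have D : is_derive s 1 (fun s => k%:R * (t - s) - m%:R * (pi / 2)) (- k%:R : R).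
  have Z := is_deriveB (is_deriveZ k%:R (is_deriveB (is_derive_cst t s 1) (is_derive_id s 1)))
    (is_derive_cst (m%:R * (pi / 2) : R) s 1).
  by refine (is_derive_eq Z _); rewrite /GRing.scale /=; ring.
have Z := is_deriveZ (dweight k) (is_deriveZ (k%:R ^+ m)
   (@is_derive1_comp R cos (fun s => k%:R * (t - s) - m%:R * (pi / 2)) s _ _ (is_derive_cos _) D)).
refine (is_derive_eq Z _); rewrite /GRing.scale /=.
have -> : k%:R * (t - s) - m.+1%:R * (pi / 2) = (k%:R * (t - s) - m%:R * (pi / 2)) - pi / 2 :> R.
  by rewrite -natr1; ring.
by rewrite cosBpihalf exprS; ring.
Qed.

Lemma dweight_ge0 k : 0 <= dweight k. Proof. by case: k. Qed.

Lemma dirichlet_tower_bound K t :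
  bounded_tower (\sum_(k < K.+1) dweight k) K%:R (dirichlet_tower K t).
Proof.
move=> m s; apply: le_trans (ler_norm_sum _ _ _) _; rewrite mulr_suml.
apply: ler_sum => k _; rewrite normrM ger0_norm ?dweight_ge0 //.
apply: ler_wpM2l; first exact: dweight_ge0.
rewrite normrM normrX normr_nat -[leRHS]mulr1; apply: ler_pM => //; last exact: cos_max.
by apply: lerXn2r; rewrite ?nnegrE // ler_nat -ltnS.
Qed.

Lemma cosD_nat k u : cos (u + pi *+ 2 *+ k) = cos u.
Proof. exact: (periodicn (@cosD2pi R)). Qed.

Lemma dirichlet_tower_periodic K t : periodic_tower (pi *+ 2) (dirichlet_tower K t).
Proof.
move=> m s; apply: eq_bigr => k _; congr (_ * (_ * _)).
rewrite -(cosD_nat k (k%:R * (t - (s + pi *+ 2)) - _)); congr (cos _).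
by rewrite -[pi *+ 2 *+ k]mulr_natr; ring.
Qed.

(** Apply [average_cst] to the product of [g] with the kernel centred at [t]: at
    the nodes shifted to [t] the kernel vanishes except at [t] itself, and at the
    fixed nodes it gives the right-hand side. *)
Lemma sampling A C K g : 0 <= A -> 0 <= C -> (C + K%:R) * (pi *+ 2 / (K.*2.+1)%:R) < 4 ->
  tower g -> periodic_tower (pi *+ 2) g -> bounded_tower A C g -> forall t,
  g 0%N t = (K.*2.+1)%:R^-1 *
    \sum_(j < K.*2.+1) g 0%N (pi *+ 2 / (K.*2.+1)%:R * j%:R) *
      dirichlet K (t - pi *+ 2 / (K.*2.+1)%:R * j%:R).
Proof.
move=> A0 C0 CK tg pg bg t.
set M := (K.*2.+1)%:R in CK *; set th := fun j : nat => pi *+ 2 / M * j%:R : R.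
have M0 : M != 0 by rewrite pnatr_eq0.
pose W m := mul_tower g (dirichlet_tower K t) m 0 0.
have D0 : 0 <= \sum_(k < K.+1) dweight k by apply: sumr_ge0 => k _; exact: dweight_ge0.
have pi2 : 0 < pi *+ 2 :> R by rewrite mulrn_wgt0 // pi_gt0.
have WE s : W 0%N s = g 0%N s * dirichlet K (t - s) by rewrite /W /= dirichlet_tower0.
have := @average_cst R (A * \sum_(k < K.+1) dweight k) (C + K%:R) (pi *+ 2) W K.*2 pi2
  (mulr_ge0 A0 D0) (addr_ge0 C0 (ler0n _ _)) CK
  (fun m s => mul_towerP tg (dirichlet_towerP K t) m 0 0 s)
  (fun m s => mul_tower_periodic pg (dirichlet_tower_periodic K t) m 0 0 s).
have WB : bounded_tower (A * \sum_(k < K.+1) dweight k) (C + K%:R) W.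
  move=> m s; have := mul_tower_bound A0 C0 D0 (ler0n _ K) bg (dirichlet_tower_bound K t) m 0 0 s.
  by rewrite !mulr1.
move=> /(_ WB t); rewrite (eq_bigr (fun j : 'I__ => W 0%N (t + th j))) // => E.
rewrite (eq_bigr (fun j : 'I__ => W 0%N (0 + th j))); last by move=> j _; rewrite WE add0r.
rewrite -E big_ord_recl big1 ?addr0; last first.
  move=> j _; rewrite WE opprD addrA subrr add0r dirichletN dirichlet_node ?mulr0 //.
  by rewrite /= /bump /= add1n ltnS ltn_ord.
by rewrite WE /th mulr0 addr0 subrr dirichlet0 mulrC mulfK.
Qed.

End Dirichlet.

(** * Trigonometric polynomials from their derivatives at a point *)

Section TrigonometricTowers.
Variable R : realType.
Implicit Types (A C t s u : R) (K k j m : nat) (al be : nat -> R).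

(** Chebyshev polynomials of both kinds, from the addition formulas. *)
Fixpoint cheb k : {poly R} * {poly R} :=
  if k is k'.+1 then
    let: (T, U) := cheb k' in ('X * T - (1 - 'X^2) * U, T + 'X * U)
  else (1, 0).

Lemma chebP k t : cos (k%:R * t) = (cheb k).1.[cos t] /\ sin (k%:R * t) = sin t * (cheb k).2.[cos t].
Proof.
elim: k => [|k [IH1 IH2]]; first by rewrite /= !mul0r cos0 sin0 !hornerE.
rewrite /=; case: (cheb k) IH1 IH2 => T U /= E1 E2.
rewrite -natr1 mulrDl mul1r cosD sinD E1 E2 !hornerE.
by split; last ring; rewrite -sin2cos2; ring.
Qed.

Definition trig_poly K al be t : R :=
  \sum_(k < K.+1) (al k * cos (k%:R * t) + be k * sin (k%:R * t)).

Lemma trig_poly_derive K al be t : is_derive t 1 (trig_poly K al be)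
  (trig_poly K (fun k => k%:R * be k) (fun k => - (k%:R * al k)) t).
Proof.
have -> : trig_poly K al be = \sum_(k < K.+1) (fun t => al k * cos (k%:R * t) + be k * sin (k%:R * t)).
  by apply/funext => r; rewrite fct_sumE.
apply: is_derive_sum => k.
have D : is_derive t 1 (fun t => k%:R * t) (k%:R : R).
  have Z := is_deriveZ (k%:R : R) (is_derive_id t 1).
  by refine (is_derive_eq Z _); rewrite /GRing.scale /= mulr1.
have Z1 := @is_derive1_comp R cos (fun t => k%:R * t) t _ _ (is_derive_cos _) D.
have Z2 := @is_derive1_comp R sin (fun t => k%:R * t) t _ _ (is_derive_sin _) D.
have Z := is_deriveD (is_deriveZ (al k) Z1) (is_deriveZ (be k) Z2).
by refine (is_derive_eq Z _); rewrite /GRing.scale /=; ring.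
Qed.

(** Every second derivative multiplies the coefficients of frequency [k] by
    [- k ^+ 2]. *)
Lemma trig_tower K al be (g : nat -> R -> R) : tower g -> g 0%N = trig_poly K al be ->
  forall m, g m.*2 = trig_poly K (fun k => (- k%:R ^+ 2) ^+ m * al k) (fun k =>
    (- k%:R ^+ 2) ^+ m * be k) /\
    g m.*2.+1 = trig_poly K (fun k => (- k%:R ^+ 2) ^+ m * (k%:R * be k))
                            (fun k => - ((- k%:R ^+ 2) ^+ m * (k%:R * al k))).
Proof.
move=> tg g0.
have step m a b : g m = trig_poly K a b -> g m.+1 = trig_poly K (fun k => k%:R * b k) (fun k => -
  (k%:R * a k)).
  move=> E; apply/funext => t; have := tg m t; rewrite E => -[_ <-].
  by have [_ ->] := trig_poly_derive K a b t.
elim=> [|m [IH1 IH2]].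
  have E : g 0.*2 = trig_poly K (fun k => (- k%:R ^+ 2) ^+ 0 * al k) (fun k =>
    (- k%:R ^+ 2) ^+ 0 * be k).
    rewrite /= g0; apply/funext => t; apply: eq_bigr => k _; by rewrite !mul1r.
  split=> //; rewrite (step _ _ _ E); apply/funext => t; apply: eq_bigr => k _; ring.
have E : g m.+1.*2 = trig_poly K (fun k => (- k%:R ^+ 2) ^+ m.+1 * al k) (fun k =>
  (- k%:R ^+ 2) ^+ m.+1 * be k).
  rewrite doubleS (step _ _ _ IH2); apply/funext => t; apply: eq_bigr => k _.
  by rewrite !exprS; ring.
split=> //; rewrite (step _ _ _ E); apply/funext => t; apply: eq_bigr => k _; ring.
Qed.

Lemma trig_poly0 K al be : trig_poly K al be 0 = \sum_(k < K.+1) al k.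
Proof. by apply: eq_bigr => k _; rewrite mulr0 cos0 sin0 mulr0 addr0 mulr1. Qed.

(** The Lagrange basis for the nodes [- l ^+ 2]. *)
Definition node_poly K (k : 'I_K.+1) : {poly R} :=
  \prod_(l < K.+1 | l != k) ((- k%:R ^+ 2 + l%:R ^+ 2)^-1 *: ('X + (l%:R ^+ 2)%:P)).

Lemma size_node_poly K (k : 'I_K.+1) : (size (node_poly k) <= K.+1)%N.
Proof.
apply: leq_trans (size_prod_leq _ _) _.
have cP : #|[pred l | l != k]| = K by rewrite cardC1 card_ord.
have le2 : (\sum_(l < K.+1 | l != k)
    size ((- k%:R ^+ 2 + l%:R ^+ 2)^-1 *: ('X + (l%:R ^+ 2)%:P) : {poly R}) <= K * 2)%N.
  rewrite -[X in (_ <= X * 2)%N]cP -sum_nat_const; apply: leq_sum => l _.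
  by apply: leq_trans (size_scale_leq _ _) _; rewrite size_XaddC.
by rewrite cP leq_subLR addnS ltnS addnn -muln2.
Qed.

Lemma node_polyE K (k l : 'I_K.+1) : (node_poly k).[- l%:R ^+ 2] = (l == k)%:R.
Proof.
rewrite /node_poly horner_prod.
have [->|lk] := eqVneq l k.
  rewrite big1 // => i ik; rewrite !hornerE mulVf // addrC subr_eq0.
  rewrite eqrXn2 ?ler0n // eqr_nat; exact: ik.
rewrite (bigD1 l) //= !hornerE addNr mulr0 mul0r //.
Qed.

(** The moments of [al] at the nodes determine [al]: the coefficients of the
    Lagrange basis are the inverse of the Vandermonde matrix. *)
Lemma node_poly_sum K (k : 'I_K.+1) al :
  \sum_(m < K.+1) (node_poly k)`_m * (\sum_(l < K.+1) (- l%:R ^+ 2) ^+ m * al l) = al k.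
Proof.
under eq_bigr do rewrite mulr_sumr.
rewrite exchange_big /=.
transitivity (\sum_(l < K.+1) (l == k)%:R * al l).
  apply: eq_bigr => l _; under eq_bigr do rewrite mulrA.
  by rewrite -mulr_suml -(horner_coef_wide _ (size_node_poly k)) node_polyE.
rewrite (bigD1 k) //= eqxx mul1r big1 ?addr0 // => l lk.
by rewrite (negbTE lk) mul0r.
Qed.

(** The left-hand side tends to [pi] when [K] grows, and [pi < 4]. *)
Lemma exists_sampling_degree C : 0 <= C -> exists K, (C + K%:R) * (pi *+ 2 / (K.*2.+1)%:R) < 4.
Proof.
move=> C0; have pi4 : pi < 4 :> R by have := pihalf_lt2 R; lra.
have pi0 := pi_gt0 R.
have B0 : 0 <= pi * C / (4 - pi) by rewrite divr_ge0 ?mulr_ge0 // ?ltW //; lra.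
have := archi_boundP B0; set K := Num.bound _ => KP; exists K.
have M0 : 0 < (K.*2.+1)%:R :> R by rewrite ltr0n.
have ME : (K.*2.+1)%:R = 2 * K%:R + 1 :> R by rewrite -addn1 natrD -muln2 natrM mulrC.
rewrite mulrA ltr_pdivrMr // ME -mulr_natr.
rewrite ltr_pdivrMr in KP; last by lra.
lra.
Qed.

(** [sampling] makes [g] a trigonometric polynomial of a degree depending only on
    [C]; its derivatives at 0 are the moments of its coefficients with respect to
    the nodes [- k ^+ 2], from which [node_poly_sum] recovers the coefficients. *)
Theorem tower_from_jet C : 0 <= C -> exists K (p q : 'I_K.+1 -> {poly R}),
  forall A g, 0 <= A -> tower g -> periodic_tower (pi *+ 2) g -> bounded_tower A C g ->
  forall t, g 0%N t = \sum_(m < K.+1) g m.*2 0 * (p m).[cos t] +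
     sin t * \sum_(m < K.+1) g m.*2.+1 0 * (q m).[cos t].
Proof.
move=> C0; have [K CK] := exists_sampling_degree C0; exists K.
exists (fun m => \sum_(k < K.+1) (node_poly k)`_m *: (cheb k).1).
exists (fun m => \sum_(k < K.+1) ((node_poly k)`_m / k%:R) *: (cheb k).2).
move=> A g A0 tg pg bg t.
pose th (j : nat) : R := pi *+ 2 / (K.*2.+1)%:R * j%:R.
pose w (j : nat) : R := (K.*2.+1)%:R^-1 * g 0%N (th j).
pose al k : R := \sum_(j < K.*2.+1) w j * (dweight R k * cos (k%:R * th j)).
pose be k : R := \sum_(j < K.*2.+1) w j * (dweight R k * sin (k%:R * th j)).
have g0 : g 0%N = trig_poly K al be.
  apply/funext => s; rewrite (sampling A0 C0 CK tg pg bg s) mulr_sumr.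
  rewrite (eq_bigr (fun j : 'I__ => \sum_(k < K.+1) (w j * (dweight R k * cos (k%:R * th j)) * cos
    (k%:R * s) +
     w j * (dweight R k * sin (k%:R * th j)) * sin (k%:R * s)))).
    rewrite exchange_big /=; apply: eq_bigr => k _.
    by rewrite big_split /= -!mulr_suml.
  move=> j _; rewrite mulrA -/(th j) -/(w j) /dirichlet mulr_sumr; apply: eq_bigr => k _.
  by rewrite mulrBr cosB; ring.
have tt := trig_tower tg g0.
rewrite g0 /trig_poly big_split /=; congr (_ + _).
  transitivity (\sum_(k < K.+1) \sum_(m < K.+1) g m.*2 0 * ((node_poly k)`_m * (cheb k).1.[cos t])).
    apply: eq_bigr => k _; rewrite -[in LHS](node_poly_sum k al) mulr_suml; apply: eq_bigr => m _.
    rewrite (tt m).1 trig_poly0 (chebP k t).1; ring.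
  rewrite exchange_big /=; apply: eq_bigr => m _; rewrite horner_sum mulr_sumr.
  by apply: eq_bigr => k _; rewrite hornerZ.
transitivity (\sum_(k < K.+1) \sum_(m < K.+1) g m.*2.+1 0 * ((node_poly k)`_m / k%:R * sin (k%:R * t))).
  apply: eq_bigr => k _.
  (* the division by [k] in the witness is harmless: frequency 0 has no sine term *)
  have [->|k0] := eqVneq (k : nat) 0%N; first by rewrite mul0r sin0 mulr0 big1 // => m _; rewrite !mulr0.
  have kn : k%:R != 0 :> R by rewrite pnatr_eq0.
  apply: (mulfI kn); rewrite mulrA -(node_poly_sum k (fun k => k%:R * be k)) mulr_suml mulr_sumr.
  apply: eq_bigr => m _; rewrite (tt m).2 trig_poly0; field.
  exact: kn.
rewrite exchange_big /= mulr_sumr; apply: eq_bigr => m _; rewrite horner_sum !mulr_sumr.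
by apply: eq_bigr => k _; rewrite hornerZ (chebP k t).2; ring.
Qed.

End TrigonometricTowers.

(** * Eigenfunctions are polynomial *)

Section PolynomialFunctions.
Variables (R : realType) (n : nat).
Notation S := (sphere_point R n).
Implicit Types (phi psi : S -> R) (p : S) (c j : 'I_n.+1) (v : 'I_n.+1 -> R).
Local Open Scope complex_scope.

Definition polyS phi : Prop := exists P : mpoly.mpoly n.+1 R[i],
  forall p, (phi p)%:C = poly_fun P (sval p).

Lemma polyS_cst a : polyS (fun=> a).
Proof. by exists (mpoly.mpolyC _ a%:C) => p; rewrite /poly_fun mpoly.mevalC. Qed.

Lemma polyS_pcoord c : polyS (fun p => pcoord c p).
Proof. by exists (mpoly.mpolyX _ (mpoly.mnm1 c)) => p; rewrite /poly_fun mpoly.mevalXU. Qed.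

Lemma polySD phi psi : polyS phi -> polyS psi -> polyS (fun p => phi p + psi p).
Proof.
move=> [P hP] [Q hQ]; exists (P + Q) => p; rewrite /poly_fun mpoly.mevalD.
by apply: etrans (rmorphD (real_complex R) _ _) _; congr (_ + _); [exact: hP|exact: hQ].
Qed.

Lemma polySM phi psi : polyS phi -> polyS psi -> polyS (fun p => phi p * psi p).
Proof.
move=> [P hP] [Q hQ]; exists (P * Q) => p; rewrite /poly_fun mpoly.mevalM.
by apply: etrans (rmorphM (real_complex R) _ _) _; congr (_ * _); [exact: hP|exact: hQ].
Qed.

Lemma polyS_ext phi psi : polyS phi -> (forall p, phi p = psi p) -> polyS psi.
Proof. by move=> [P hP] E; exists P => p; rewrite -E hP. Qed.

Lemma polySX phi m : polyS phi -> polyS (fun p => phi p ^+ m).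
Proof.
move=> h; elim: m => [|m IH]; first exact: polyS_cst.
by apply: polyS_ext (polySM h IH) _ => p; rewrite exprS.
Qed.

Lemma polyS_sum (I : Type) (r : seq I) (F : I -> S -> R) :
  (forall i, polyS (F i)) -> polyS (fun p => \sum_(i <- r) F i p).
Proof.
move=> h; elim: r => [|i r IH].
  by apply: polyS_ext (polyS_cst 0) _ => p; rewrite big_nil.
by apply: polyS_ext (polySD (h i) IH) _ => p; rewrite big_cons.
Qed.

Lemma polyS_horner (q : {poly R}) phi : polyS phi -> polyS (fun p => q.[phi p]).
Proof.
move=> h; apply: polyS_ext (_ : polyS (fun p => \sum_(i < size q) q`_i * phi p ^+ i)) _.
  by apply: polyS_sum => i; apply: polySM; [exact: polyS_cst|exact: polySX].
by move=> p; rewrite horner_coef.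
Qed.

(** [dir_rot] is linear in the direction, with coefficients which do not depend on
    the direction. *)
Lemma polyS_iter_dir_rot (w : 'I_n.+1 -> S -> R) j m phi q : (forall c, polyS (w c)) ->
  rsmooth phi -> polyS (fun p => iter m (dir_rot j (w ^~ p)) phi q).
Proof.
move=> hw; elim: m phi => [|m IH] phi ps /=; first exact: polyS_cst.
apply: polyS_ext (_ : polyS (fun p => \sum_c w c p * iter m (dir_rot j (w ^~ p))
  (axis_rot j c phi) q)) _.
  apply: polyS_sum => c; apply: polySM => //; apply: IH; exact: rsmooth_axis_rot.
move=> p; rewrite -iterS iterSr {2}/dir_rot iter_dir_rot_sum; last first.
  by move=> c; apply: rsmoothZ; exact: rsmooth_axis_rot.
by apply: eq_bigr => c _; rewrite iter_dir_rotZ //; exact: rsmooth_axis_rot.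
Qed.

Lemma pole_on_sphere j : sqnorm (delta_mx 0 j : 'rV[R]_n.+1) == 1.
Proof.
apply/eqP; rewrite /sqnorm (eq_bigr (fun c => (c == j)%:R * 1)) ?delta_sumS //.
by move=> c _; rewrite mxE eqxx /=; case: (c == j); rewrite /= ?expr1n ?expr0n ?mulr1 ?mulr0.
Qed.

Definition pole j : S := exist (fun x : 'rV[R]_n.+1 => sqnorm x == 1) _ (pole_on_sphere j).

Lemma great_circle0 j v (vj : v j = 0) (v1 : \sum_c v c ^+ 2 = 1) :
  great_circle vj v1 0 = pole j.
Proof.
apply: val_inj; apply/rowP => c; rewrite !mxE sin0 cos0 mul1r mul0r addr0 eqxx /=.
by rewrite eq_sym.
Qed.

(** The part of [p] orthogonal to the axis [j]. *)
Definition tail j c p : R := pcoord c p - (j == c)%:R * pcoord j p.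

Lemma polyS_tail j c : polyS (tail j c).
Proof.
apply: polyS_ext (_ : polyS (fun p => pcoord c p + (- (j == c)%:R) * pcoord j p)) _.
  apply: polySD; first exact: polyS_pcoord.
  by apply: polySM; [exact: polyS_cst|exact: polyS_pcoord].
by move=> p; rewrite mulNr.
Qed.

Lemma sum_tail j p : \sum_c tail j c p ^+ 2 = 1 - pcoord j p ^+ 2.
Proof.
rewrite (eq_bigr (fun c => pcoord c p ^+ 2 + (c == j)%:R *
  (pcoord j p ^+ 2 - 2 * pcoord j p * pcoord c p))).
  by rewrite big_split /= sum_pcoord delta_sumS; ring.
by move=> c _; rewrite /tail eq_sym; case: (c == j); rewrite /=; ring.
Qed.

(** On the great circles through the pole [j], the function is a trigonometric
    polynomial whose coefficients are polynomials in the unit direction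
    [tail j p / s] with [s = sqrt (1 - x_j ^+ 2)].  The odd derivatives come with a
    factor [sin t = s], so only even powers of [s] remain in the denominator, and
    the factor [(1 - x_j ^+ 2) ^+ N] clears them. *)
Lemma polyS_away_from_poles j phi A C : rsmooth phi -> 0 <= A -> 0 <= C ->
  (forall v, \sum_c v c ^+ 2 = 1 -> forall m p, `|iter m (dir_rot j v) phi p| <= A * C ^+ m) ->
  exists N, polyS (fun p => (1 - pcoord j p ^+ 2) ^+ N * phi p).
Proof.
move=> ps A0 C0 bd; have [K [P [Q HPQ]]] := tower_from_jet C0; exists K.+1.
pose W m p := iter m (dir_rot j (fun c => tail j c p)) phi (pole j).
have Wp m : polyS (W m) by apply: polyS_iter_dir_rot => // c; exact: polyS_tail.
have yp : polyS (fun p => 1 - pcoord j p ^+ 2).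
  apply: polyS_ext (_ : polyS (fun p => 1 + -1 * pcoord j p ^+ 2)) _.
    apply: polySD; first exact: polyS_cst.
    by apply: polySM; [exact: polyS_cst|apply: polySX; exact: polyS_pcoord].
  by move=> p; rewrite mulN1r.
apply: polyS_ext (_ : polyS (fun p => \sum_(m < K.+1) (1 - pcoord j p ^+ 2) ^+ (K.+1 - m) *
   (W m.*2 p * (P m).[pcoord j p] + W m.*2.+1 p * (Q m).[pcoord j p]))) _.
  apply: polyS_sum => m; apply: polySM; first exact: polySX.
  by apply: polySD; apply: polySM => //; apply: polyS_horner; exact: polyS_pcoord.
move=> p; set y := 1 - _.
have [y0|y0] := eqVneq y 0.
  by rewrite y0 expr0n mul0r big1 // => m _; rewrite expr0n subn_eq0 leqNgt ltn_ord mul0r.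
have yge : 0 <= y by rewrite /y -sum_tail; apply: sumr_ge0 => c _; exact: sqr_ge0.
have x1 : pcoord j p ^+ 2 <= 1 by rewrite -subr_ge0.
have xb : -1 <= pcoord j p <= 1.
  by rewrite -ler_norml -(@expr_le1 _ 2) // real_normK ?num_real.
pose s := Num.sqrt y; have s2 : s ^+ 2 = y by rewrite sqr_sqrtr.
have s0 : s != 0 by apply: contra_neq y0 => s0; rewrite -s2 s0 expr0n.
pose v c := tail j c p / s.
have vj : v j = 0 by rewrite /v /tail eqxx mul1r subrr mul0r.
have v1 : \sum_c v c ^+ 2 = 1.
  rewrite (eq_bigr (fun c => tail j c p ^+ 2 * y^-1)).
    by rewrite -mulr_suml sum_tail -/y divff.
  by move=> c _; rewrite /v expr_div_n s2.
pose g m := iter m (dir_rot j v) phi \o great_circle vj v1.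
have E : phi p = g 0%N (acos (pcoord j p)).
  congr (phi _); apply: val_inj; apply/rowP => c; rewrite mxE.
  rewrite acosK // sin_acos // -/y -/s /v mulrC [s * _]mulrC divfK // /tail addrC subrK.
  by [].
have tg : tower g.
  by move=> m t; apply: great_circle_derive; exact: rsmooth_iter_dir_rot.
have pg : periodic_tower (pi *+ 2) g by move=> m t; rewrite /g /= great_circleD2pi.
have bg : bounded_tower A C g by move=> m t; exact: bd.
have WE m : W m p = s ^+ m * g m 0.
  rewrite /W /g /= great_circle0; have := iter_dir_rot_scale m j v s ps.
  move=> /(congr1 (fun F => F (pole j))) <-; congr (iter m (dir_rot j _) phi _).
  by apply/funext => c; rewrite /v mulrC divfK.
rewrite E (HPQ _ _ A0 tg pg bg) acosK // sin_acos // -/y -/s mulrDr !mulr_sumr -big_split /=.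
apply: eq_bigr => m _; rewrite !WE -s2.
have -> : s ^+ m.*2 = (s ^+ 2) ^+ m by rewrite -exprM mul2n.
have -> : s ^+ m.*2.+1 = s * (s ^+ 2) ^+ m by rewrite exprS -exprM mul2n.
have mK : (m <= K.+1)%N by rewrite ltnW.
have -> : (s ^+ 2) ^+ K.+1 = (s ^+ 2) ^+ (K.+1 - m) * (s ^+ 2) ^+ m by rewrite -exprD subnK.
move: (g _ _) (g _ _) (_ ^+ m) (_ ^+ (_ - _)) (_.[_]) (_.[_]) => ? ? ? ? ? ?; ring.
Qed.

(** The functions which become polynomial after multiplication by [phi] form an
    ideal, and a sum of elements with a power in an ideal has a power in it. *)
Lemma polyS_power_sum phi (y : 'I_n.+1 -> S -> R) (r : seq 'I_n.+1) :
  (forall j, polyS (y j)) ->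
  (forall j, exists N, polyS (fun p => y j p ^+ N * phi p)) ->
  exists N, polyS (fun p => (\sum_(j <- r) y j p) ^+ N * phi p).
Proof.
move=> yp hy; elim: r => [|j r [M hM]].
  by exists 1%N; apply: polyS_ext (polyS_cst 0) _ => p; rewrite big_nil expr1 mul0r.
have [N hN] := hy j; exists (N + M)%N.
pose z p := \sum_(k <- r) y k p.
have zp : polyS z by exact: polyS_sum.
apply: polyS_ext (_ : polyS (fun p => \sum_(i < (N + M).+1)
   ('C(N + M, i)%:R : R) * (y j p ^+ (N + M - i) * z p ^+ i * phi p))) _; last first.
  move=> p; rewrite big_cons exprDn mulr_suml; apply: eq_bigr => i _.
  by rewrite -[in RHS]mulr_natl -!mulrA.
apply: polyS_sum => i; apply: polySM; first exact: polyS_cst.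
have [iM|Mi] := leqP i M.
  apply: polyS_ext (_ : polyS (fun p => y j p ^+ (M - i) * z p ^+ i * (y j p ^+ N * phi p))) _.
    by apply: polySM => //; apply: polySM; exact: polySX.
  move=> p; have -> : y j p ^+ (N + M - i) = y j p ^+ N * y j p ^+ (M - i).
    by rewrite -exprD addnBA.
  ring.
apply: polyS_ext (_ : polyS (fun p => y j p ^+ (N + M - i) * z p ^+ (i - M) * (z p ^+ M * phi p))) _.
  by apply: polySM => //; apply: polySM; exact: polySX.
move=> p; have -> : z p ^+ i = z p ^+ (i - M) * z p ^+ M by rewrite -exprD subnK // ltnW.
ring.
Qed.

(** The functions [1 - x_j ^+ 2] add up to the nonzero constant [n]. *)
Lemma polyS_of_local phi : (0 < n)%N ->
  (forall j, exists N, polyS (fun p => (1 - pcoord j p ^+ 2) ^+ N * phi p)) -> polyS phi.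
Proof.
move=> n0 h.
have yp j : polyS (fun p => 1 - pcoord j p ^+ 2).
  apply: polyS_ext (_ : polyS (fun p => 1 + -1 * pcoord j p ^+ 2)) _.
    apply: polySD; first exact: polyS_cst.
    by apply: polySM; [exact: polyS_cst|apply: polySX; exact: polyS_pcoord].
  by move=> p; rewrite mulN1r.
have [N hN] := polyS_power_sum (index_enum _) yp h.
apply: polyS_ext (polySM (polyS_cst (n%:R ^- N)) hN) _ => p.
rewrite sumrB sum_pcoord sumr_const card_ord -natr1 addrK mulrA mulVf ?mul1r //.
by rewrite expf_neq0 // pnatr_eq0 -lt0n.
Qed.

Theorem eigenpair_polyS lr li a b : (2 <= n)%N -> eigenpair lr li a b -> polyS a /\ polyS b.
Proof.
move=> n2 eab; have [as_ bs _ _] := eab.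
have [p0 p0max] := sphere_max (rsmooth_normsq as_ bs).
pose A := Num.sqrt (normsq a b p0).
have bd p : normsq a b p <= A ^+ 2 by rewrite sqr_sqrtr // normsq_ge0.
have gr0 : 0 <= growth lr by rewrite /growth mulr_ge0 // addr_ge0.
have B j v (v1 : \sum_c v c ^+ 2 = 1) :=
  @iter_dir_rot_bound R n lr li j v a b A n2 v1 eab (sqrtr_ge0 _) bd.
split; apply: polyS_of_local; try exact: ltnW; move=> j;
  apply: (@polyS_away_from_poles j _ A (growth lr)) => //; try exact: sqrtr_ge0;
  by move=> v v1 m p; have [] := B j v v1 m p.
Qed.

End PolynomialFunctions.

(** * Polynomial functions and their derivatives *)

Section PolynomialEvaluation.
Variables (R : realType) (m : nat).
Local Open Scope complex_scope.
Local Notation MP := (mpoly.mpoly m R[i]).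
Local Notation X_ i := (mpoly.mpolyX R[i] (mpoly.mnm1 i)).
Local Notation d_ i P := (mpoly.mderiv i P).
Implicit Types (P Q : MP) (i k : 'I_m) (x : 'rV[R]_m) (e : nat).

(** For properties compatible with sums and products, such as the rules for
    evaluation and derivation. *)
Lemma mpoly_ring_ind (K : MP -> Prop) : (forall c, K (mpoly.mpolyC m c)) ->
  (forall i, K (X_ i)) -> (forall P Q, K P -> K Q -> K (P + Q)) ->
  (forall P Q, K P -> K Q -> K (P * Q)) -> forall P, K P.
Proof.
move=> KC KX KD KM P; rewrite (mpoly.mpolyE P).
have K0 : K 0 by have := KC 0; rewrite mpoly.mpolyC0.
have K1 : K 1 by exact: (KC 1).
apply: (big_ind K) => // s _; rewrite -mpoly.mul_mpolyC; apply: (KM _ _ (KC _)).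
rewrite mpoly.mpolyXE_id; apply: (big_ind K) => // i _.
by elim: (s i) => [|k IH]; rewrite ?expr0 ?exprS //; exact: KM.
Qed.

Notation ev P x := (poly_fun P (x : euclid R m)).

Lemma ev_C c x : ev (mpoly.mpolyC m c) x = c.
Proof. exact: mpoly.mevalC. Qed.
Lemma ev_X i x : ev (X_ i) x = (x 0 i)%:C.
Proof. exact: mpoly.mevalXU. Qed.
Lemma ev_D P Q x : ev (P + Q) x = ev P x + ev Q x.
Proof. exact: mpoly.mevalD. Qed.
Lemma ev_B P Q x : ev (P - Q) x = ev P x - ev Q x.
Proof. exact: mpoly.mevalB. Qed.
Lemma ev_M P Q x : ev (P * Q) x = ev P x * ev Q x.
Proof. exact: mpoly.mevalM. Qed.
Lemma ev_Z a P x : ev (a *: P) x = a * ev P x.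
Proof. exact: mpoly.mevalZ. Qed.
Lemma ev_0 x : ev (0 : MP) x = 0.
Proof. exact: mpoly.meval0. Qed.
Lemma ev_sum (I : Type) (r : seq I) (p : pred I) (F : I -> MP) x :
  ev (\sum_(i <- r | p i) F i) x = \sum_(i <- r | p i) ev (F i) x.
Proof. exact: (raddf_sum (mpoly.meval (fun i => (x 0 i)%:C))). Qed.

Lemma ReCD (z w : R[i]) : complex.Re (z + w) = complex.Re z + complex.Re w.
Proof. by case: z w => [? ?] [? ?]. Qed.
Lemma ImCD (z w : R[i]) : complex.Im (z + w) = complex.Im z + complex.Im w.
Proof. by case: z w => [? ?] [? ?]. Qed.
Lemma ReCM (z w : R[i]) : complex.Re (z * w) =
  complex.Re z * complex.Re w + -1 * (complex.Im z * complex.Im w).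
Proof. by case: z w => [? ?] [? ?] /=; rewrite mulN1r. Qed.
Lemma ImCM (z w : R[i]) : complex.Im (z * w) =
  complex.Re z * complex.Im w + complex.Im z * complex.Re w.
Proof. by case: z w => [? ?] [? ?]. Qed.

Lemma complex_split (a b : R[i]) : complex.Re a = complex.Re b ->
  complex.Im a = complex.Im b -> a = b.
Proof. by case: a b => [? ?] [? ?] /= -> ->. Qed.

Lemma poly_fun_smooth P : smooth_fun (fun x => complex.Re (ev P x)) /\
  smooth_fun (fun x => complex.Im (ev P x)).
Proof.
elim/mpoly_ring_ind: P => [c|i|P Q [P1 P2] [Q1 Q2]|P Q [P1 P2] [Q1 Q2]].
- split; under eq_fun do rewrite ev_C; exact: smooth_fun_cst.
- split; under eq_fun do rewrite ev_X /=; first exact: coord_smooth.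
  exact: smooth_fun_cst.
- split; under eq_fun do rewrite ev_D ?ReCD ?ImCD; exact: smooth_funD.
- split; under eq_fun do rewrite ev_M ?ReCM ?ImCM; apply: smooth_funD; try exact: smooth_funM.
  by apply: smooth_funM; [exact: smooth_fun_cst|exact: smooth_funM].
Qed.

Lemma cpartial_poly_fun P k x : cpartial (poly_fun P) k x = ev (d_ k P) x.
Proof.
elim/mpoly_ring_ind: P => [c|i|P Q IP IQ|P Q IP IQ].
- rewrite mpoly.mderivC ev_0 /cpartial; apply: complex_split => /=;
    by under eq_fun do rewrite ev_C; rewrite partial_cst.
- rewrite mpoly.mderivX mpoly.mnm1E ev_Z /cpartial.
  have -> : ev (mpoly.mpolyX R[i] (mpoly.mnm_sub (mpoly.mnm1 i) (mpoly.mnm1 k))) x =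
     if k == i then 1 else (x 0 i)%:C.
    have [->|ki] := eqVneq k i.
      by rewrite /poly_fun mpoly.mevalX big1 // => l _; rewrite mpoly.mnmBE subnn expr0.
    rewrite -ev_X; congr (poly_fun (mpoly.mpolyX _ _) _); apply/mpoly.mnmP => l.
    rewrite mpoly.mnmBE !mpoly.mnm1E; have [<-|_] := eqVneq i l; last by rewrite sub0n.
    by rewrite (negbTE ki) subn0.
  have E1 : partial (fun w => complex.Re (poly_fun (X_ i) w)) k x = (k == i)%:R.
    by under eq_fun do rewrite ev_X /=; rewrite partial_coord.
  have E2 : partial (fun w => complex.Im (poly_fun (X_ i) w)) k x = 0.
    by under eq_fun do rewrite ev_X /=; rewrite partial_cst.
  by rewrite E1 E2 [i == k]eq_sym; case: (k == i); rewrite ?mulr1 ?mul0r.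
- have [P1 P2] := poly_fun_smooth P; have [Q1 Q2] := poly_fun_smooth Q.
  have [p1 _ _] := smooth_funP P1; have [p2 _ _] := smooth_funP P2.
  have [q1 _ _] := smooth_funP Q1; have [q2 _ _] := smooth_funP Q2.
  rewrite mpoly.mderivD ev_D -IP -IQ; apply: complex_split => /=.
    under eq_fun do rewrite ev_D ReCD.
    exact: (partialD (p1 k x) (q1 k x)).
  under eq_fun do rewrite ev_D ImCD.
  exact: (partialD (p2 k x) (q2 k x)).
- have [P1 P2] := poly_fun_smooth P; have [Q1 Q2] := poly_fun_smooth Q.
  have [p1 _ _] := smooth_funP P1; have [p2 _ _] := smooth_funP P2.
  have [q1 _ _] := smooth_funP Q1; have [q2 _ _] := smooth_funP Q2.
  have [r1 _ _] := smooth_funP (smooth_funM P1 Q1).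
  have [r2 _ _] := smooth_funP (smooth_funM P2 Q2).
  have [r2' _ _] := smooth_funP (smooth_funM (smooth_fun_cst m (-1 : R)) (smooth_funM P2 Q2)).
  have [r3 _ _] := smooth_funP (smooth_funM P1 Q2).
  have [r4 _ _] := smooth_funP (smooth_funM P2 Q1).
  rewrite mpoly.mderivM ev_D !ev_M -IP -IQ; apply: complex_split.
    rewrite ReCD !ReCM /=; under eq_fun do rewrite ev_M ReCM.
    rewrite (partialD (r1 k x) (r2' k x)) (partialZ (r2 k x)).
    rewrite (partialM (p1 k x) (q1 k x)) (partialM (p2 k x) (q2 k x)) mulrDr.
    exact: addrACA.
  rewrite ImCD !ImCM /=; under eq_fun do rewrite ev_M ImCM.
  rewrite (partialD (r3 k x) (r4 k x)).
  rewrite (partialM (p1 k x) (q2 k x)) (partialM (p2 k x) (q1 k x)).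
  exact: addrACA.
Qed.

End PolynomialEvaluation.

(** * Homogeneous polynomials *)

Section HomogeneousPolynomials.
Variables (R : realType) (m : nat).
Local Open Scope complex_scope.
Local Notation MP := (mpoly.mpoly m R[i]).
Local Notation X_ i := (mpoly.mpolyX R[i] (mpoly.mnm1 i)).
Local Notation d_ i P := (mpoly.mderiv i P).
Local Notation ev P x := (poly_fun P (x : euclid R m)).
Implicit Types (P Q : MP) (k : 'I_m) (x : 'rV[R]_m) (e d : nat).

Lemma homogE P d s : is_homogeneous d P -> s \in mpoly.msupp P -> mpoly.mdeg s = d.
Proof. by move=> /mpoly.dhomogP; exact. Qed.

Lemma homogI P d : (forall s, s \in mpoly.msupp P -> mpoly.mdeg s = d) -> is_homogeneous d P.
Proof. by move=> h; apply/mpoly.dhomogP. Qed.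

Lemma ev_origin P : ev P 0 = mpoly.mcoeff mpoly.mnm0 P.
Proof.
rewrite /poly_fun mpoly.mevalE [in RHS](mpoly.mpolyE P) raddf_sum; apply: eq_bigr => s _.
rewrite /= mpoly.mcoeffZ mpoly.mcoeffX; congr (_ * _).
have [->|s0] := eqVneq s mpoly.mnm0.
  by rewrite big1 // => i _; rewrite mpoly.mnm0E expr0.
have [/existsP[i si]|/existsPn h] := boolP [exists i, s i != 0%N].
  by rewrite (bigD1 i) //= mxE expr0n (negbTE si) mul0r.
case/eqP: s0; apply/mpoly.mnmP => i; rewrite mpoly.mnm0E.
by apply/eqP; rewrite -[_ == _]negbK h.
Qed.

(** All derivatives at the origin of a polynomial vanishing on [R^m] are 0. *)
Lemma poly_fun_eq0 P : (forall x, ev P x = 0) -> P = 0.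
Proof.
move=> P0; apply/mpoly.mpolyP => s; rewrite mpoly.mcoeff0.
have dz Q k : (forall x, ev Q x = 0) -> forall x, ev (d_ k Q) x = 0.
  move=> Q0 x; rewrite -cpartial_poly_fun /cpartial.
  by apply: complex_split => /=; under eq_fun do rewrite Q0 /=; rewrite partial_cst.
have dzm : forall x, ev (mpoly.mderivm s P) x = 0.
  by rewrite mpoly.mderivm_foldr; elim: (flatten _) => //= k r IH; exact: dz.
have := mpoly.mcoeff_mderivm s P mpoly.mnm0; rewrite -ev_origin dzm mpoly.addm0.
move=> /esym/eqP; rewrite mulrn_eq0 => /orP[|/eqP//].
rewrite (eq_bigr (fun i => (s i)`!)) => [|i _]; last exact: ffactnn.
by rewrite gtn_eqF // prodn_gt0 // => i; exact: fact_gt0.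
Qed.

Lemma ev_scale P d t x : is_homogeneous d P -> ev P (t *: x) = t%:C ^+ d * ev P x.
Proof.
move=> hP; rewrite /poly_fun !mpoly.mevalE mulr_sumr.
rewrite big_seq [RHS]big_seq; apply: eq_bigr => s /(homogE hP) <-.
rewrite mulrCA; congr (_ * _); rewrite mpoly.mdegE -prodrXr -big_split /=.
by apply: eq_bigr => i _; rewrite mxE rmorphM exprMn.
Qed.

Lemma homog_deriv P d k : is_homogeneous d P -> is_homogeneous d.-1 (d_ k P).
Proof.
move=> hP; apply: homogI => s; rewrite mpoly.mcoeff_msupp mpoly.mcoeff_deriv => s0.
have : mpoly.mnm_add s (mpoly.mnm1 k) \in mpoly.msupp P.
  by rewrite mpoly.mcoeff_msupp; apply: contra_neq s0 => ->; rewrite mul0rn.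
by move=> /(homogE hP) <-; rewrite mpoly.mdegD mpoly.mdeg1 addn1.
Qed.

Lemma homog0_deriv P k : is_homogeneous 0 P -> d_ k P = 0.
Proof.
move=> hP; apply/mpoly.mpolyP => s; rewrite mpoly.mcoeff0 mpoly.mcoeff_deriv.
case: (boolP (mpoly.mnm_add s (mpoly.mnm1 k) \in mpoly.msupp P)).
  by move=> /(homogE hP); rewrite mpoly.mdegD mpoly.mdeg1 addn1.
by move=> /mpoly.memN_msupp_eq0 ->; rewrite mul0rn.
Qed.

Lemma homogM P Q d e : is_homogeneous d P -> is_homogeneous e Q -> is_homogeneous (d + e) (P * Q).
Proof. exact: mpoly.dhomogM. Qed.

Lemma homogD P Q d : is_homogeneous d P -> is_homogeneous d Q -> is_homogeneous d (P + Q).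
Proof. exact: mpoly.dhomogD. Qed.

Lemma homogZ P d a : is_homogeneous d P -> is_homogeneous d (a *: P).
Proof. exact: mpoly.dhomogZ. Qed.

Lemma homog_0 d : is_homogeneous d (0 : MP).
Proof. exact: mpoly.dhomog0. Qed.

Lemma homog_sum (I : Type) (r : seq I) (F : I -> MP) d :
  (forall i, is_homogeneous d (F i)) -> is_homogeneous d (\sum_(i <- r) F i).
Proof.
move=> h; apply: (big_ind (fun P => is_homogeneous d P)) => [|P Q|i _]; last exact: h.
  exact: homog_0.
exact: homogD.
Qed.

Lemma homog_X (i : 'I_m) : @is_homogeneous R m 1 (X_ i).
Proof. by rewrite /is_homogeneous mpoly.dhomogX /= mpoly.mdeg1. Qed.

Lemma euler P d : is_homogeneous d P -> \sum_k X_ k * d_ k P = d%:R *: P.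
Proof.
move=> hP; rewrite {2}(mpoly.mpolyE P) scaler_sumr.
transitivity (\sum_k \sum_(s <- mpoly.msupp P) mpoly.mcoeff s P *: (X_ k * d_ k (mpoly.mpolyX R[i] s))).
  apply: eq_bigr => k _; rewrite {1}(mpoly.mpolyE P) raddf_sum mulr_sumr.
  by apply: eq_bigr => s _; rewrite /= mpoly.mderivZ -scalerAr.
rewrite exchange_big big_seq [RHS]big_seq /=; apply: eq_bigr => s /(homogE hP) <-.
rewrite -scaler_sumr scalerA mulrC -scalerA; congr (_ *: _).
rewrite mpoly.mdegE natr_sum scaler_suml; apply: eq_bigr => k _.
rewrite mpoly.mderivX -scalerAr; have [->|k0] := eqVneq (s k) 0%N; first by rewrite !scale0r.
congr (_ *: _); rewrite -mpoly.mpolyXD mpoly.addmC mpoly.submK //.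
by rewrite mpoly.lep1mP.
Qed.

Definition lapP P : MP := \sum_k d_ k (d_ k P).
Definition gradsqP P : MP := \sum_k d_ k P ^+ 2.
Definition normsqP : MP := \sum_k X_ k ^+ 2.

Lemma homog_normsqP : @is_homogeneous R m 2 normsqP.
Proof. by apply: homog_sum => k; apply: (@homogM _ _ 1 1); exact: homog_X. Qed.

Lemma homog_lapP P d : is_homogeneous d P -> is_homogeneous d.-2 (lapP P).
Proof. by move=> hP; apply: homog_sum => k; do 2! apply: homog_deriv. Qed.

Lemma lapP_small P d : (d < 2)%N -> is_homogeneous d P -> lapP P = 0.
Proof.
move=> d2 hP; rewrite /lapP big1 // => k _; apply: homog0_deriv.
by have := homog_deriv k hP; case: d d2 {hP} => [|[|]].
Qed.

Lemma homog_normsq_lapP P d : is_homogeneous d P -> is_homogeneous d (normsqP * lapP P).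
Proof.
move=> hP; have [d2|d2] := ltnP d 2; first by rewrite (lapP_small d2 hP) mulr0; exact: homog_0.
have -> : d = (2 + d.-2)%N by case: d d2 {hP} => [|[|]].
by apply: homogM; [exact: homog_normsqP|exact: homog_lapP].
Qed.

Lemma homog_normsq_gradsqP P d : is_homogeneous d P -> is_homogeneous (d + d) (normsqP * gradsqP P).
Proof.
move=> hP; case: d hP => [|d] hP.
  have -> : gradsqP P = 0 by rewrite /gradsqP big1 // => k _; rewrite homog0_deriv // expr0n.
  by rewrite mulr0; exact: homog_0.
have -> : (d.+1 + d.+1 = 2 + (d + d))%N by rewrite addSn addnS.
apply: homogM; first exact: homog_normsqP.
by apply: homog_sum => k; apply: homogM; exact: (homog_deriv k hP).
Qed.

Lemma ev_normsqP x : ev normsqP x = (sqnorm x)%:C.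
Proof.
rewrite /normsqP ev_sum /sqnorm rmorph_sum; apply: eq_bigr => k _.
by rewrite expr2 ev_M !ev_X rmorphXn expr2.
Qed.

End HomogeneousPolynomials.

(** * Spherical operators on restrictions of polynomials *)

Section ComplexSphere.
Variables (R : realType) (n : nat).
Notation S := (sphere_point R n).
Local Open Scope complex_scope.
Local Notation MP := (mpoly.mpoly n.+1 R[i]).
Local Notation X_ i := (mpoly.mpolyX R[i] (mpoly.mnm1 i)).
Local Notation d_ i P := (mpoly.mderiv i P).
Implicit Types (f g : S -> R[i]) (P Q : MP) (p : S) (c k : 'I_n.+1) (d e : nat).

Local Notation re f := (fun p => complex.Re (f p)).
Local Notation im f := (fun p => complex.Im (f p)).

Definition csmooth f := rsmooth (re f) /\ rsmooth (im f).

Definition cSd c f p : R[i] := Sd c (re f) p +i* Sd c (im f) p.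
Definition clap f p : R[i] := lap (re f) p +i* lap (im f) p.

Lemma clapE f p : clap f p = \sum_c cSd c (cSd c f) p.
Proof.
apply: complex_split; rewrite /= ?(raddf_sum (@complex.Re R)) ?(raddf_sum (@complex.Im R)) //.
Qed.

Definition restr P p : R[i] := poly_fun P (sval p : euclid R n.+1).

Lemma cSdD c f g p : csmooth f -> csmooth g ->
  cSd c (fun p => f p + g p) p = cSd c f p + cSd c g p.
Proof.
move=> [f1 f2] [g1 g2]; apply: complex_split; rewrite /cSd ?ReCD ?ImCD /=.
  by under [X in Sd c X]eq_fun do rewrite ReCD; rewrite SdD.
by under [X in Sd c X]eq_fun do rewrite ImCD; rewrite SdD.
Qed.

Lemma cSdM c f g p : csmooth f -> csmooth g ->
  cSd c (fun p => f p * g p) p = cSd c f p * g p + f p * cSd c g p.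
Proof.
move=> [f1 f2] [g1 g2]; apply: complex_split; rewrite /cSd ?ReCD ?ImCD ?ReCM ?ImCM /=.
  under [X in Sd c X]eq_fun do rewrite ReCM.
  rewrite SdD; [|exact: rsmoothM|by apply: rsmoothZ; exact: rsmoothM].
  by rewrite SdZ; [rewrite !SdM //; ring|exact: rsmoothM].
under [X in Sd c X]eq_fun do rewrite ImCM.
rewrite SdD; [|exact: rsmoothM..].
by rewrite !SdM //; ring.
Qed.

Lemma csmooth_restr P : csmooth (restr P).
Proof.
elim/mpoly_ring_ind: P => [a|c|P Q [P1 P2] [Q1 Q2]|P Q [P1 P2] [Q1 Q2]]; rewrite /csmooth /restr.
- by split; under eq_fun do rewrite ev_C; exact: rsmooth_cst.
- split; under eq_fun do rewrite ev_X /=; first exact: rsmooth_pcoord.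
  exact: rsmooth_cst.
- split; under eq_fun do rewrite ev_D ?ReCD ?ImCD; [exact: (rsmoothD P1 Q1)|exact: (rsmoothD P2 Q2)].
- split; under eq_fun do rewrite ev_M ?ReCM ?ImCM.
    exact: (rsmoothD (rsmoothM P1 Q1) (rsmoothZ (-1) (rsmoothM P2 Q2))).
  exact: (rsmoothD (rsmoothM P1 Q2) (rsmoothM P2 Q1)).
Qed.

(** The polynomial whose restriction to the sphere is the [c]-th component of the
    gradient of the restriction of [P], see [cSd_restr]. *)
Definition tang c P : MP := d_ c P - X_ c * \sum_k X_ k * d_ k P.

Lemma ev_dX c k (x : 'rV[R]_n.+1) : poly_fun (d_ k (X_ c)) (x : euclid R n.+1) = (k == c)%:R.
Proof.
rewrite -cpartial_poly_fun /cpartial.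
under eq_fun do rewrite ev_X /=.
under [X in _ +i* partial X _ _]eq_fun do rewrite ev_X /=.
by rewrite partial_coord partial_cst; case: (k == c).
Qed.

(** Both sides are derivations in [P], and they agree on the coordinates. *)
Lemma cSd_restr c P : cSd c (restr P) = restr (tang c P).
Proof.
apply/funext => p; rewrite /restr /tang ev_B ev_M ev_X (ev_sum _ xpredT (fun k => X_ k * d_ k P)).
elim/mpoly_ring_ind: P => [a|i|P Q IP IQ|P Q IP IQ].
- rewrite mpoly.mderivC ev_0 big1 ?mulr0 ?subr0 => [|k _]; last by rewrite mpoly.mderivC mulr0 ev_0.
  rewrite /cSd; under eq_fun do rewrite ev_C.
  under [X in _ +i* Sd c X _]eq_fun do rewrite ev_C.
  by rewrite !Sd_cst.
- rewrite ev_dX (eq_bigr (fun k => (k == i)%:R * (sval p 0 k)%:C)); last first.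
    by move=> k _; rewrite ev_M ev_X ev_dX mulrC.
  rewrite (bigD1 i) //= eqxx mul1r big1 ?addr0; last by move=> k /negbTE ->; rewrite mul0r.
  rewrite /cSd; under eq_fun do rewrite ev_X /=.
  under [X in _ +i* Sd c X _]eq_fun do rewrite ev_X /=.
  rewrite Sd_cst Sd_pcoord -rmorphM.
  by apply: complex_split; case: (c == i); rewrite /= ?subr0 ?add0r ?oppr0.
- rewrite mpoly.mderivD ev_D; under eq_bigr do rewrite mpoly.mderivD mulrDr ev_D.
  rewrite big_split /= mulrDr opprD addrACA -IP -IQ -cSdD; try exact: csmooth_restr.
  by congr (cSd c _ p); apply/funext => q; rewrite ev_D.
- rewrite mpoly.mderivM ev_D !ev_M.
  rewrite (eq_bigr (fun k => poly_fun (X_ k * d_ k P) (sval p : euclid R n.+1) * poly_fun Q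
    (sval p : euclid R n.+1) +
     poly_fun P (sval p : euclid R n.+1) * poly_fun (X_ k * d_ k Q) (sval p : euclid R n.+1)));
       last first.
    move=> k _; rewrite mpoly.mderivM ev_M ev_D !ev_M mulrDr mulrA; congr (_ + _).
    exact: mulrCA.
  rewrite big_split /= -mulr_suml -mulr_sumr.
  transitivity (cSd c (restr P) p * restr Q p + restr P p * cSd c (restr Q) p).
    rewrite -cSdM; try exact: csmooth_restr.
    by congr (cSd c _ p); apply/funext => q; rewrite /restr ev_M.
  by rewrite /restr IP IQ mulrBl mulrBr addrACA -opprD mulrDr mulrA; congr (_ - (_ + _)); exact: mulrCA.
Qed.

Lemma restr_normsqP p : restr (normsqP R n.+1) p = 1.
Proof. by rewrite /restr ev_normsqP; case: p => x /= /eqP ->. Qed.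

Lemma tang_homog P d c : is_homogeneous d P -> tang c P = d_ c P - d%:R *: (X_ c * P).
Proof. by move=> hP; rewrite /tang (euler hP) -scalerAr. Qed.

Lemma tang_tang P d c : is_homogeneous d P -> tang c (tang c P) =
  d_ c (d_ c P) - d%:R *: P - (d%:R + d.-1%:R) *: (X_ c * d_ c P) +
  (d%:R * d.+1%:R) *: (X_ c ^+ 2 * P).
Proof.
move=> hP; rewrite (tang_homog c hP) /tang mpoly.mderivB mpoly.mderivZ mpoly.mderivM.
have -> : d_ c (X_ c) = 1.
  apply/eqP; rewrite -subr_eq0; apply/eqP/poly_fun_eq0 => x.
  by rewrite ev_B ev_dX eqxx /poly_fun mpoly.meval1 subrr.
have -> : \sum_k X_ k * d_ k (d_ c P - d%:R *: (X_ c * P)) =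
   d.-1%:R *: d_ c P - (d%:R * d.+1%:R) *: (X_ c * P).
  rewrite -(euler (homog_deriv c hP)) -scalerA -(euler (homogM (homog_X _ c) hP)).
  rewrite scaler_sumr -sumrB; apply: eq_bigr => k _.
  by rewrite mpoly.mderivB mpoly.mderivZ mulrBr scalerAr.
rewrite mul1r mulrBr -!scalerAr scalerDr scalerDl expr2 mulrA.
by rewrite !opprD !opprK !addrA.
Qed.

(** Apply [tang] twice and sum over [c], using [|x|^2 = 1] and Euler's identity. *)
Lemma clap_restr P d p : is_homogeneous d P ->
  clap (restr P) p = restr (lapP P) p - d%:R * (d%:R + n%:R - 1) * restr P p.
Proof.
move=> hP; rewrite clapE.
rewrite (eq_bigr (fun c => restr (tang c (tang c P)) p)); last by move=> c _; rewrite !cSd_restr.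
under eq_bigr => c _ do rewrite (tang_tang _ hP) /restr !(ev_B, ev_D, ev_Z) (ev_M (X_ c ^+ 2) P).
rewrite big_split /= !sumrB sumr_const card_ord -!mulr_sumr -mulr_suml -!(ev_sum (index_enum _)).
rewrite -/(normsqP R n.+1) -/(lapP P) (euler hP) ev_Z -/(restr _ p) -!/(restr _ p) restr_normsqP.
rewrite -mulr_natr -!natr1; move: (restr _ _) (restr _ _) => A B.
case: d {hP} => [|d]; first by rewrite /=; ring.
by rewrite /= -natr1; ring.
Qed.

Lemma gradsq_restr P d p : is_homogeneous d P ->
  \sum_c cSd c (restr P) p ^+ 2 = restr (gradsqP P) p - d%:R ^+ 2 * restr P p ^+ 2.
Proof.
move=> hP.
rewrite (eq_bigr (fun c => restr (d_ c P ^+ 2) p - 2 * d%:R * restr P p * restr (X_ c * d_ c P) p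
  + d%:R ^+ 2 * restr P p ^+ 2 * restr (X_ c ^+ 2) p)); last first.
  move=> c _; rewrite cSd_restr (tang_homog c hP) /restr ev_B ev_Z !expr2 !ev_M.
  by ring.
rewrite big_split /= sumrB -!mulr_sumr -!(ev_sum (index_enum _)).
rewrite (euler hP) ev_Z -/(normsqP R n.+1) -/(gradsqP P) -!/(restr _ p) restr_normsqP; ring.
Qed.

Lemma smooth_csmooth f : smooth (sphere R n) f -> csmooth f.
Proof. by move=> hf; split=> s k; have [] := hf s k. Qed.

Lemma eigenfunctionE lambda mu f : (2 <= n)%N -> csmooth f ->
  (eigenfunction (sphere R n) lambda mu f <->
   forall p, clap f p = lambda * f p /\ \sum_c cSd c f p ^+ 2 = mu * f p ^+ 2).
Proof.
move=> n2 [f1 f2].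
have E1 s u : tau (round_metric s) (fun u => f (sphere_chart s u)) u = clap f (sphere_chart s u).
  by rewrite tau_round // /clap !lap_chart.
have E2 s u : kappa (round_metric s) (fun u => f (sphere_chart s u)) (fun u => f (sphere_chart s u)) u =
    \sum_c cSd c f (sphere_chart s u) ^+ 2.
  by rewrite kappa_round; apply: eq_bigr => c _; rewrite /cSd !Sd_chart.
split=> [h p|h s u].
  have [s [u <-]] := sphere_cover p; have [h1 h2] := h s u.
  by rewrite -E1 -E2.
by have [h1 h2] := h (sphere_chart s u); rewrite -E1 -E2 in h1 h2.
Qed.

End ComplexSphere.

(** * Division by the quadratic form *)

Section NormalFormIdentities.
Variables (T : comPzRingType) (a a' b b' x N h h' g : T).

(** The identities behind [normal_form] and [normsq_dvd_of_sqr], over an abstract ring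
    where they are cheap to verify. *)
Lemma nf_add : a + x * b + N * h + (a' + x * b' + N * h') =
  (a + a') + x * (b + b') + N * (h + h').
Proof. ring. Qed.

Lemma nf_mul : (a + x * b + N * h) * (a' + x * b' + N * h') =
  (a * a' - (N - x ^+ 2) * (b * b')) + x * (a * b' + a' * b) +
  N * (b * b' + h * (a' + x * b' + N * h') + h' * (a + x * b)).
Proof. ring. Qed.

Lemma nf_sqr : (a + x * b + N * h) ^+ 2 = N * g ->
  (a * a - (N - x ^+ 2) * (b * b)) + x * (2 * (a * b)) =
  N * (g - b * b - h * (N * h + 2 * (a + x * b))).
Proof. by rewrite !mulrBr => <-; ring. Qed.

End NormalFormIdentities.

Section Division.
Variables (R : realType) (n : nat).
Local Open Scope complex_scope.
Local Notation MP := (mpoly.mpoly n.+1 R[i]).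
Local Notation X_ i := (mpoly.mpolyX R[i] (mpoly.mnm1 i)).
Local Notation mw a := (mpoly.mwiden a).
Implicit Types (P Q F G H : MP) (a b : mpoly.mpoly n R[i]).

Local Notation N2 := (normsqP R n.+1).
Local Notation q := (normsqP R n).

Lemma lift_max_widen (j : 'I_n) : lift ord_max j = widen_ord (leqnSn n) j.
Proof. by apply: ord_inj; rewrite lift_max. Qed.

Lemma mwiden_X (j : 'I_n) : mw (X_ j) = X_ (widen_ord (leqnSn n) j).
Proof. by rewrite mpoly.mwidenX mpoly.mnmwiden1. Qed.

Lemma normsqP_split : N2 = mw q + X_ ord_max ^+ 2.
Proof.
rewrite /normsqP big_ord_recr /= raddf_sum; congr (_ + _); apply: eq_bigr => j _.
by rewrite !expr2 /= mpoly.mwidenM mwiden_X.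
Qed.

Lemma mwiden_q : mw q = N2 - X_ ord_max ^+ 2.
Proof. by rewrite normsqP_split addrK. Qed.

(** Normal forms modulo [|x|^2]: the square of the last variable is replaced
    by minus the sum of the other squares. *)
Lemma normal_form P : exists a b H, P = mw a + X_ ord_max * mw b + N2 * H.
Proof.
elim/mpoly_ring_ind: P => [c|i|P Q [a [b [H ->]]] [a' [b' [H' ->]]]|P Q [a [b [H ->]]] [a' [b' [H' ->]]]].
- exists (mpoly.mpolyC _ c), 0, 0.
  by rewrite mpoly.mwidenC mpoly.mwiden0 !mulr0 !addr0.
- case: (unliftP ord_max i) => [j|] ->.
    exists (X_ j), 0, 0; rewrite mwiden_X lift_max_widen mpoly.mwiden0.
    by rewrite !mulr0 !addr0.
  exists 0, 1, 0; rewrite mpoly.mwiden0 mpoly.mwiden1.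
  by rewrite mulr1 mulr0 add0r addr0.
- exists (a + a'), (b + b'), (H + H'); rewrite !mpoly.mwidenD; exact: nf_add.
- exists (a * a' - q * (b * b')), (a * b' + a' * b),
    (mw b * mw b' + H * (mw a' + X_ ord_max * mw b' + N2 * H') + H' * (mw a + X_ ord_max * mw b)).
  rewrite mpoly.mwidenB !mpoly.mwidenD !mpoly.mwidenM mwiden_q; exact: nf_mul.
Qed.

Lemma meval_mwiden (v : 'I_n.+1 -> R[i]) a :
  mpoly.meval v (mw a) = mpoly.meval (fun j => v (widen_ord (leqnSn n) j)) a.
Proof.
elim/mpoly_ring_ind: a => [c|i|P Q IP IQ|P Q IP IQ].
- by rewrite mpoly.mwidenC !mpoly.mevalC.
- by rewrite mwiden_X !mpoly.mevalXU.
- rewrite mpoly.mwidenD; apply: etrans (mpoly.mevalD _ _ _) _; apply: etrans _ (esym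
  (mpoly.mevalD _ _ _)).
  exact: (congr2 +%R IP IQ).
- rewrite mpoly.mwidenM; apply: etrans (mpoly.mevalM _ _ _) _; apply: etrans _ (esym
  (mpoly.mevalM _ _ _)).
  exact: (congr2 *%R IP IQ).
Qed.

Lemma normsqP_neq0 : (0 < n)%N -> q != 0.
Proof.
move=> n0; apply/eqP => q0.
have := ev_normsqP (const_mx 1 : 'rV[R]_n); rewrite q0 ev_0 /sqnorm => /esym/eqP.
rewrite fmorph_eq0 (eq_bigr (fun=> 1)) => [|i _]; last by rewrite mxE expr1n.
by rewrite sumr_const card_ord pnatr_eq0 => /eqP nn; rewrite nn in n0.
Qed.

(** Evaluate at the two points [(y, +- i |y|)] of the isotropic cone above [y]. *)
Lemma normal_form_eq0 a b G : (0 < n)%N -> mw a + X_ ord_max * mw b = N2 * G -> a = 0 /\ b = 0.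
Proof.
move=> n0 E.
pose cone (y : 'rV[R]_n) (z : R[i]) : 'I_n.+1 -> R[i] :=
  fun c => if unlift ord_max c is Some j then (y 0 j)%:C else z.
have coneE y z j : cone y z (widen_ord (leqnSn n) j) = (y 0 j)%:C.
  by rewrite /cone -lift_max_widen liftK.
have evc y z c : mpoly.meval (cone y z) (mw c) = poly_fun c (y : euclid R n).
  by rewrite meval_mwiden; apply: mpoly.meval_eq => j; rewrite coneE.
have key y z : z ^+ 2 = - (sqnorm y)%:C ->
    poly_fun a (y : euclid R n) + z * poly_fun b (y : euclid R n) = 0.
  move=> z2.
  have vX : mpoly.meval (cone y z) (X_ ord_max) = z.
    by rewrite mpoly.mevalXU /cone unlift_none.
  have vN : mpoly.meval (cone y z) N2 = 0.
    rewrite normsqP_split (mpoly.mevalD _ (mw q) (X_ ord_max ^+ 2)) evc ev_normsqP.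
    by rewrite expr2 (mpoly.mevalM _ (X_ ord_max) (X_ ord_max)) vX -expr2 z2 subrr.
  have vl : mpoly.meval (cone y z) (mw a + X_ ord_max * mw b) =
      poly_fun a (y : euclid R n) + z * poly_fun b (y : euclid R n).
    rewrite (mpoly.mevalD _ (mw a) (X_ ord_max * mw b)) (mpoly.mevalM _ (X_ ord_max) (mw b)).
    by congr (_ + _ * _); [exact: evc|exact: vX|exact: evc].
  apply: etrans (esym vl) _; apply: etrans (congr1 (mpoly.meval (cone y z)) E) _.
  apply: etrans (mpoly.mevalM _ N2 G) _.
  exact: etrans (congr1 ( *%R^~ _) vN) (mul0r _).
have both y : poly_fun a (y : euclid R n) = 0 /\ poly_fun (q * b) (y : euclid R n) = 0.
  pose z : R[i] := 'i * (Num.sqrt (sqnorm y))%:C.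
  have z2 : z ^+ 2 = - (sqnorm y)%:C.
    by rewrite exprMn sqr_i mulN1r -rmorphXn sqr_sqrtr ?sqnorm_ge0.
  have h1 := key y z z2; have := key y (- z); rewrite sqrrN => /(_ z2) h2.
  have a0 : poly_fun a (y : euclid R n) = 0.
    have : 2 * poly_fun a (y : euclid R n) = 0.
      have := congr2 +%R h1 h2; rewrite addr0 mulNr => <-; ring.
    by move=> /eqP; rewrite mulf_eq0 pnatr_eq0 /= => /eqP.
  split=> //; rewrite ev_M ev_normsqP -[_%:C]opprK -z2 expr2.
  by move: h1; rewrite a0 add0r => h1; rewrite mulNr -mulrA h1 mulr0 oppr0.
have a0 : a = 0 by apply: poly_fun_eq0 => y; have [] := both y.
split=> //.
have : q * b = 0 by apply: poly_fun_eq0 => y; have [] := both y.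
by move=> /eqP; rewrite mulf_eq0 (negbTE (normsqP_neq0 n0)) => /eqP.
Qed.

(** The quadric [|x|^2 = 0] is reduced: in normal form, the square of
    [a + x_n b] has the components [a ^+ 2 - q b ^+ 2] and [2 a b], where [q] is
    the sum of the other squares, and both vanish only if [a = b = 0]. *)
Lemma normsq_dvd_of_sqr F G : (0 < n)%N -> F ^+ 2 = N2 * G -> exists H, F = N2 * H.
Proof.
move=> n0 E; have [a [b [H FE]]] := normal_form F.
have E' : mw (a * a - q * (b * b)) + X_ ord_max * mw (mpoly.mpolyC n 2 * (a * b)) =
    N2 * (G - mw b * mw b - H * (N2 * H + 2 * (mw a + X_ ord_max * mw b))).
  rewrite mpoly.mwidenB !mpoly.mwidenM mpoly.mwidenC mpoly.mpolyC_nat mwiden_q.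
  by apply: nf_sqr; rewrite -FE.
have [A0 B0] := normal_form_eq0 n0 E'; have q0 := normsqP_neq0 n0.
have [a0 b0] : a = 0 /\ b = 0.
  move: B0 => /eqP; rewrite !mulf_eq0 mpoly.mpolyC_eq0 pnatr_eq0 /= => /orP[/eqP a0|/eqP b0].
  - split=> //; move: A0 => /eqP; rewrite a0 mul0r sub0r oppr_eq0 mulf_eq0 (negbTE q0) /=.
    by rewrite mulf_eq0 orbb => /eqP.
  - split=> //; move: A0 => /eqP; rewrite b0 !mulr0 subr0.
    by rewrite mulf_eq0 orbb => /eqP.
by exists H; rewrite FE a0 b0 mpoly.mwiden0 mulr0 !add0r.
Qed.

End Division.

(** * Polynomial eigenfunctions and harmonic polynomials *)

Section Descent.
Variables (R : realType) (n : nat).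
Hypothesis n0 : (0 < n)%N.
Notation S := (sphere_point R n).
Local Open Scope complex_scope.
Local Notation MP := (mpoly.mpoly n.+1 R[i]).
Local Notation X_ i := (mpoly.mpolyX R[i] (mpoly.mnm1 i)).
Local Notation N2 := (normsqP R n.+1).
Implicit Types (f g : S -> R[i]) (P Q A B F G H : MP) (p : S) (d e : nat) (lam mu : R[i]).

Lemma restr0 p : restr (0 : MP) p = 0.
Proof. exact: ev_0. Qed.
Lemma restrD P Q p : restr (P + Q) p = restr P p + restr Q p.
Proof. exact: ev_D. Qed.

Lemma restrZ a P p : restr (a *: P) p = a * restr P p.
Proof. exact: ev_Z. Qed.
Lemma restrM P Q p : restr (P * Q) p = restr P p * restr Q p.
Proof. exact: ev_M. Qed.
Lemma restr_normsqM P p : restr (N2 * P) p = restr P p.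
Proof. by rewrite restrM restr_normsqP mul1r. Qed.

Lemma rayP (x : 'rV[R]_n.+1) : exists (r : R) p, x = r *: sval p.
Proof.
have [x0|x0] := eqVneq (sqnorm x) 0.
  exists 0, (pole R (ord0 : 'I_n.+1) : S); rewrite scale0r; apply/rowP => c; rewrite mxE.
  have : x 0 c ^+ 2 <= 0.
    by rewrite -x0 /sqnorm (bigD1 c) //= lerDl; apply: sumr_ge0 => k _; exact: sqr_ge0.
  by rewrite real_exprn_even_le0 ?num_real //= => /eqP.
have r0 : Num.sqrt (sqnorm x) != 0.
  by rewrite sqrtr_eq0 -ltNge lt_neqAle eq_sym x0 sqnorm_ge0.
have xS : sqnorm ((Num.sqrt (sqnorm x))^-1 *: x) == 1.
  by rewrite sqnormZ exprVn sqr_sqrtr ?sqnorm_ge0 // mulVf.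
exists (Num.sqrt (sqnorm x)), (exist (fun y : 'rV[R]_n.+1 => sqnorm y == 1) _ xS).
by rewrite /= scalerA divff // scale1r.
Qed.

(** A homogeneous polynomial is determined by its values on the sphere, which meets
    every ray. *)
Lemma homog_restr_eq0 P d : is_homogeneous d P -> (forall p, restr P p = 0) -> P = 0.
Proof.
move=> hP P0; apply: poly_fun_eq0 => x; have [r [p ->]] := rayP x.
by rewrite (ev_scale _ _ hP) -/(restr P p) P0 mulr0.
Qed.

(** The eigenvalue of the Laplacian on restrictions of harmonic homogeneous
    polynomials of degree [d]. *)
Definition sphere_eigenvalue d : R[i] := - (d%:R * (d%:R + n%:R - 1)).

(** Up to sign the eigenvalue is [d * (d + (n - 1))], which is strictly increasing
    in the degree. *)
Lemma sphere_eigenvalue_inj d e : sphere_eigenvalue d = sphere_eigenvalue e -> d = e.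
Proof.
have nE : n%:R - 1 = n.-1%:R :> R[i] by rewrite -{1}(prednK n0) -natr1 addrK.
rewrite /sphere_eigenvalue -!addrA nE -!natrD -!natrM => /oppr_inj/eqP; rewrite eqr_nat => /eqP.
clear nE; move: n.-1 => m E; apply/eqP; rewrite eqn_leq.
have lt a b : (a < b)%N -> (a * (a + m) < b * (b + m))%N.
  move=> ab; have b0 : (0 < b)%N by exact: leq_ltn_trans ab.
  apply: (@leq_ltn_trans (a * (b + m))); first by rewrite leq_mul2l leq_add2r (ltnW ab) orbT.
  by rewrite ltn_pmul2r // addn_gt0 b0.
by apply/andP; split; rewrite leqNgt; apply/negP => /lt; rewrite E ltnn.
Qed.

(** When the eigenvalue is not that of the degree, [P] agrees on the sphere with a
    multiple of its Laplacian, of degree two less. *)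
Lemma harmonic_descent e P lam : is_homogeneous e P ->
  (forall p, clap (restr P) p = lam * restr P p) ->
  exists d H, [/\ (d <= e)%N, is_homogeneous d H, lapP H = 0,
    forall p, restr H p = restr P p & H = 0 \/ lam = sphere_eigenvalue d].
Proof.
elim/ltn_ind: e P => e IH P hP lapE.
have key p : restr (lapP P) p = (lam - sphere_eigenvalue e) * restr P p.
  have := lapE p; rewrite (clap_restr _ hP) => h.
  by rewrite mulrBl -h /sphere_eigenvalue mulNr opprK subrK.
have [le|le] := eqVneq lam (sphere_eigenvalue e).
  exists e, P; split=> //; last by right.
  apply: (homog_restr_eq0 (homog_lapP hP)) => p.
  by rewrite key le subrr mul0r.
have c0 : lam - sphere_eigenvalue e != 0 by rewrite subr_eq0.
have PE p : restr ((lam - sphere_eigenvalue e)^-1 *: lapP P) p = restr P p.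
  by rewrite restrZ key mulKf.
have [e2|e2] := ltnP e 2.
  exists e, 0; split=> //; [exact: homog_0| | |by left].
    by rewrite /lapP big1 // => k _; rewrite !mpoly.mderiv0.
  by move=> p; rewrite restr0 -PE (lapP_small e2 hP) scaler0 restr0.
have hP' : is_homogeneous e.-2 ((lam - sphere_eigenvalue e)^-1 *: lapP P).
  by apply: homogZ; exact: homog_lapP.
have fE : restr ((lam - sphere_eigenvalue e)^-1 *: lapP P) = restr P by apply/funext.
have e2' : (e.-2 < e)%N by case: e e2 {IH hP lapE key le c0 PE hP' fE} => [|[|e]].
have lapE' p : clap (restr ((lam - sphere_eigenvalue e)^-1 *: lapP P)) p = lam * restr
  ((lam - sphere_eigenvalue e)^-1 *: lapP P) p.
  by rewrite fE; exact: lapE.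
have [d [H [h1 h2 h3 h4 h5]]] := IH _ e2' _ hP' lapE'.
exists d, H; split=> //; first exact: leq_trans h1 (ltnW e2').
by move=> p; rewrite h4 PE.
Qed.

(** Since [|x|^2 = 1] on the sphere, degrees can be raised by two; so every
    polynomial agrees there with one of this form ([exists_two_degrees]). *)
Definition two_degrees D P := exists A B, [/\ is_homogeneous D A, is_homogeneous D.+1 B &
  forall p, restr P p = restr A p + restr B p].

Lemma two_degrees_leq D E P : (D <= E)%N -> two_degrees D P -> two_degrees E P.
Proof.
move=> DE; rewrite -(subnK DE); elim: (E - D)%N => // k IH /IH[A [B [hA hB h]]].
exists B, (N2 * A); split=> //.
  by rewrite -[(_ + D).+2]add2n; apply: homogM => //; exact: homog_normsqP.
by move=> p; rewrite restr_normsqM addrC h.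
Qed.

Lemma exists_two_degrees P : exists D, two_degrees D P.
Proof.
rewrite (mpoly.mpolyE P); apply: (big_ind (fun P => exists D, two_degrees D P)).
- exists 0%N, 0, 0; split; try exact: homog_0.
  by move=> p; rewrite restr0 addr0.
- move=> P1 P2 [D1 h1] [D2 h2]; exists (maxn D1 D2).
  have [A1 [B1 [hA1 hB1 E1]]] := two_degrees_leq (leq_maxl D1 D2) h1.
  have [A2 [B2 [hA2 hB2 E2]]] := two_degrees_leq (leq_maxr D1 D2) h2.
  exists (A1 + A2), (B1 + B2); split; try exact: homogD.
  by move=> p; rewrite !restrD E1 E2 addrACA.
- move=> s _; exists (mpoly.mdeg s), (mpoly.mcoeff s P *: mpoly.mpolyX _ s), 0; split.
  + by apply: homogZ; rewrite /is_homogeneous mpoly.dhomogX.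
  + exact: homog_0.
  + by move=> p; rewrite restr0 addr0.
Qed.

Lemma antipode_on_sphere p : sqnorm (-1 *: sval p) == 1.
Proof. by rewrite sqnormZ sqrrN expr1n mul1r; exact: (valP p). Qed.

Definition antipode p : S := exist (fun y : 'rV[R]_n.+1 => sqnorm y == 1) _ (antipode_on_sphere p).

Lemma restr_antipode P d p : is_homogeneous d P -> restr P (antipode p) = (-1) ^+ d * restr P p.
Proof. by move=> hP; rewrite /restr (ev_scale _ _ hP) rmorphN rmorph1. Qed.

(** Homogeneous polynomials of consecutive degrees have opposite parities under the
    antipodal map. *)
Lemma parity_split A B D : is_homogeneous D A -> is_homogeneous D.+1 B ->
  (forall p, restr A p + restr B p = 0) -> forall p, restr A p = 0 /\ restr B p = 0.
Proof.
move=> hA hB h p; have h1 := h p; have := h (antipode p).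
rewrite (restr_antipode _ hA) (restr_antipode _ hB) exprS mulN1r mulNr -mulrBr => /eqP.
rewrite mulf_eq0 signr_eq0 subr_eq0 /= => /eqP E.
have : 2 * restr A p = 0 by rewrite mulr_natl mulr2n -{2}[restr A p]opprK; move: h1;
  rewrite E => <-; rewrite -E opprK.
move=> /eqP; rewrite mulf_eq0 pnatr_eq0 /= => /eqP A0.
by rewrite -E A0.
Qed.

Lemma clapD f g p : csmooth f -> csmooth g -> clap (fun p => f p + g p) p = clap f p + clap g p.
Proof.
move=> [f1 f2] [g1 g2]; apply: complex_split; rewrite ?ReCD ?ImCD /=.
  by under [X in lap X]eq_fun do rewrite ReCD; rewrite lapD.
by under [X in lap X]eq_fun do rewrite ImCD; rewrite lapD.
Qed.

(** Split [P] into two homogeneous parts by parity.  The defect of each part from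
    being an eigenfunction is again the restriction of a homogeneous polynomial of
    the same degree, so both parts are eigenfunctions and [harmonic_descent]
    applies to them; the eigenvalue forces equal degrees if neither part is 0. *)
Lemma eigen_harmonic P lam : (forall p, clap (restr P) p = lam * restr P p) ->
  exists d F, [/\ is_homogeneous d F, lapP F = 0, forall p, restr F p = restr P p &
    F = 0 \/ lam = sphere_eigenvalue d].
Proof.
move=> lapE; have [D [A [B [hA hB E]]]] := exists_two_degrees P.
pose defect e Q := N2 * lapP Q + (sphere_eigenvalue e - lam) *: Q.
have hd e Q : is_homogeneous e Q -> is_homogeneous e (defect e Q).
  by move=> hQ; apply: homogD; [exact: homog_normsq_lapP|exact: homogZ].
have dE e Q p : is_homogeneous e Q -> restr (defect e Q) p = clap (restr Q) p - lam * restr Q p.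
  move=> hQ; rewrite restrD restr_normsqM restrZ (clap_restr _ hQ) /sphere_eigenvalue.
  by rewrite mulrBl mulNr addrA.
have fE : restr P = fun p => restr A p + restr B p by apply/funext.
have both := parity_split (hd _ _ hA) (hd _ _ hB).
have zero p : restr (defect D A) p = 0 /\ restr (defect D.+1 B) p = 0.
  apply: both => {}p; rewrite !dE // addrACA -opprD -mulrDr -clapD; try exact: csmooth_restr.
  by rewrite -[X in clap X]fE -E lapE subrr.
have eA p : clap (restr A) p = lam * restr A p.
  by apply/eqP; rewrite -subr_eq0 -(dE _ _ _ hA) (zero p).1.
have eB p : clap (restr B) p = lam * restr B p.
  by apply/eqP; rewrite -subr_eq0 -(dE _ _ _ hB) (zero p).2.
have [d1 [H1 [_ hH1 l1 E1 c1]]] := harmonic_descent hA eA.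
have [d2 [H2 [_ hH2 l2 E2 c2]]] := harmonic_descent hB eB.
case: c1 => [H10|lam1].
  exists d2, H2; split=> // p; rewrite E -E1 H10 restr0 add0r; exact: E2.
case: c2 => [H20|lam2].
  exists d1, H1; split=> //; last by right.
  by move=> p; rewrite E -E2 H20 restr0 addr0.
have d12 : d1 = d2 by apply: sphere_eigenvalue_inj; rewrite -lam1.
exists d1, (H1 + H2); split; last by right.
- by apply: homogD => //; rewrite d12.
- rewrite -[RHS](addr0 0) -{1}l1 -l2 /lapP -big_split /=; apply: eq_bigr => k _.
  by rewrite !mpoly.mderivD.
- by move=> p; rewrite restrD E1 E2 E.
Qed.

Local Notation mf := (@mpoly.mdeg n.+1).
(** Compare homogeneous components: only the component of degree [d - 2] of [H]
    contributes to the component of degree [d] of [|x|^2 H]. *)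
Lemma homog_quotient F H d : is_homogeneous d F -> F = N2 * H ->
  exists H', F = N2 * H' /\ (F = 0 \/ (2 <= d)%N /\ is_homogeneous (d - 2) H').
Proof.
move=> hF FE.
have hH := @mpoly.pihomog_partitionE _ _ mf (mpoly.mmeasure mf H) H (leqnn _).
have FS : F = \sum_(e < mpoly.mmeasure mf H) mpoly.pihomog mf d (N2 * mpoly.pihomog mf e H).
  rewrite -{1}(mpoly.pihomog_dE hF) {1}FE {1}hH mulr_sumr raddf_sum.
  by [].
have h2 e : N2 * mpoly.pihomog mf e H \is mpoly.ishomog1 (2 + e) mf.
  by apply: homogM; [exact: homog_normsqP|exact: mpoly.pihomogP].
have [d2|d2] := ltnP d 2.
  exists H; split=> //; left; rewrite FS big1 // => e _.
  by apply: mpoly.pihomog_ne0 (h2 _); rewrite gtn_eqF // (leq_trans d2) // leq_addr.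
have [dl|dl] := leqP (mpoly.mmeasure mf H) (d - 2).
  exists H; split=> //; left; rewrite FS big1 // => e _.
  apply: mpoly.pihomog_ne0 (h2 _); rewrite neq_ltn; apply/orP; left.
  by rewrite -ltn_subRL (leq_trans (ltn_ord e)).
have h2' := h2 (d - 2)%N; rewrite subnKC // in h2'.
exists (mpoly.pihomog mf (d - 2) H); split; last first.
  by right; split=> //; exact: mpoly.pihomogP.
rewrite FS (bigD1 (Ordinal dl)) //= big1 ?addr0; first by rewrite (mpoly.pihomog_dE h2').
move=> e ed; apply: mpoly.pihomog_ne0 (h2 _).
by apply: contraNneq ed => ed; apply/eqP/val_inj => /=; rewrite -ed addKn.
Qed.

End Descent.

(** * Eigenfunctions on Euclidean space *)

Section Euclid.
Variables (R : realType) (m : nat).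
Local Open Scope complex_scope.
Implicit Types (P : mpoly.mpoly m R[i]) (x : 'rV[R]_m).

Lemma cmetric_euclid x : cmetric (fun=> 1%:M) x = 1%:M :> 'M[R[i]]_m.
Proof. by rewrite /cmetric map_mx1. Qed.

Lemma grad_euclid P x i :
  grad (fun=> 1%:M) (poly_fun P) x 0 i = poly_fun (mpoly.mderiv i P) (x : euclid R m).
Proof.
rewrite /grad mxE cmetric_euclid invmx1 (bigD1 i) //= mxE eqxx mul1r cpartial_poly_fun.
by rewrite big1 ?addr0 // => j /negbTE ji; rewrite mxE eq_sym ji mul0r.
Qed.

Lemma tau_euclid P x : tau (fun=> 1%:M) (poly_fun P) x = poly_fun (lapP P) (x : euclid R m).
Proof.
rewrite /tau /divergence /volume det1 sqrtr1 invr1 mul1r /lapP ev_sum.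
apply: eq_bigr => i _; rewrite -cpartial_poly_fun; congr (cpartial _ i x).
by apply/funext => w; rewrite mul1r grad_euclid.
Qed.

Lemma kappa_euclid P x :
  kappa (fun=> 1%:M) (poly_fun P) (poly_fun P) x = poly_fun (gradsqP P) (x : euclid R m).
Proof.
rewrite /kappa /gradsqP ev_sum; apply: eq_bigr => i _.
rewrite cmetric_euclid (bigD1 i) //= mxE eqxx mul1r !grad_euclid -ev_M -expr2.
by rewrite big1 ?addr0 // => j /negbTE ji; rewrite mxE eq_sym ji !mul0r.
Qed.

Lemma euclid_eigenfunctionP P :
  eigenfunction (euclid R m) 0 0 (poly_fun P) <-> lapP P = 0 /\ gradsqP P = 0.
Proof.
split=> [h|[h1 h2] c x]; last first.
  rewrite !mul0r; split; first by apply: etrans (tau_euclid P x) _; rewrite h1; exact: ev_0.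
  by apply: etrans (kappa_euclid P x) _; rewrite h2; exact: ev_0.
split; apply: poly_fun_eq0 => x; have [h1 h2] := h tt x.
  by apply: etrans (esym (tau_euclid P x)) _; apply: etrans h1 _; exact: mul0r.
by apply: etrans (esym (kappa_euclid P x)) _; apply: etrans h2 _; exact: mul0r.
Qed.

End Euclid.

(** * Conformality and conclusion *)

Section Sphere.
Variables (R : realType) (n : nat).
Hypothesis n2 : (2 <= n)%N.
Local Open Scope complex_scope.
Local Notation MP := (mpoly.mpoly n.+1 R[i]).
Local Notation N2 := (normsqP R n.+1).
Implicit Types (F P H : MP) (f : sphere_point R n -> R[i]) (d e : nat) (lam mu : R[i]).

Let n0 : (0 < n)%N. Proof. exact: ltnW. Qed.

(** If the sum of the squares of the derivatives of [F] is a nonzero multiple of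
    [F ^+ 2] on the sphere, then [|x|^2] divides [F], and [F] agrees on the sphere
    with a harmonic polynomial of smaller degree, so with a different eigenvalue. *)
Lemma conformal_harmonic d F lam mu : is_homogeneous d F -> lapP F = 0 ->
  F = 0 \/ lam = sphere_eigenvalue R n d ->
  (forall p, clap (restr F) p = lam * restr F p) ->
  (forall p, \sum_c cSd c (restr F) p ^+ 2 = mu * restr F p ^+ 2) ->
  gradsqP F = 0.
Proof.
move=> hF lF lamE tauE kappaE.
have gE p : restr (gradsqP F) p = (mu + d%:R ^+ 2) * restr F p ^+ 2.
  by rewrite mulrDl -kappaE (gradsq_restr _ hF) subrK.
have [c0|c0] := eqVneq (mu + d%:R ^+ 2) 0.
  apply: (@homog_restr_eq0 _ _ _ (d.-1 + d.-1)); last by move=> p; rewrite gE c0 mul0r.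
  by apply: homog_sum => k; apply: homogM; exact: homog_deriv.
have sqE : F ^+ 2 = N2 * ((mu + d%:R ^+ 2)^-1 *: gradsqP F).
  apply/eqP; rewrite -subr_eq0 -scalerAr -scaleNr; apply/eqP.
  apply: (@homog_restr_eq0 _ _ _ (d + d)).
    apply: homogD; first exact: homogM.
    by apply: homogZ; exact: homog_normsq_gradsqP.
  move=> p; rewrite restrD restrZ restr_normsqM gE expr2 restrM -expr2.
  by rewrite mulNr mulKf // subrr.
have [H FH] := normsq_dvd_of_sqr n0 sqE.
have [H' [FH' [F0|[d2 hH']]]] := homog_quotient hF FH.
  by rewrite F0 /gradsqP big1 // => k _; rewrite mpoly.mderiv0 expr0n.
have fE : restr H' = restr F by apply/funext => p; rewrite FH' restr_normsqM.
have tauE' p : clap (restr H') p = lam * restr H' p by rewrite fE; exact: tauE.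
have [e [K [ed _ _ KE Kc]]] := harmonic_descent hH' tauE'.
have F0 : F = 0.
  case: lamE => [//|lamd]; case: Kc => [K0|lame].
    by apply: (homog_restr_eq0 hF) => p; rewrite -fE -KE K0 restr0.
  have de : d = e by apply: (sphere_eigenvalue_inj n0 (R := R)); rewrite -lamd -lame.
  by move: ed; rewrite -de leqNgt ltn_subrL (leq_trans _ d2).
by rewrite F0 /gradsqP big1 // => k _; rewrite mpoly.mderiv0 expr0n.
Qed.

Lemma eigen_polynomial f lambda : csmooth f ->
  (forall p, clap f p = lambda * f p) -> exists P, forall p, f p = restr P p.
Proof.
move=> [f1 f2] tauE.
have [] := @eigenpair_polyS R n (complex.Re lambda) (complex.Im lambda)
  (fun p => complex.Re (f p)) (fun p => complex.Im (f p)) n2.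
  split=> // p.
    by have := congr1 (@complex.Re R) (tauE p); rewrite ReCM mulN1r; exact: id.
  by have := congr1 (@complex.Im R) (tauE p); rewrite ImCM addrC; exact: id.
move=> [P PE] [Q QE]; exists (P + (0 +i* 1) *: Q) => p.
rewrite restrD restrZ /restr -PE -QE; apply: complex_split => /=.
  by rewrite !mul0r mul1r subrr addr0.
by rewrite mul0r mul1r !add0r.
Qed.

End Sphere.

Theorem theorem1p3 (R : realType) (n : nat) (hn : (2 <= n)%N)
    (f : sphere R n -> R[i]) (hf : smooth (sphere R n) f) :
  (exists lambda mu : R[i], eigenfunction (sphere R n) lambda mu f) <->
  (exists (d : nat) (P : mpoly.mpoly n.+1 R[i]),
     [/\ is_homogeneous d P,
         forall x : sphere R n, f x = poly_fun P (sval x)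
       & eigenfunction (euclid R n.+1) 0 0 (poly_fun P)]).
Proof.
have cf := smooth_csmooth hf; have n0 : (0 < n)%N := ltnW hn.
split=> [[lambda [mu /(eigenfunctionE _ _ hn cf) h]]|[d [P [hP PE]]]].
  have [P PE] := eigen_polynomial hn cf (fun p => (h p).1).
  have fP : f = restr P by apply/funext.
  have tauE p : clap (restr P) p = lambda * restr P p by rewrite -fP; have [] := h p.
  have [d [F [hF lF FP lamE]]] := eigen_harmonic n0 tauE.
  have fF : f = restr F by apply/funext => p; rewrite FP PE.
  exists d, F; split=> //; first by move=> p; rewrite fF.
  apply/euclid_eigenfunctionP; split=> //.
  apply: (conformal_harmonic hn hF lF lamE (mu := mu)) => p; rewrite -fF; have [] := h p; exact.
move=> /euclid_eigenfunctionP[lP gP].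
have fP : f = restr P by apply/funext.
exists (- (d%:R * (d%:R + n%:R - 1))), (- d%:R ^+ 2).
apply/(eigenfunctionE _ _ hn cf) => p.
rewrite fP (clap_restr _ hP) (gradsq_restr _ hP) lP gP restr0 !sub0r !mulNr.
by split.
Qed.
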